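(* For every constant $L>0$ there exists a constant $c>0$ such that for all primes $p$ and all sets $A,B,C,D\subseteq\mathbb{F}_p$ with $|A|\le|B|$, $|C|\le|D|$ and $|B|\le|D|$ that satisfy \[ |A||B||C||D| > L\,p^{12/5} \qquad\text{and}\qquad |A||B|^4|C|\ \ge\ p^2|D|^2, \] we have \[ |(A-B)(C-D)| > c\,p . \]
   Context: $\mathbb{F}_p$ is the field with $p$ elements, and $(A-B)(C-D)=\{(a-b)(c-d): a\in A,b\in B,c\in C,d\in D\}$. *)

(* Defs.v *)
From HB Require Import structures.
From mathcomp Require Import all_boot all_order all_algebra.

Set Implicit Arguments.
Unset Strict Implicit.
Unset Printing Implicit Defensive.

Import Order.TTheory GRing.Theory Num.Theory.

Local Open Scope ring_scope.

Definition diff_prod (F : finFieldType) (A B C D : {set F}) : {set F} :=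
  [set x : F | [exists a in A, exists b in B, exists c in C, exists d in D,
                  x == (a - b) * (c - d)]].

(* Main.v *)
Require Import Defs.
From HB Require Import structures.
From mathcomp Require Import all_boot all_order all_algebra.
From mathcomp Require Import all_classical all_reals all_analysis.
From mathcomp Require Import fintype finset zify ring lra.

Set Implicit Arguments.
Unset Strict Implicit.
Unset Printing Implicit Defensive.

Import Order.TTheory GRing.Theory Num.Theory.

Local Open Scope ring_scope.

(* Let e(s) be the sum over t of the squared deviations from the mean of the number of x in A
   with s x + t in B. The number of
   solutions of a - b = l (a' - b') in A and B deviates from its mean by at most
   (e(-l) + e(-1/l)) / 2, so the second moment of the number of representations of a nonzero
   x as (a - b)(c - d) is controlled by the sums of e(s)^2 attached to (A, B) and (C, D); the
   two size hypotheses keep these sums below the main term, and Cauchy-Schwarz concludes.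

   The sum of e(s)^2 is bounded through the number of k-rich lines of the grid A x B. The
   coincidence s x + t = s' x' + t' between points x of A carried by rich lines (s, t) is an
   incidence between two families of lines of space: the red ones u = x, w = s v + t and the
   blue ones v = y, w = s' u + t'. Incidences between r red and b blue lines are at most of
   order min(r, b)^(1/2) (r + b), up to the number of lines of a common bilinear surface, by
   the polynomial method: an evenly spread sample of the red lines lies on a surface of low
   degree; lines meeting it too often lie on it; on a prime component with many lines of both
   families the flecnode polynomial vanishes identically, so that the component is ruled in
   both directions and w is a bilinear function of u and v on it. *)

(** * Gauss' lemma for prime elements *)

(** Each red line has its own abscissa x, so a polynomial in u and v that vanishes on many red lines
    has as many roots in u: eliminating w by a resultant replaces any intersection theory in space.
    The pairs (x, line) of a grid repeat both abscissae and slopes; they are moved to general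
    position over the fraction field of [{poly F}], which has the same characteristic. The
    characteristic is the main obstacle. Differentiating surfaces and expanding them along tangents
    needs degrees below p, so only about p^2/4 pairs (x, line) can be treated at once, and the count
    of k-rich lines holds only for k above a threshold. The sum of e(s)^2 is then of order
    p|A|^2|B|^2 + |A|^3|B|^2 (p|B|)^(1/2). For the product of the two second terms to stay below the
    main term, p^6 must be at most of order |A|^2|B|^3|C|^2|D|^3; this follows from the lower bound
    p^(12/5) on |A||B||C||D| and is the origin of that exponent. The other size hypothesis is spent
    on the mixed term with the first summand of (A, B) and the second of (C, D). *)

Definition rdivides (R : idomainType) (a b : R) : Prop := exists c, b = c * a.

Definition prime_elt (R : idomainType) (p : R) : Prop :=
  [/\ p != 0, p \isn't a GRing.unit &
      forall a b, rdivides p (a * b) -> rdivides p a \/ rdivides p b].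

(** Only existence is demanded: with prime rather than irreducible factors, uniqueness is
    automatic. *)
Definition factorial_ring (R : idomainType) : Prop :=
  forall x : R, x != 0 -> exists c : R, exists s : seq R,
    [/\ c \is a GRing.unit, forall p, p \in s -> prime_elt p &
        x = c * \prod_(p <- s) p].

Lemma rdividesC (R : idomainType) (c : R) (f : {poly R}) :
  rdivides c%:P f <-> forall i, rdivides c f`_i.
Proof.
split=> [[g ->] i|H]; first by exists g`_i; rewrite coefMC.
have [h hP] := choice H.
exists (\poly_(i < size f) h i); apply/polyP=> i.
rewrite coefMC coef_poly; case: ltnP => Hi; first exact: hP.
by rewrite nth_default // mul0r.
Qed.

Lemma rdividesD (R : idomainType) (p a b : R) :
  rdivides p a -> rdivides p b -> rdivides p (a + b).
Proof. by move=> [c ->] [d ->]; exists (c + d); rewrite mulrDl. Qed.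

Lemma rdivides_mull (R : idomainType) (p a b : R) :
  rdivides p b -> rdivides p (a * b).
Proof. by move=> [c ->]; exists (a * c); rewrite mulrA. Qed.

Lemma rdivides_mulr (R : idomainType) (p a b : R) :
  rdivides p a -> rdivides p (a * b).
Proof. by rewrite mulrC; exact: rdivides_mull. Qed.

Lemma rdivides_sum (R : idomainType) (p : R) (I : Type) (r : seq I) (P : pred I)
    (f : I -> R) :
  (forall i, P i -> rdivides p (f i)) -> rdivides p (\sum_(i <- r | P i) f i).
Proof.
move=> H; elim/big_ind: _ => //; first by exists 0; rewrite mul0r.
exact: rdividesD.
Qed.

(** If i and j are the first indices at which p fails to divide the coefficients of f and g, then
    the coefficient of index i + j of f g is f_i g_j modulo p. *)
Lemma prime_eltC (R : idomainType) (p : R) : prime_elt p -> prime_elt p%:P.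
Proof.
move=> [p0 pu pP]; split; first by rewrite polyC_eq0.
  by rewrite poly_unitE coefC eqxx negb_and pu orbT.
move=> f g fg.
have [|nf] := EM (rdivides p%:P f); [by left|right].
have [|ng] := EM (rdivides p%:P g); [by []|exfalso].
have ex_min (h : {poly R}) : ~ rdivides p%:P h ->
    exists i, ~ rdivides p h`_i /\ forall j, (j < i)%N -> rdivides p h`_j.
  move=> /rdividesC/existsNP [i0 Hi0].
  have ex : exists i, `[< ~ rdivides p h`_i >] by exists i0; apply/asboolP.
  case: (ex_minnP ex) => i /asboolP Hi Hmin; exists i; split=> // j ji.
  by apply: contrapT => /asboolP /Hmin; rewrite leqNgt ji.
have [i [Hi mi]] := ex_min f nf; have [j [Hj mj]] := ex_min g ng.
have /rdividesC/(_ (i + j)%N) := fg; rewrite coefM.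
have Hlt : (i < (i + j).+1)%N by rewrite ltnS leq_addr.
rewrite (bigD1 (Ordinal Hlt)) //= addKn => H.
have H2 : rdivides p (f`_i * g`_j).
  have -> : f`_i * g`_j = f`_i * g`_j + \sum_(k < (i + j).+1 | k != Ordinal Hlt) f`_k * g`_(i + j - k)
     + - 1 * \sum_(k < (i + j).+1 | k != Ordinal Hlt) f`_k * g`_(i + j - k).
    by rewrite mulN1r addrK.
  apply: rdividesD => //; apply: rdivides_mull; apply: rdivides_sum => k kn.
  have [ki|ik] := ltnP k i; first by apply: rdivides_mulr; apply: mi.
  apply: rdivides_mull; apply: mj.
  have : (i < k)%N.
    rewrite ltn_neqAle ik andbT; apply: contraNneq kn => ik'.
    by apply/eqP; apply: val_inj.
  have := ltn_ord k; rewrite ltnS => kij ik'.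
  by rewrite ltn_subLR // ltn_add2r.
by case: (pP _ _ H2).
Qed.

(** Brings a factorisation that exists up to a scalar, as pseudo-division gives it, back to an exact
    one. Each prime of c divides k or q and is cancelled there, which changes no degree. *)
Lemma gauss_strip (R : idomainType) (c : R) (f k q : {poly R}) :
  factorial_ring R -> c != 0 -> c%:P * f = k * q ->
  exists k' q', f = k' * q' /\ size k' = size k.
Proof.
move=> uR /uR [u [s [uu]]].
elim: s c f k q => [|p s IH] c f k q sP ->.
  rewrite big_nil mulr1 => E.
  exists ((u^-1)%:P * k), q; split; last first.
    by rewrite mul_polyC size_scale // invr_eq0; apply: contraTneq uu => ->; rewrite unitr0.
  by rewrite -mulrA -E mulrA -polyCM mulVr // mul1r.
rewrite big_cons mulrCA => E.
have pp : prime_elt p by apply: sP; rewrite mem_head.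
have sP' q' : q' \in s -> prime_elt q' by move=> Hq; apply: sP; rewrite inE Hq orbT.
have p0 : p%:P != 0 :> {poly R} by case: pp; rewrite polyC_eq0.
have pkq : rdivides p%:P (k * q).
  by exists ((u * \prod_(j <- s) j)%:P * f); rewrite -E polyCM; ring.
have [_ _ /(_ _ _ pkq) []] := prime_eltC pp.
- move=> [k1 k1E]; have E' : (u * \prod_(j <- s) j)%:P * f = k1 * q.
    by apply: (mulfI p0); rewrite [LHS]mulrA -polyCM E k1E; ring.
  have [k' [q' [fE sk]]] := IH _ _ _ _ sP' erefl E'.
  exists k', q'; split=> //; rewrite sk k1E mulrC mul_polyC size_scale //.
  by case: pp.
- move=> [q1 q1E]; have E' : (u * \prod_(j <- s) j)%:P * f = k * q1.
    apply: (mulfI p0); rewrite [LHS]mulrA -polyCM E q1E.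
    by rewrite mulrA mulrC.
  exact: IH _ _ _ _ sP' erefl E'.
Qed.

Definition primitive_poly (R : idomainType) (f : {poly R}) : Prop :=
  forall p : R, prime_elt p -> ~ rdivides p%:P f.

(** Each prime of c divides m f, where m is the quotient, hence divides m because f is primitive;
    the primes of c are cancelled one by one. *)
Lemma primitive_cancel (R : idomainType) (c : R) (f a : {poly R}) :
  factorial_ring R -> c != 0 -> primitive_poly f ->
  rdivides f (c%:P * a) -> rdivides f a.
Proof.
move=> uR /uR [u [s [uu]]].
elim: s c => [|p s IH] c sP ->.
  rewrite big_nil mulr1 => pf [m E].
  exists ((u^-1)%:P * m).
  by rewrite -mulrA -E mulrA -polyCM mulVr // mul1r.
rewrite big_cons mulrCA => pf [m E].
have pp : prime_elt p by apply: sP; rewrite mem_head.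
have sP' q' : q' \in s -> prime_elt q' by move=> Hq; apply: sP; rewrite inE Hq orbT.
have p0 : p%:P != 0 :> {poly R} by case: pp; rewrite polyC_eq0.
apply: (IH _ sP' erefl pf).
have pmf : rdivides p%:P (m * f).
  by exists ((u * \prod_(j <- s) j)%:P * a); rewrite -E polyCM; ring.
have [_ _ /(_ _ _ pmf) []] := prime_eltC pp.
- move=> [m1 m1E]; exists m1; apply: (mulfI p0); rewrite [LHS]mulrA -polyCM E m1E.
  by rewrite mulrAC mulrC.
- by move/(pf _ pp).
Qed.

(** Let f divide a b. If f and a have no common factor of positive degree, their resultant is a
    nonzero constant A f + B a, so f divides that constant times b. Otherwise irreducibility makes
    the gcd proportional to f, so f divides a scalar multiple of a. Primitivity removes the scalar
    in both cases. *)
Lemma irreducible_prime_elt (R : idomainType) (f : {poly R}) :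
  factorial_ring R -> (1 < size f)%N -> primitive_poly f ->
  (forall g h, f = g * h -> (size g <= 1)%N \/ (size h <= 1)%N) ->
  prime_elt f.
Proof.
move=> uR sf pf irr.
have f0 : f != 0 by rewrite -size_poly_gt0 (ltn_trans _ sf).
split=> //; first by rewrite poly_unitE; apply/negP => /andP[/eqP E]; rewrite E in sf.
move=> a b [m E].
have [->|a0] := eqVneq a 0; first by left; exists 0; rewrite mul0r.
have [sa|sa] := leqP (size a) 1.
  right; apply: (@primitive_cancel _ a`_0) => //.
    by apply: contraNneq a0 => a00; rewrite (size1_polyC sa) a00.
  by exists m; rewrite -size1_polyC.
have [sk|sk] := leqP (size (gcdp f a)) 1.
  right; have res : resultant f a != 0 by rewrite resultant_eq0 -leqNgt.
  have [[A B] /= _ AB] := resultant_in_ideal sf sa.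
  apply: (primitive_cancel uR res) => //; exists (A * b + B * m).
  by rewrite AB !mulrDl -!mulrA E [b * f]mulrC.
left; have /Pdiv.Idomain.dvdpP [[c q] /= c0 cq] := dvdp_gcdl f a.
have /Pdiv.Idomain.dvdpP [[c' q2] /= c0' cq2] := dvdp_gcdr f a.
set k := gcdp f a in sk cq cq2.
have cq' : c%:P * f = k * q by rewrite mul_polyC cq mulrC.
have [k' [q' [fE sk']]] := gauss_strip uR c0 cq'.
have k0 : k != 0 by rewrite -size_poly_gt0 (ltn_trans _ sk).
have q0 : q != 0.
  apply: contraNneq f0 => q0; by have /eqP := cq; rewrite q0 mul0r scale_poly_eq0 (negPf c0).
have sq : (size q <= 1)%N.
  case: (irr _ _ fE) => [|sq']; first by rewrite sk' leqNgt sk.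
  have k0' : k' != 0 by apply: contraNneq f0 => k'0; rewrite fE k'0 mul0r.
  have q0' : q' != 0 by apply: contraNneq f0 => q'0; rewrite fE q'0 mulr0.
  have := congr1 (fun z : {poly R} => size z) cq.
  by rewrite size_scale // fE !size_mul // sk'; lia.
apply: (@primitive_cancel _ (q`_0 * c')) => //.
  rewrite mulf_neq0 //; apply: contraNneq q0 => q00.
  by rewrite (size1_polyC sq) q00.
exists (q2 * c%:P); rewrite polyCM -size1_polyC // -!mulrA !mul_polyC cq2 cq.
by rewrite mulrCA.
Qed.

(** A prime constant dividing f divides the leading coefficient, hence is associate to a member of
    s; so f is primitive. It is then either irreducible, hence prime, or a product of two factors of
    smaller positive degree. *)
Lemma factor_primitive (R : idomainType) (n : nat) (f : {poly R}) (c : R) (s : seq R) :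
  factorial_ring R ->
  (forall g : {poly R}, (size g <= n)%N -> g != 0 ->
   exists c : {poly R}, exists s : seq {poly R},
    [/\ c \is a GRing.unit, forall p, p \in s -> prime_elt p &
        g = c * \prod_(p <- s) p]) ->
  (size f <= n.+1)%N -> f != 0 ->
  c \is a GRing.unit -> (forall p, p \in s -> prime_elt p) ->
  lead_coef f = c * \prod_(p <- s) p ->
  ~ (exists p, p \in s /\ rdivides p%:P f) ->
  exists c : {poly R}, exists s : seq {poly R},
    [/\ c \is a GRing.unit, forall p, p \in s -> prime_elt p &
        f = c * \prod_(p <- s) p].
Proof.
move=> uR IHn sf f0 cu sP lf nodiv.
have pf : primitive_poly f.
  move=> q [q0 qu qP] [g fE].
  have [p0 [p0s qp]] : exists p0, p0 \in s /\ rdivides q p0.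
    have : rdivides q (c * \prod_(p <- s) p).
      by rewrite -lf fE lead_coefM lead_coefC; exists (lead_coef g).
    case/qP => [[d dE]|].
      by case/negP: qu; move: cu; rewrite dE unitrM => /andP[].
    elim: (s) => [|p1 s' IH]; first by rewrite big_nil => -[d dE];
      case/negP: qu; have := unitr1 R; rewrite dE unitrM => /andP[].
    rewrite big_cons => /qP[Hq|/IH [p2 [Hp2 Hq]]]; first by exists p1; rewrite mem_head.
    by exists p2; rewrite inE Hp2 orbT.
  have [p00 p0u p0P] := sP _ p0s.
  case: nodiv; exists p0; split=> //; case: qp => d p0E.
  have /p0P [] : rdivides p0 (d * q) by exists 1; rewrite mul1r.
    move=> [e dE]; case/negP: qu; apply/unitrPr; exists e.
    by apply: (mulfI p00); rewrite mulr1 [RHS]p0E dE; ring.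
  by move=> [e qE]; exists (g * e%:P); rewrite fE qE polyCM mulrA.
have [s1|s1] := leqP (size f) 1.
  have /eqP s1' : size f == 1%N by rewrite eqn_leq s1 size_poly_gt0.
  have lfE : lead_coef f = f`_0 by rewrite lead_coefE s1'.
  case: s sP lf {nodiv} => [|q s] sP lf.
    exists f, [::]; split=> //; last by rewrite big_nil mulr1.
    by rewrite poly_unitE s1' eqxx -lfE lf big_nil mulr1.
  case: (pf q); first by apply: sP; rewrite mem_head.
  exists (c * \prod_(p <- s) p)%:P; rewrite -polyCM -mulrA [_ * q]mulrC.
  by move: lf; rewrite big_cons => <-; rewrite lfE -size1_polyC.
have [[g [h [fE sg sh]]]|irr] := EM (exists g h, [/\ f = g * h, (1 < size g)%N & (1 < size h)%N]).
  have g0 : g != 0 by rewrite -size_poly_gt0 (ltn_trans _ sg).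
  have h0 : h != 0 by rewrite -size_poly_gt0 (ltn_trans _ sh).
  have sgh : (size g + size h <= n.+2)%N.
    by move: sf; rewrite fE size_mul // -(ltn_predK sg) addSn /= -addSn.
  have [c1 [s2 [A1 A2 A3]]] := IHn g ltac:(lia) g0.
  have [c2 [s3 [B1 B2 B3]]] := IHn h ltac:(lia) h0.
  exists (c1 * c2), (s2 ++ s3); split; first by rewrite unitrM A1.
    by move=> p; rewrite mem_cat => /orP[/A2|/B2].
  by rewrite fE {1}A3 {1}B3 big_cat /= mulrACA.
exists 1, [:: f]; split; first exact: unitr1; last by rewrite big_seq1 mul1r.
move=> p; rewrite inE => /eqP ->; apply: irreducible_prime_elt => // g h fE.
have [|sg] := leqP (size g) 1; first by left.
have [|sh] := leqP (size h) 1; first by right.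
by case: irr; exists g, h.
Qed.

(** Outer induction on the degree, inner induction on the number of primes of the leading
    coefficient: a prime of that list dividing f is pulled out as a constant factor. *)
Lemma factorial_poly (R : idomainType) :
  factorial_ring R -> factorial_ring {poly R}.
Proof.
move=> uR f; have [n] := ubnP (size f).
elim: n f => // n IHn f; rewrite ltnS => sf f0.
case: n IHn sf => [|n] IHn sf; first by rewrite leqn0 size_poly_eq0 (negPf f0) in sf.
have [c [s [cu sP lf]]] := uR (lead_coef f) ltac:(by rewrite lead_coef_eq0).
have [m sm] := ubnP (size s).
elim: m f s sf f0 sP lf sm => // m IHm f s sf f0 sP lf sm.
have [[p [ps [g fE]]]|] := EM (exists p, p \in s /\ rdivides p%:P f); last first.
  by apply: (factor_primitive uR _ sf f0 cu sP lf) => g gn; apply: IHn.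
have [p0 pu pP] := sP p ps.
have sgf : size f = size g by rewrite fE mulrC mul_polyC size_scale.
have g0 : g != 0 by rewrite -size_poly_gt0 -sgf size_poly_gt0.
have lg : lead_coef g = c * \prod_(q <- rem p s) q.
  apply: (mulIf p0); have := lf; rewrite fE lead_coefM lead_coefC => ->.
  by rewrite (big_rem p) //= mulrCA mulrC.
have sm' : (size (rem p s) < m)%N.
  by rewrite size_rem //; move: sm ps; case: (s) => //= *; lia.
have [c1 [s1 [A1 A2 A3]]] := IHm g (rem p s) ltac:(by rewrite -sgf) g0
  (fun q Hq => sP q (mem_rem Hq)) lg sm'.
exists c1, (p%:P :: s1); split=> //.
  by move=> q; rewrite inE => /orP[/eqP ->|/A2 //]; apply: prime_eltC.
by rewrite fE {1}A3 big_cons -mulrA; congr (_ * _); rewrite mulrC.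
Qed.

Lemma factorial_field (K : fieldType) : factorial_ring K.
Proof.
by move=> x x0; exists x, [::]; split=> //; rewrite ?unitfE // big_nil mulr1.
Qed.

(** * Polynomials in three variables *)

Definition hmorph (R S : comNzRingType) (f : {rmorphism R -> S}) (u : S)
  (p : {poly R}) : S := (map_poly f p).[u].

Lemma hmorph_is_zmod_morphism (R S : comNzRingType) (f : {rmorphism R -> S}) (u : S) :
  zmod_morphism (hmorph f u).
Proof. by move=> p q; rewrite /hmorph rmorphB hornerD hornerN. Qed.

Lemma hmorph_is_monoid_morphism (R S : comNzRingType) (f : {rmorphism R -> S}) (u : S) :
  monoid_morphism (hmorph f u).
Proof.
by split=> [|p q]; rewrite /hmorph ?rmorph1 ?hornerC // rmorphM hornerM.
Qed.

HB.instance Definition _ (R S : comNzRingType) (f : {rmorphism R -> S}) (u : S) :=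
  GRing.isZmodMorphism.Build {poly R} S (hmorph f u) (hmorph_is_zmod_morphism f u).
HB.instance Definition _ (R S : comNzRingType) (f : {rmorphism R -> S}) (u : S) :=
  GRing.isMonoidMorphism.Build {poly R} S (hmorph f u) (hmorph_is_monoid_morphism f u).

Lemma hmorphC (R S : comNzRingType) (f : {rmorphism R -> S}) (u : S) (c : R) :
  hmorph f u c%:P = f c.
Proof. by rewrite /hmorph map_polyC hornerC. Qed.

Lemma hmorphX (R S : comNzRingType) (f : {rmorphism R -> S}) (u : S) :
  hmorph f u 'X = u.
Proof. by rewrite /hmorph map_polyX hornerX. Qed.

Notation poly3 K := {poly {poly {poly K}}}.

(* The variables of [poly3 K], from the innermost to the outermost, are v, u and w. *)
Definition ev3 (K S : comNzRingType) (j : {rmorphism K -> S}) (u v w : S) :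
  poly3 K -> S := hmorph (hmorph (hmorph j v) u) w.

HB.instance Definition _ (K S : comNzRingType) (j : {rmorphism K -> S}) (u v w : S) :=
  GRing.RMorphism.copy (ev3 j u v w) (hmorph (hmorph (hmorph j v) u) w).

Lemma ev3E (K S : comNzRingType) (j : {rmorphism K -> S}) (u v w : S) :
  (forall c, ev3 j u v w c%:P%:P%:P = j c) * (ev3 j u v w 'X%:P%:P = v)
  * (ev3 j u v w 'X%:P = u) * (ev3 j u v w 'X = w).
Proof. by rewrite /ev3; do 3?split; try (move=> c); do 3?rewrite (hmorphC, hmorphX) /=. Qed.

Lemma poly3_ind (K : comNzRingType) (P : poly3 K -> Prop) :
  (forall c, P c%:P%:P%:P) -> P 'X%:P%:P -> P 'X%:P -> P 'X ->
  (forall F G, P F -> P G -> P (F + G)) -> (forall F G, P F -> P G -> P (F * G)) ->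
  forall F, P F.
Proof.
move=> Pc Pv Pu Pw PD PM F.
elim/poly_ind: F => [|F c PF]; first by have := Pc 0; rewrite !polyC0.
apply: (PD); first exact: (PM).
elim/poly_ind: c => [|G d PG]; first by have := Pc 0; rewrite !polyC0.
rewrite polyCD polyCM; apply: (PD); first exact: (PM).
elim/poly_ind: d => [|H e PH]; first by have := Pc 0; rewrite !polyC0.
by rewrite !(polyCD, polyCM); apply: (PD); first exact: (PM).
Qed.

Lemma poly3_ext (K : comNzRingType) (S : nzRingType) (f g : {rmorphism poly3 K -> S}) :
  (forall c, f c%:P%:P%:P = g c%:P%:P%:P) -> f 'X%:P%:P = g 'X%:P%:P ->
  f 'X%:P = g 'X%:P -> f 'X = g 'X -> f =1 g.
Proof.
move=> *; elim/poly3_ind => // F G HF HG; first by rewrite !rmorphD HF HG.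
by rewrite !rmorphM HF HG.
Qed.

Definition swap3 (K : comNzRingType) : poly3 K -> poly3 K := map_poly (@swapXY K).

HB.instance Definition _ (K : comNzRingType) :=
  GRing.RMorphism.copy (@swap3 K) (map_poly (@swapXY K)).

Lemma swap3E (K : comNzRingType) :
  (forall c, swap3 (c%:P%:P%:P : poly3 K) = c%:P%:P%:P) *
  (swap3 ('X%:P%:P : poly3 K) = 'X%:P) * (swap3 ('X%:P : poly3 K) = 'X%:P%:P) *
  (swap3 ('X : poly3 K) = 'X).
Proof.
rewrite /swap3; do 3?split; try (move=> c); rewrite ?map_polyX ?map_polyC //=.
- by rewrite swapXY_polyC map_polyC.
- by rewrite swapXY_Y.
- by rewrite swapXY_X.
Qed.

Lemma swap3K (K : comNzRingType) : involutive (@swap3 K).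
Proof.
move=> F; apply/polyP=> i; rewrite !coef_map /=.
exact: swapXYK.
Qed.

Definition degw (K : fieldType) (F : poly3 K) := (size F).-1.
Definition degu (K : fieldType) (F : poly3 K) := (sizeY F).-1.
Definition degv (K : fieldType) (F : poly3 K) := degu (swap3 F).
(** The sum of the partial degrees, not the total degree: each partial degree is the size of a
    nested polynomial, so additivity on products and bounds under substitution reduce to one
    variable. *)
Definition deg3 (K : fieldType) (F : poly3 K) := (degw F + degu F + degv F)%N.

Lemma degw_swap (K : fieldType) (F : poly3 K) : degw (swap3 F) = degw F.
Proof. by rewrite /degw size_map_inj_poly ?raddf0 //; exact: inv_inj (@swapXYK _). Qed.

Lemma degu_swap (K : fieldType) (F : poly3 K) : degu (swap3 F) = degv F.
Proof. by []. Qed.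

Lemma degv_swap (K : fieldType) (F : poly3 K) : degv (swap3 F) = degu F.
Proof. by rewrite /degv swap3K. Qed.

Lemma deg3_swap (K : fieldType) (F : poly3 K) : deg3 (swap3 F) = deg3 F.
Proof. by rewrite /deg3 degw_swap degu_swap degv_swap -!addnA [(degv F + _)%N]addnC. Qed.

Lemma size_mul_pred (R : idomainType) (p q : {poly R}) : p != 0 -> q != 0 ->
  (size (p * q)).-1 = ((size p).-1 + (size q).-1)%N.
Proof.
move=> p0 q0; rewrite size_mul //.
by move: p0 q0; rewrite -!size_poly_gt0; lia.
Qed.

Lemma degwM (K : fieldType) (F G : poly3 K) : F != 0 -> G != 0 ->
  degw (F * G) = (degw F + degw G)%N.
Proof. exact: size_mul_pred. Qed.

Lemma deguM (K : fieldType) (F G : poly3 K) : F != 0 -> G != 0 ->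
  degu (F * G) = (degu F + degu G)%N.
Proof.
by move=> F0 G0; rewrite /degu !sizeYE rmorphM; apply: size_mul_pred; rewrite swapXY_eq0.
Qed.

Lemma swap3_eq0 (K : fieldType) (F : poly3 K) : (swap3 F == 0) = (F == 0).
Proof. by rewrite (inv_eq (@swap3K K)) raddf0. Qed.

Lemma degvM (K : fieldType) (F G : poly3 K) : F != 0 -> G != 0 ->
  degv (F * G) = (degv F + degv G)%N.
Proof. by move=> F0 G0; rewrite /degv rmorphM deguM ?swap3_eq0. Qed.

Lemma deg3M (K : fieldType) (F G : poly3 K) : F != 0 -> G != 0 ->
  deg3 (F * G) = (deg3 F + deg3 G)%N.
Proof. by move=> F0 G0; rewrite /deg3 degwM ?deguM ?degvM //; lia. Qed.

Lemma size_coef_sizeY (R : nzRingType) (u : {poly {poly R}}) i :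
  ((size u`_i)%R.-1 <= (sizeY u).-1)%N.
Proof. by have := max_size_coefXY u i; lia. Qed.

Lemma degu_coef (K : fieldType) (F : poly3 K) i : ((size F`_i)%R.-1 <= degu F)%N.
Proof. exact: size_coef_sizeY. Qed.

Lemma degv_coef (K : fieldType) (F : poly3 K) i j :
  ((size F`_i`_j)%R.-1 <= degv F)%N.
Proof.
apply: leq_trans (size_coef_sizeY _ _) _; rewrite sizeYE.
have -> : swapXY F`_i = (swap3 F)`_i by rewrite coef_map.
exact: size_coef_sizeY.
Qed.

Lemma size_hmorph (R : comNzRingType) (T : comNzRingType)
    (f : {rmorphism R -> {poly T}}) (u : {poly T}) (p : {poly R}) s :
  (forall i, (size (f p`_i)%R).-1 <= s)%N ->
  ((size (hmorph f u p)).-1 <= s + (size p).-1 * (size u).-1)%N.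
Proof.
move=> Hs; rewrite /hmorph horner_coef -subn1 leq_subLR add1n.
apply: leq_trans (size_sum _ _ _) _; apply/bigmax_leqP => i _; rewrite coef_map /=.
apply: leq_trans (size_polyMleq _ _) _.
have Hi : (i <= (size p).-1)%N.
  by have := leq_trans (ltn_ord i) (size_poly _ _); rewrite -ltnS; lia.
have arith a b x k m : (a.-1 <= s -> b <= (x * k).+1 -> k <= m ->
    (a + b).-1 <= (s + m * x).+1)%N by nia.
exact: arith (Hs i) (size_poly_exp_leq _ _) Hi.
Qed.

(** * Lines on two surfaces without common component *)

Lemma size_det_leq (R : comNzRingType) n (M : 'M[{poly R}]_n) (r : 'I_n -> nat) :
  (forall i j, (size (M i j) <= (r i).+1)%N) ->
  (size (\det M) <= (\sum_i r i).+1)%N.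
Proof.
move=> HM; rewrite /determinant; apply: leq_trans (size_sum _ _ _) _.
apply/bigmax_leqP => s _; rewrite -signr_odd mulr_sign (fun_if (fun q : {poly R} => size q)) size_polyN if_same.
apply: leq_trans (size_poly_prod_leq _ _) _; rewrite leq_subLR addnS ltnS.
have -> : #|xpredT : pred 'I_n| = (\sum_(i < n) 1)%N by rewrite sum1_card.
by rewrite -big_split /=; apply: leq_sum => i _; rewrite add1n; exact: HM.
Qed.

(** The Sylvester matrix has deg q rows of coefficients of p and deg p rows of coefficients of q;
    the degrees of the rows add up in the determinant. *)
Lemma size_resultant_leq (R : comNzRingType) (p q : {poly {poly R}}) :
  ((size (resultant p q)).-1 <=
    (size q).-1 * (sizeY p).-1 + (size p).-1 * (sizeY q).-1)%N.
Proof.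
rewrite -subn1 leq_subLR add1n.
pose r (i : 'I_((size q).-1 + (size p).-1)) :=
  match split i with inl _ => (sizeY p).-1 | inr _ => (sizeY q).-1 end.
have -> : ((size q).-1 * (sizeY p).-1 + (size p).-1 * (sizeY q).-1 = \sum_i r i)%N.
  rewrite big_split_ord /=; congr (_ + _)%N.
    rewrite (eq_bigr (fun=> (sizeY p).-1)) ?sum_nat_const ?card_ord // => i _.
    by rewrite /r; case: split_ordP => k // /eqP; rewrite eq_lrshift.
  rewrite (eq_bigr (fun=> (sizeY q).-1)) ?sum_nat_const ?card_ord // => i _.
  by rewrite /r; case: split_ordP => k // /eqP; rewrite eq_rlshift.
apply: size_det_leq => i j; rewrite Sylvester_mxE /r.
have H (u : {poly {poly R}}) k (b : bool) : (size (u`_k *+ b)%R <= (sizeY u).-1.+1)%N.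
  rewrite mulrb; case: b; last by rewrite size_poly0.
  by apply: leq_trans (max_size_coefXY _ _) _; case: (sizeY u).
case: (split i) => k; exact: H.
Qed.

(** A zero resultant gives a common factor k of positive degree, up to scalars. The prime F divides
    a scalar multiple q k of itself: if F divides q then k is constant, and if F divides k then F
    divides a scalar multiple of G, hence G. *)
Lemma prime_resultant (R : idomainType) (F G : {poly R}) :
  prime_elt F -> (1 < size F)%N -> ~ rdivides F G -> resultant F G != 0.
Proof.
move=> [F0 _ pF] sF nFG; rewrite resultant_eq0 -leqNgt leqNgt; apply/negP => sk.
have constN (c : R) : c != 0 -> ~ rdivides F c%:P.
  move=> c0 [m E]; have m0 : m != 0 by apply: contraNneq c0 => m0; move: E; rewrite m0 mul0r => /polyC_inj ->.
  have := congr1 (fun z : {poly R} => size z) E; rewrite size_polyC c0 size_mul //.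
  by move: sF (size_poly_gt0 m); rewrite m0; lia.
have /Pdiv.Idomain.dvdpP [[c q] /= c0 cq] := dvdp_gcdl F G.
have /Pdiv.Idomain.dvdpP [[c' q2] /= c0' cq2] := dvdp_gcdr F G.
set k := gcdp F G in sk cq cq2.
have /pF : rdivides F (q * k) by exists c%:P; rewrite -cq mul_polyC.
case=> [[m qE]|[m kE]].
  have ckm : c%:P = m * k.
    by apply: (mulIf F0); rewrite mul_polyC cq qE; ring.
  have m0 : m != 0 by apply: contraNneq c0 => m0; move: ckm; rewrite m0 mul0r => /polyC_inj ->.
  have k0 : k != 0 by rewrite -size_poly_gt0; lia.
  have := congr1 (fun z : {poly R} => size z) ckm; rewrite size_polyC c0 size_mul //.
  by move: sk (size_poly_gt0 m); rewrite m0; lia.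
have /pF [/constN|//] : rdivides F (c'%:P * G).
  by exists (q2 * m); rewrite mul_polyC cq2 kE mulrA.
exact.
Qed.

Lemma prime_elimination (R : idomainType) (F G : {poly {poly R}}) :
  prime_elt F -> (1 < size F)%N -> ~ rdivides F G ->
  exists r : {poly R}, exists A B : {poly {poly R}},
  [/\ r != 0, r%:P = A * F + B * G &
     ((size r).-1 <= (size G).-1 * (sizeY F).-1 + (size F).-1 * (sizeY G).-1)%N].
Proof.
move=> pF sF nFG; have [sG|sG] := leqP (size G) 1.
  exists G`_0, 0, 1; rewrite mul0r mul1r add0r -size1_polyC //; split=> //.
    apply/negP => /eqP G0; apply: nFG; exists 0.
    by rewrite (size1_polyC sG) G0 mul0r.
  apply: leq_trans (size_coef_sizeY _ _) _.
  by apply: leq_trans (leq_addl _ _); rewrite leq_pmull //; lia.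
have [[A B] /= _ AB] := resultant_in_ideal sF sG.
exists (resultant F G), A, B; split=> //; first exact: prime_resultant.
exact: size_resultant_leq.
Qed.

(** Restriction to the red line u = x, w = s v + t, as a polynomial in v. Restriction to a blue line
    is the same map composed with [swap3]. *)
Definition on_line (K : comNzRingType) (x s t : K) : poly3 K -> {poly K} :=
  ev3 polyC x%:P 'X (s%:P * 'X + t%:P).

HB.instance Definition _ (K : comNzRingType) (x s t : K) :=
  GRing.RMorphism.copy (on_line x s t) (ev3 polyC x%:P 'X (s%:P * 'X + t%:P)).

Lemma on_line_polyC (K : comNzRingType) (x s t : K) (r : {poly {poly K}}) :
  on_line x s t r%:P = r.[x%:P].
Proof.
rewrite /on_line /ev3 hmorphC /= /hmorph; congr horner.
apply/polyP=> i; rewrite coef_map /=.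
exact: comp_polyXr.
Qed.

(** Here r is a polynomial in u over the domain of polynomials in v, and the abscissae are constant
    roots; injectivity of x turns roots into lines. *)
Lemma card_roots (K : fieldType) (I : finType) (x : I -> K) (P : {set I})
   (r : {poly {poly K}}) :
  injective x -> r != 0 -> {in P, forall i, r.[(x i)%:P] = 0} ->
  (#|P| <= (size r).-1)%N.
Proof.
move=> xi r0 HP.
have := max_poly_roots (rs := [seq (x i)%:P | i <- enum P]) r0.
rewrite size_map -cardE map_inj_uniq ?enum_uniq; last by move=> i j /polyC_inj /xi.
have -> : all (root r) [seq (x i)%:P | i <- enum P].
  by apply/allP => _ /mapP[i iP ->]; apply/rootP/HP; rewrite -mem_enum.
by move=> /(_ isT isT); case: (size r).
Qed.

(** The eliminant r(u, v) = A F + B G is nonzero and r(x, v) vanishes identically for every common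
    red line, so its degree in u bounds their number. *)
Lemma card_common_lines (K : fieldType) (I : finType) (x s t : I -> K) (P : {set I})
   (F G : poly3 K) :
  injective x -> prime_elt F -> (1 < size F)%N -> ~ rdivides F G ->
  {in P, forall i, on_line (x i) (s i) (t i) F = 0 /\ on_line (x i) (s i) (t i) G = 0} ->
  (#|P| <= degw G * degu F + degw F * degu G)%N.
Proof.
move=> xi pF sF nFG HP.
have [r [A [B [r0 rE sr]]]] := prime_elimination pF sF nFG.
apply: leq_trans (card_roots (x := x) xi r0 _) sr => i /HP [HF HG].
by rewrite -(on_line_polyC _ (s i) (t i)) rE rmorphD !rmorphM /= HF HG !mulr0 addr0.
Qed.

Lemma card_lines_size1 (K : fieldType) (I : finType) (x s t : I -> K) (P : {set I})
   (F : poly3 K) :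
  injective x -> F != 0 -> (size F <= 1)%N ->
  {in P, forall i, on_line (x i) (s i) (t i) F = 0} -> (#|P| <= degu F)%N.
Proof.
move=> xi F0 sF HP; have FE := size1_polyC sF.
apply: leq_trans (degu_coef F 0).
apply: (card_roots (x := x)) => // [|i /HP].
  by apply: contraNneq F0 => F00; rewrite FE F00.
by rewrite FE on_line_polyC coefC eqxx.
Qed.

(** * Flecnode polynomial and ruled surfaces *)

Definition dw (K : comNzRingType) (F : poly3 K) : poly3 K := F^`().
Definition du (K : comNzRingType) (F : poly3 K) : poly3 K := swapXY (swapXY F)^`().

Lemma dwD (K : comNzRingType) (F G : poly3 K) : dw (F + G) = dw F + dw G.
Proof. exact: derivD. Qed.
Lemma dwM (K : comNzRingType) (F G : poly3 K) : dw (F * G) = dw F * G + F * dw G.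
Proof. exact: derivM. Qed.
Lemma duD (K : comNzRingType) (F G : poly3 K) : du (F + G) = du F + du G.
Proof. by rewrite /du rmorphD derivD rmorphD. Qed.
Lemma duM (K : comNzRingType) (F G : poly3 K) : du (F * G) = du F * G + F * du G.
Proof. by rewrite /du rmorphM derivM rmorphD !rmorphM /= !swapXYK. Qed.

Lemma dwE (K : comNzRingType) :
  (forall c : {poly {poly K}}, dw c%:P = 0) * (dw ('X : poly3 K) = 1).
Proof. by rewrite /dw; split=> [c|]; rewrite ?derivC ?derivX. Qed.

Lemma duE (K : comNzRingType) :
  (forall c : K, du (c%:P%:P%:P : poly3 K) = 0) * (du ('X%:P%:P : poly3 K) = 0) *
  (du ('X%:P : poly3 K) = 1) * (du ('X : poly3 K) = 0).
Proof.
rewrite /du; do 3?split; try move=> c.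
- by rewrite swapXY_polyC map_polyC derivC raddf0.
- by rewrite swapXY_polyC map_polyC derivC raddf0.
- by rewrite swapXY_Y derivX rmorph1.
- by rewrite swapXY_X derivC raddf0.
Qed.

Lemma chain_rule (K S : comNzRingType) (e : {rmorphism poly3 K -> S}) (d : S -> S) :
  (forall a b, d (a + b) = d a + d b) -> (forall a b, d (a * b) = d a * b + a * d b) ->
  (forall c, d (e c%:P%:P%:P) = 0) -> d (e 'X%:P%:P) = 0 ->
  forall F, d (e F) = e (du F) * d (e 'X%:P) + e (dw F) * d (e 'X).
Proof.
move=> dD dM dc dv.
have e0 : e 0 = 0 by exact: rmorph0.
have uu : e (du 'X%:P) = 1 by rewrite duE; exact: rmorph1.
have ww : e (dw 'X) = 1 by rewrite dwE; exact: rmorph1.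
elim/poly3_ind => [c||||F G HF HG|F G HF HG].
- by rewrite dc duE dwE e0 !mul0r addr0.
- by rewrite dv duE dwE e0 !mul0r addr0.
- by rewrite uu dwE e0 mul0r mul1r addr0.
- by rewrite ww duE e0 mul0r mul1r add0r.
- by rewrite duD dwD !rmorphD dD HF HG; ring.
- by rewrite duM dwM !(rmorphD, rmorphM) dM HF HG /=; ring.
Qed.

(* The second derivative of [F] along the tangent direction of the slice [v = const]; it
   vanishes on a line of the surface contained in such a slice. *)
Definition flecnode (K : comNzRingType) (F : poly3 K) : poly3 K :=
  dw F ^+ 2 * du (du F) - dw F * du F * (du (dw F) + dw (du F))
  + du F ^+ 2 * dw (dw F).

(** Differentiating [e F = 0] once along a line of slope s gives F_u = - s F_w; differentiating
    again with [d s = 0] gives F_uu in terms of the other second derivatives. Substituting both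
    cancels the flecnode polynomial. *)
Lemma flecnode_kernel (K S : comNzRingType) (e : {rmorphism poly3 K -> S})
    (d : S -> S) (s : S) (F : poly3 K) :
  (forall a b, d (a + b) = d a + d b) -> (forall a b, d (a * b) = d a * b + a * d b) ->
  (forall c, d (e c%:P%:P%:P) = 0) -> d (e 'X%:P%:P) = 0 ->
  d (e 'X%:P) = 1 -> d (e 'X) = s -> d s = 0 ->
  e F = 0 -> e (flecnode F) = 0.
Proof.
move=> dD dM dc dv dU dW ds eF.
have d0 : d 0 = 0 by apply: (addrI (d 0)); rewrite -dD !addr0.
have ch (G : poly3 K) : d (e G) = e (du G) + e (dw G) * s.
  by rewrite (chain_rule dD dM dc dv) dU dW mulr1.
have E1 : e (du F) = - (e (dw F) * s).
  by apply/eqP; rewrite -addr_eq0 -ch eF d0.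
have := ch (du F); rewrite E1 -mulN1r !dM ds.
have -> : d (-1) = 0.
  apply: (addrI (d 1)); rewrite -dD subrr d0 addr0.
  by have := dM 1 1; rewrite !mulr1 mul1r -{1}[d 1]addr0 => /addrI <-.
rewrite ch => E2.
have E3 : e (du (du F)) = - ((e (du (dw F)) + e (dw (dw F)) * s) * s) - e (dw (du F)) * s.
  by apply: (addIr (e (dw (du F)) * s)); rewrite -E2; ring.
rewrite /flecnode !(rmorphD, rmorphN, rmorphM, rmorphXn) E1 E3.
by ring.
Qed.

Lemma flecnode_on_line (K : comNzRingType) (y s t : K) (F : poly3 K) :
  on_line y s t (swap3 F) = 0 -> on_line y s t (swap3 (flecnode F)) = 0.
Proof.
apply: (@flecnode_kernel _ _ (on_line y s t \o @swap3 K) (@deriv K) s%:P F) => /=.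
- exact: derivD.
- exact: derivM.
- by move=> c; rewrite swap3E /on_line ev3E derivC.
- by rewrite swap3E /on_line ev3E derivC.
- by rewrite swap3E /on_line ev3E derivX.
- by rewrite swap3E /on_line ev3E derivD derivM !derivC derivX mul0r add0r mulr1 addr0.
- exact: derivC.
Qed.

(** The extension of a derivation of T to [{poly T}] that kills the variable. *)
Definition coef_derivation (T : nzRingType) (D : T -> T) (G : {poly T}) : {poly T} :=
  \poly_(i < size G) D G`_i.

Lemma coef_coef_derivation (T : nzRingType) (D : T -> T) (G : {poly T}) i :
  D 0 = 0 -> (coef_derivation D G)`_i = D G`_i.
Proof. by move=> D0; rewrite coef_poly; case: ltnP => // Hi; rewrite nth_default. Qed.

Lemma coef_derivationD (T : nzRingType) (D : T -> T) (G H : {poly T}) :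
  D 0 = 0 -> (forall a b, D (a + b) = D a + D b) ->
  coef_derivation D (G + H) = coef_derivation D G + coef_derivation D H.
Proof.
by move=> D0 DD; apply/polyP=> i; rewrite coefD !coef_coef_derivation // coefD DD.
Qed.

Lemma coef_derivationM (T : nzRingType) (D : T -> T) (G H : {poly T}) :
  D 0 = 0 -> (forall a b, D (a + b) = D a + D b) ->
  (forall a b, D (a * b) = D a * b + a * D b) ->
  coef_derivation D (G * H) = coef_derivation D G * H + G * coef_derivation D H.
Proof.
move=> D0 DD DM; apply/polyP=> i.
rewrite coefD !coefM coef_coef_derivation // coefM.
rewrite (big_morph D DD D0) -big_split /=; apply: eq_bigr => j _.
by rewrite DM !coef_coef_derivation.
Qed.

Lemma coef_derivationC (T : nzRingType) (D : T -> T) (a : T) :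
  D 0 = 0 -> coef_derivation D a%:P = (D a)%:P.
Proof.
by move=> D0; apply/polyP=> i; rewrite coef_coef_derivation // !coefC; case: ifP.
Qed.

Lemma coef_derivationX (T : nzRingType) (D : T -> T) :
  D 0 = 0 -> D 1 = 0 -> coef_derivation D 'X = 0.
Proof.
by move=> D0 D1; apply/polyP=> i; rewrite coef_coef_derivation // coefX coef0; case: eqP.
Qed.

(* A differential equation modulo a prime [F] for a polynomial whose constant term
   is divisible by [F] propagates the divisibility to all the coefficients. *)
Lemma prime_divides_coefs (T : idomainType) (F X Y P : T) (D : T -> T) (G H : {poly T}) :
  prime_elt F -> ~ rdivides F X -> rdivides F P -> D 0 = 0 ->
  (forall a, rdivides F a -> rdivides F (D a)) ->
  X%:P * coef_derivation D G = (X%:P + 'X * Y%:P) * G^`() - 'X * P%:P * H ->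
  (forall i, (0 < i < size G)%N -> (i%:R : T) \is a GRing.unit) ->
  rdivides F G`_0 -> forall i, rdivides F G`_i.
Proof.
move=> [_ _ pF] nFX FP D0 FD E charG F0; elim=> // i IH.
have [si|si] := leqP (size G) i.+1; first by exists 0; rewrite nth_default // mul0r.
have := congr1 (fun p : {poly T} => p`_i) E.
rewrite coefCM coef_coef_derivation // coefB mulrDl coefD coefCM coef_deriv.
rewrite -mulrA coefXM -mulrA coefXM !coefCM coef_deriv => Ei.
have FiX : rdivides F (X * (G`_i.+1 *+ i.+1)).
  have -> : X * (G`_i.+1 *+ i.+1) = X * D G`_i
      - (if i == 0%N then 0 else Y * (G`_i.-1.+1 *+ i.-1.+1))
      + (if i == 0%N then 0 else P * H`_i.-1) by rewrite Ei [X in X + _]addrAC addrK subrK.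
  apply: rdividesD; last first.
    case: eqP => _; first by exists 0; rewrite mul0r.
    exact: rdivides_mulr.
  apply: rdividesD; first by apply: rdivides_mull; apply: FD.
  rewrite -mulN1r; apply: rdivides_mull.
  case: eqP => [_|/eqP i0]; first by exists 0; rewrite mul0r.
  rewrite prednK ?lt0n // -mulr_natl mulrA; exact: rdivides_mull.
case: (pF _ _ FiX) => // -[m mE].
have u := charG i.+1 si.
by exists (i.+1%:R^-1 * m); rewrite -mulrA -mE -[_`_i.+1 *+ _]mulr_natl mulrA mulVr // mul1r.
Qed.

(** Evaluation at (u + z X, v, w + z Y), where z is the new polynomial variable: a Taylor expansion
    along (X, Y) whose coefficients involve no division by factorials. *)
Definition along (K T : comNzRingType) (j : {rmorphism K -> T}) (u v w X Y : T) :
  poly3 K -> {poly T} :=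
  ev3 (polyC \o j) (u%:P + 'X * X%:P) v%:P (w%:P + 'X * Y%:P).

HB.instance Definition _ (K T : comNzRingType) (j : {rmorphism K -> T}) (u v w X Y : T) :=
  GRing.RMorphism.copy (along j u v w X Y)
   (ev3 (polyC \o j) (u%:P + 'X * X%:P) v%:P (w%:P + 'X * Y%:P)).

Lemma alongE (K T : comNzRingType) (j : {rmorphism K -> T}) (u v w X Y : T) :
  (forall c : K, along j u v w X Y c%:P%:P%:P = (j c)%:P) *
  (along j u v w X Y 'X%:P%:P = v%:P) *
  (along j u v w X Y 'X%:P = u%:P + 'X * X%:P) *
  (along j u v w X Y 'X = w%:P + 'X * Y%:P).
Proof. by rewrite /along; do 3?split; try move=> c; rewrite ev3E. Qed.

Lemma deriv_along (K T : comNzRingType) (j : {rmorphism K -> T}) (u v w X Y : T)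
    (F : poly3 K) :
  let e := along j u v w X Y in
  (e F)^`() = e (du F) * X%:P + e (dw F) * Y%:P.
Proof.
move=> e; have dline (a b : T) : (a%:P + 'X * b%:P)^`() = b%:P.
  by rewrite derivD derivM !derivC derivX mulr0 addr0 mul1r add0r.
rewrite (chain_rule (e := e) (d := @deriv T)).
- by rewrite /e /= !alongE !dline.
- exact: derivD.
- exact: derivM.
- by move=> c; rewrite /e /= alongE derivC.
- by rewrite /e /= alongE derivC.
Qed.

(* If the derivation [D] maps the coordinates [(u, w)] to [(X, Y)], then
   [coef_derivation D] and the derivative in the new variable differ on [along] by the
   variation of [(X, Y)] itself, which is proportional to [(X, Y)] modulo [P]. *)
Lemma coef_derivation_along (K T : comNzRingType) (j : {rmorphism K -> T})
    (u v w X Y : T) (D : T -> T) (F : poly3 K) :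
  (forall a b, D (a + b) = D a + D b) -> (forall a b, D (a * b) = D a * b + a * D b) ->
  (forall c, D (j c) = 0) -> D v = 0 -> D u = X -> D w = Y ->
  let e := along j u v w X Y in
  X%:P * coef_derivation D (e F) =
  (X%:P + 'X * (D X)%:P) * (e F)^`() - 'X * (D X * Y - D Y * X)%:P * e (dw F).
Proof.
move=> DD DM Dj Dv Du Dw e.
have D0 : D 0 = 0 by apply: (addrI (D 0)); rewrite -DD !addr0.
have D1 : D 1 = 0.
  by have := DM 1 1; rewrite !mulr1 mul1r -{1}[D 1]addr0 => /addrI <-.
have cD := coef_derivationD _ _ D0 DD.
have cM := coef_derivationM _ _ D0 DD DM.
have -> : coef_derivation D (e F) =
    e (du F) * (X%:P + 'X * (D X)%:P) + e (dw F) * (Y%:P + 'X * (D Y)%:P).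
  rewrite (chain_rule (e := e) (d := coef_derivation D)) //.
  - rewrite /e /= !alongE !cD !cM !coef_derivationC // coef_derivationX //.
    by rewrite Du Dw !mul0r !add0r.
  - by move=> c; rewrite /e /= alongE coef_derivationC // Dj.
  - by rewrite /e /= alongE coef_derivationC // Dv.
rewrite deriv_along -/e polyCB !polyCM; ring.
Qed.

(* The derivation along the tangent vector field [(F_w, - F_u)] of the slices of [F = 0]. *)
Definition tangent (K : comNzRingType) (F G : poly3 K) : poly3 K :=
  dw F * du G - du F * dw G.

Lemma tangentD (K : comNzRingType) (F a b : poly3 K) :
  tangent F (a + b) = tangent F a + tangent F b.
Proof. by rewrite /tangent duD dwD; ring. Qed.

Lemma tangentM (K : comNzRingType) (F a b : poly3 K) :
  tangent F (a * b) = tangent F a * b + a * tangent F b.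
Proof. by rewrite /tangent duM dwM; ring. Qed.

Lemma tangent_self (K : comNzRingType) (F : poly3 K) : tangent F F = 0.
Proof. by rewrite /tangent mulrC subrr. Qed.

Lemma tangent0 (K : comNzRingType) (F : poly3 K) : tangent F 0 = 0.
Proof. by apply: (addrI (tangent F 0)); rewrite -tangentD !addr0. Qed.

Lemma tangent_coord (K : comNzRingType) (F : poly3 K) :
  (tangent F 'X%:P = dw F) * (tangent F 'X = - du F) *
  (forall c : K, tangent F c%:P%:P%:P = 0) * (tangent F 'X%:P%:P = 0).
Proof.
rewrite /tangent; do 3?split; try move=> c; rewrite duE dwE.
- by rewrite mulr1 mulr0 subr0.
- by rewrite mulr0 mulr1 sub0r.
- by rewrite !mulr0 subr0.
- by rewrite !mulr0 subr0.
Qed.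

Definition poly3C (K : comNzRingType) (c : K) : poly3 K := c%:P%:P%:P.

HB.instance Definition _ (K : comNzRingType) :=
  GRing.RMorphism.copy (@poly3C K) (polyC \o polyC \o polyC).

Definition uvar (K : comNzRingType) : poly3 K := 'X%:P.
Definition vvar (K : comNzRingType) : poly3 K := 'X%:P%:P.
Definition wvar (K : comNzRingType) : poly3 K := 'X.

(** The expansion at the generic point (u, v, w) along the tangent of the slice of F = 0. *)
Definition along_tangent (K : comNzRingType) (F : poly3 K) :=
  @along K {poly {poly {poly K}}} (@poly3C K) (uvar K) (vvar K) (wvar K) (dw F) (- du F).

(** The flecnode polynomial is the determinant of the tangent field and its derivative along itself:
    it measures how far the slices are from straight lines. *)
Lemma flecnode_tangent (K : comNzRingType) (F : poly3 K) :
  tangent F (dw F) * (- du F) - tangent F (- du F) * dw F = flecnode F.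
Proof.
rewrite -[- du F as X in tangent F X]mulN1r tangentM.
have -> : tangent F (-1) = 0.
  by have := (tangent_coord F).1.2 (-1); rewrite !polyCN !polyC1.
by rewrite /flecnode /tangent; ring.
Qed.

Lemma tangent_equation (K : comNzRingType) (F : poly3 K) :
  (dw F)%:P * coef_derivation (tangent F) (along_tangent F F) =
  ((dw F)%:P + 'X * (tangent F (dw F))%:P) * (along_tangent F F)^`()
  - 'X * (flecnode F)%:P * along_tangent F (dw F).
Proof.
rewrite -flecnode_tangent; apply: coef_derivation_along.
- exact: tangentD.
- exact: tangentM.
- by move=> c; rewrite tangent_coord.
- by rewrite tangent_coord.
- by rewrite tangent_coord.
- by rewrite tangent_coord.
Qed.

Lemma size_ev3 (K : fieldType) (T : comNzRingType) (j : {rmorphism K -> {poly T}})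
    (u v w : {poly T}) (F : poly3 K) :
  (forall c, (size (j c) <= 1)%N) ->
  ((size (ev3 j u v w F)).-1 <=
    degv F * (size v).-1 + degu F * (size u).-1 + degw F * (size w).-1)%N.
Proof.
move=> Hj.
have Hv i k : ((size (hmorph j v F`_i`_k)).-1 <= degv F * (size v).-1)%N.
  apply: leq_trans (size_hmorph (s := 0) v _) _ => [l|].
    by have := Hj (F`_i`_k`_l); case: (size _) => [|[|]].
  by rewrite add0n leq_mul2r degv_coef orbT.
have Hu i : ((size (hmorph (hmorph j v) u F`_i)).-1 <=
    degv F * (size v).-1 + degu F * (size u).-1)%N.
  apply: leq_trans (size_hmorph u (Hv i)) _.
  by rewrite leq_add2l leq_mul2r degu_coef orbT.
exact: size_hmorph.
Qed.

Lemma dw_neq0 (K : fieldType) (F : poly3 K) :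
  (1 < size F)%N -> ((degw F)%:R : K) != 0 -> dw F != 0.
Proof.
move=> sF c0; apply: contra_neq (_ : F`_(degw F) != 0) => [dF|]; last first.
  by rewrite -lead_coefE lead_coef_eq0 -size_poly_gt0; apply: leq_trans sF.
have := congr1 (fun p : poly3 K => p`_(degw F).-1) dF.
rewrite coef_deriv coef0 prednK; last by rewrite /degw; case: (size F) sF => [|[|]].
rewrite -mulr_natl => /eqP; rewrite mulf_eq0 => /orP[|/eqP //].
have -> : ((degw F)%:R : {poly {poly K}}) = ((degw F)%:R : K)%:P%:P.
  by rewrite !rmorph_nat.
by rewrite !polyC_eq0 (negPf c0).
Qed.

Lemma size_leq_mull (R : idomainType) (m F : {poly R}) : m != 0 -> F != 0 ->
  (size F <= size (m * F)%R)%N.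
Proof.
move=> m0 F0; rewrite size_mul //; move: m0; rewrite -size_poly_gt0.
by case: (size m) => // k _; rewrite addSn leq_addl.
Qed.

Lemma ndivides_dw (K : fieldType) (F : poly3 K) :
  (1 < size F)%N -> ((degw F)%:R : K) != 0 -> ~ rdivides F (dw F).
Proof.
move=> sF c0 [m E]; have d0 := dw_neq0 sF c0.
have F0 : F != 0 by rewrite -size_poly_gt0; apply: leq_trans sF.
have m0 : m != 0 by apply: contra_neq d0 => m0; rewrite E m0 mul0r.
have : (size (m * F)%R < size F)%N by rewrite -E; apply: lt_size_deriv.
by rewrite ltnNge size_leq_mull.
Qed.

Lemma size_along_tangent (K : fieldType) (F : poly3 K) :
  ((size (along_tangent F F)).-1 <= degu F + degw F)%N.
Proof.
have line (a b : poly3 K) : (size (a%:P + 'X * b%:P)%R <= 2)%N.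
  rewrite addrC [_ * _]mulrC size_MXaddC size_polyC.
  by case: ifP => //; case: (b != 0).
rewrite /along_tangent /along.
apply: leq_trans (size_ev3 _ _ _ _ _) _ => [c|]; first exact: size_polyC_leq1.
rewrite size_polyC -[X in (_ <= X)%N]add0n -addnA; apply: leq_add.
  by case: (_ != 0); rewrite muln0.
by apply: leq_add; rewrite -[X in (_ <= X)%N]muln1 leq_mul2l;
  apply/orP; right; rewrite -subn1 leq_subLR; apply: line.
Qed.

(** The tangents of the slices at the points of F = 0 stay on F = 0. The constant term of the
    expansion is F itself, and modulo F the differential equation [tangent_equation] loses its error
    term. The integers to be inverted are at most the degree of the expansion, hence at most
    [deg3 F]. *)
Lemma rdivides_along_tangent (K : fieldType) (F : poly3 K) :
  prime_elt F -> (1 < size F)%N -> rdivides F (flecnode F) ->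
  (forall i, (0 < i <= deg3 F)%N -> (i%:R : K) != 0) ->
  forall i, rdivides F (along_tangent F F)`_i.
Proof.
move=> pF sF Fl char.
have nF : ~ rdivides F (dw F).
  apply: ndivides_dw => //; apply: char; rewrite /deg3 -addnA leq_addr andbT.
  by rewrite /degw; case: (size F) sF => [|[|]].
apply: (prime_divides_coefs pF nF Fl _ _ (tangent_equation F)).
- exact: tangent0.
- move=> _ [m ->]; exists (tangent F m).
  by rewrite tangentM tangent_self mulr0 addr0.
- move=> i /andP[i0 si].
  have -> : (i%:R : poly3 K) = poly3C (i%:R : K) by rewrite /poly3C !rmorph_nat.
  apply: rmorph_unit; rewrite unitfE char // i0 /=.
  have := size_along_tangent F; rewrite /deg3 => Hs.
  apply: leq_trans (leq_trans (_ : (i <= (size (along_tangent F F)).-1)%N) Hs) _.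
    by move: si; case: (size _).
  by rewrite [(degu F + _)%N]addnC leq_addr.
(* At parameter 0 the expansion is a ring morphism fixing the generators, hence the identity. *)
- exists 1; rewrite mul1r -horner_coef0.
  pose e : {rmorphism poly3 K -> poly3 K} :=
    horner_eval (0 : poly3 K) \o @along K {poly {poly {poly K}}} (@poly3C K) (uvar K) (vvar K) (wvar K) (dw F) (- du F).
  rewrite -[LHS]/(e F); apply: (poly3_ext (f := e) (g := idfun)) => [c|||] /=;
    by rewrite /horner_eval alongE ?hornerD ?hornerM ?hornerX ?hornerC ?mul0r ?addr0.
Qed.

Lemma on_lineN (K : comNzRingType) (x s t : K) (F : poly3 K) :
  on_line x s t (- F) = - on_line x s t F.
Proof.
pose e : {rmorphism poly3 K -> {poly K}} := on_line x s t.
by rewrite -![on_line _ _ _ _]/(e _) rmorphN.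
Qed.

(** Moves the base point of the expansion from the generic point to the points of a red line; both
    sides are ring morphisms in G, compared on generators. *)
Lemma along_tangent_on_line (K : comNzRingType) (x s t : K) (F G : poly3 K) :
  map_poly (on_line x s t) (along_tangent F G) =
  along (@polyC K) x%:P 'X (s%:P * 'X + t%:P) (on_line x s t (dw F))
    (- on_line x s t (du F)) G.
Proof.
pose e1 : {rmorphism poly3 K -> {poly poly3 K}} :=
  @along K {poly {poly {poly K}}} (@poly3C K) (uvar K) (vvar K) (wvar K) (dw F) (- du F).
pose e2 : {rmorphism {poly poly3 K} -> {poly {poly K}}} := map_poly (on_line x s t).
pose e3 : {rmorphism poly3 K -> {poly {poly K}}} :=
  along (@polyC K) x%:P 'X (s%:P * 'X + t%:P) (on_line x s t (dw F))
    (- on_line x s t (du F)).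
have e2C a : e2 a%:P = (on_line x s t a)%:P by rewrite /e2 /= map_polyC.
have e2X : e2 'X = 'X by rewrite /e2 /= map_polyX.
have e2D a b : e2 (a + 'X * b%:P) = e2 a + 'X * (on_line x s t b)%:P.
  by rewrite [e2 _]rmorphD; congr (_ + _); rewrite [e2 _]rmorphM e2X e2C.
have olc c : on_line x s t (poly3C c) = c%:P by rewrite /on_line ev3E.
have olu : on_line x s t (uvar K) = x%:P by rewrite /on_line ev3E.
have olv : on_line x s t (vvar K) = 'X by rewrite /on_line ev3E.
have olw : on_line x s t (wvar K) = s%:P * 'X + t%:P by rewrite /on_line ev3E.
have oln : on_line x s t (- du F) = - on_line x s t (du F) by exact: on_lineN.
have e1c c : e1 c%:P%:P%:P = (poly3C c)%:P by exact: (alongE _ _ _ _ _ _).1.1.1.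
have e1v : e1 'X%:P%:P = (vvar K)%:P by exact: (alongE _ _ _ _ _ _).1.1.2.
have e1u : e1 'X%:P = (uvar K)%:P + 'X * (dw F)%:P by exact: (alongE _ _ _ _ _ _).1.2.
have e1w : e1 'X = (wvar K)%:P + 'X * (- du F)%:P by exact: (alongE _ _ _ _ _ _).2.
rewrite -[LHS]/(e2 (e1 G)) -[RHS]/(e3 G).
apply: (poly3_ext (f := e2 \o e1) (g := e3)) => [c|||].
- by rewrite -[LHS]/(e2 (e1 _)) e1c e2C olc; symmetry; exact: (alongE _ _ _ _ _ _).1.1.1.
- by rewrite -[LHS]/(e2 (e1 _)) e1v e2C olv; symmetry; exact: (alongE _ _ _ _ _ _).1.1.2.
- by rewrite -[LHS]/(e2 (e1 _)) e1u e2D e2C olu; symmetry; exact: (alongE _ _ _ _ _ _).1.2.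
- by rewrite -[LHS]/(e2 (e1 _)) e1w e2D e2C olw oln; symmetry; exact: (alongE _ _ _ _ _ _).2.
Qed.

Lemma along_inner (K : comNzRingType) (x w X Y : {poly K}) (r : {poly {poly K}}) :
  along (@polyC K) x 'X w X Y r%:P = r \Po (x%:P + 'X * X%:P).
Proof.
rewrite /along /ev3 hmorphC /= /hmorph /comp_poly; congr horner.
apply/polyP=> i; rewrite !coef_map /=.
elim/poly_ind: (r`_i) => [|p c IH]; first by rewrite !rmorph0 ?horner0.
by rewrite rmorphD rmorphM /= IH hmorphX hmorphC /= polyCD polyCM.
Qed.

(* The surface swept by the tangents issued from the points of a line of [F = 0]. *)
Definition tangent_sweep (K : comNzRingType) (x s t : K) (F : poly3 K) : poly3 K :=
  (on_line x s t (dw F))%:P%:P * ('X - (s%:P * 'X + t%:P)%:P%:P)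
  + ('X%:P - x%:P%:P%:P) * (on_line x s t (du F))%:P%:P.

(** Otherwise eliminating w between F and the sweep T leaves a nonzero r(u, v) = A F + B T. Both F
    and T vanish on the tangents issued from the line, so r(x + z X(v), v) = 0 identically in z and
    v; since X is nonzero this forces r = 0. *)
Lemma rdivides_tangent_sweep (K : fieldType) (x s t : K) (F : poly3 K) :
  prime_elt F -> (1 < size F)%N -> rdivides F (flecnode F) ->
  (forall i, (0 < i <= deg3 F)%N -> (i%:R : K) != 0) ->
  on_line x s t F = 0 -> on_line x s t (dw F) != 0 ->
  rdivides F (tangent_sweep x s t F).
Proof.
move=> pF sF Fl char F0 X0; apply: contrapT => nF.
have [r [A [B [r0 rE _]]]] := prime_elimination pF sF nF.
set X := on_line x s t (dw F) in X0.
pose l : {poly K} := s%:P * 'X + t%:P; pose Y := on_line x s t (du F).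
have [e [eF eW eU er]] : exists e : {rmorphism poly3 K -> {poly {poly K}}},
   [/\ e F = 0, e 'X = l%:P + 'X * (- Y)%:P, e 'X%:P = x%:P%:P + 'X * X%:P &
       forall r : {poly {poly K}}, e r%:P = r \Po (x%:P%:P + 'X * X%:P)].
  exists (along (@polyC K) x%:P 'X l X (- Y)); split.
  - rewrite /l /Y -[LHS]along_tangent_on_line; apply/polyP=> i; rewrite coef_map coef0 /=.
    by have [m ->] := rdivides_along_tangent pF sF Fl char i; rewrite rmorphM /= F0 mulr0.
  - exact: (alongE _ _ _ _ _ _).2.
  - exact: (alongE _ _ _ _ _ _).1.2.
  - by move=> q; exact: along_inner.
have eC (a : {poly K}) : e a%:P%:P = a%:P by rewrite er comp_polyC.
have eT : e (tangent_sweep x s t F) = 0.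
  have sw (T : comNzRingType) (f : {rmorphism T -> {poly {poly K}}}) a b c d g h :
      f (a * (b - c) + (d - g) * h) = f a * (f b - f c) + (f d - f g) * f h.
    by rewrite rmorphD !rmorphM !rmorphB.
  have rg (T : comNzRingType) (a b c d g : T) :
      a * (c + g * - b - c) + (d + g * a - d) * b = 0 by ring.
  by rewrite [LHS](sw _ e) !eC eW eU polyCN; exact: rg.
have := congr1 e rE; rewrite rmorphD !rmorphM eF eT !mulr0 addr0 er.
move=> /eqP; rewrite comp_poly_eq0; first by apply/negP.
by rewrite addrC mulrC size_MXaddC !polyC_eq0 (negPf X0) /= size_polyC X0.
Qed.

(** Degrees in w and in u add under products. A divisor of X w + b of positive degree in w thus has
    degree 1 in w and at most 1 in u, and its coefficient of w is free of u because X is. *)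
Lemma factor_of_linear (S : idomainType) (F m : {poly {poly S}}) (X : S) (b : {poly S}) :
  (1 < size F)%N -> X != 0 -> (size b <= 2)%N -> m * F = X%:P%:P * 'X + b%:P ->
  [/\ size F = 2%N, forall i, (size (F`_i)%R <= 2)%N & (size (F`_1)%R <= 1)%N].
Proof.
move=> sF X0 sb E.
have sk : size (m * F) = 2%N.
  by rewrite E size_MXaddC !polyC_eq0 (negPf X0) /= size_polyC polyC_eq0 X0.
have m0 : m != 0 by apply: contra_eq_neq sk => ->; rewrite mul0r size_poly0.
have F0 : F != 0 by rewrite -size_poly_gt0; apply: leq_trans sF.
have [sm sF2] : (size m <= 1)%N /\ size F = 2%N.
  have := size_mul m0 F0; rewrite sk; move: m0; rewrite -size_poly_gt0.
  move: sF; move: (size m) (size F) => a c; split; lia.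
have coef i : m`_0 * F`_i = (X%:P%:P * 'X + b%:P)`_i.
  by rewrite -E [in RHS](size1_polyC sm) coefCM.
have c1 := coef 1%N; have c0 := coef 0%N.
rewrite coefD coefMX !coefC /= addr0 in c1; rewrite coefD coefMX !coefC /= add0r in c0.
have XP0 : X%:P != 0 :> {poly S} by rewrite polyC_eq0.
have [m00 F10] : m`_0 != 0 /\ F`_1 != 0.
  by apply/andP; rewrite -negb_or -mulf_eq0 c1.
have := congr1 (fun p : {poly S} => size p) c1; rewrite size_mul // size_polyC X0 /=.
move=> sz1.
have sz : size m`_0 = 1%N /\ size F`_1 = 1%N.
  move: m00 F10 sz1; rewrite -!size_poly_gt0.
  by move: (size m`_0) (size F`_1) => a c; split; lia.
split=> [//|i|]; last by rewrite sz.2.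
case: i => [|[|i]]; last by rewrite nth_default ?sF2 // size_poly0.
  have [->|F00] := eqVneq F`_0 0; first by rewrite size_poly0.
  by move: sb; rewrite -c0 size_mul // sz.1 add1n.
by rewrite sz.2.
Qed.

(** The conclusion encodes F = a(v) w + b(v) u + c(v), the shape of the tangent sweep, which F
    divides. *)
Lemma ruled_shape (K : fieldType) (x s t : K) (F : poly3 K) :
  prime_elt F -> (1 < size F)%N -> rdivides F (flecnode F) ->
  (forall i, (0 < i <= deg3 F)%N -> (i%:R : K) != 0) ->
  on_line x s t F = 0 -> on_line x s t (dw F) != 0 ->
  [/\ size F = 2%N, forall i, (size (F`_i)%R <= 2)%N & (size (F`_1)%R <= 1)%N].
Proof.
move=> pF sF Fl char F0 X0.
have [m mE] := rdivides_tangent_sweep pF sF Fl char F0 X0.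
set X := on_line x s t (dw F) in X0 mE; pose l : {poly K} := s%:P * 'X + t%:P.
pose Y := on_line x s t (du F).
apply: (@factor_of_linear _ F m X (Y%:P * 'X + (- (X * l + x%:P * Y))%:P)) => //.
  by rewrite size_MXaddC; case: ifP => // _; rewrite ltnS size_polyC_leq1.
rewrite -mE /tangent_sweep -/X -/Y -/l !(polyCD, polyCN, polyCM).
have rg (T : comNzRingType) (a b c d g h : T) :
  a * (c - d) + (g - h) * b = a * c + (b * g - (a * d + h * b)) by ring.
exact: rg.
Qed.

(** * Partial degrees of the flecnode polynomial *)

Lemma pred_sizeD (R : nzRingType) (p q : {poly R}) a :
  ((size p).-1 <= a -> (size q).-1 <= a -> (size (p + q)%R).-1 <= a)%N.
Proof. by have := size_polyD p q; lia. Qed.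

Lemma pred_sizeM (R : nzRingType) (p q : {poly R}) a b :
  ((size p).-1 <= a -> (size q).-1 <= b -> (size (p * q)%R).-1 <= a + b)%N.
Proof. by have := size_polyMleq p q; lia. Qed.

(** Upper bounds on the partial degrees, which unlike the degrees themselves behave uniformly under
    sums and in the presence of zero. *)
Definition inbox (K : fieldType) (a b c : nat) (F : poly3 K) :=
  [/\ (degw F <= a)%N, (degu F <= b)%N & (degv F <= c)%N].

Lemma inboxD (K : fieldType) a b c (F G : poly3 K) :
  inbox a b c F -> inbox a b c G -> inbox a b c (F + G).
Proof.
move=> [Fw Fu Fv] [Gw Gu Gv]; split; first exact: pred_sizeD.
  by move: Fu Gu; rewrite /degu !sizeYE rmorphD; exact: pred_sizeD.
by move: Fv Gv; rewrite /degv /degu !sizeYE !rmorphD; exact: pred_sizeD.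
Qed.

Lemma inboxM (K : fieldType) a b c a' b' c' (F G : poly3 K) :
  inbox a b c F -> inbox a' b' c' G -> inbox (a + a') (b + b') (c + c') (F * G).
Proof.
move=> [Fw Fu Fv] [Gw Gu Gv]; split; first exact: pred_sizeM.
  by move: Fu Gu; rewrite /degu !sizeYE rmorphM; exact: pred_sizeM.
by move: Fv Gv; rewrite /degv /degu !sizeYE !rmorphM; exact: pred_sizeM.
Qed.

Lemma sizeYN (R : nzRingType) (u : {poly {poly R}}) : sizeY (- u) = sizeY u.
Proof. by rewrite /sizeY size_polyN; apply: eq_bigr => i _; rewrite coefN size_polyN. Qed.

Lemma swap3N (K : comNzRingType) (F : poly3 K) : swap3 (- F) = - swap3 F.
Proof.
pose e : {rmorphism poly3 K -> poly3 K} := @swap3 K.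
by rewrite -![swap3 _]/(e _) rmorphN.
Qed.

Lemma inboxN (K : fieldType) a b c (F : poly3 K) : inbox a b c F -> inbox a b c (- F).
Proof.
move=> [Fw Fu Fv]; split; first by rewrite /degw size_polyN.
  by rewrite /degu sizeYN.
by rewrite /degv swap3N /degu sizeYN.
Qed.

Lemma pred_size_deriv (R : nzRingType) (p : {poly R}) : ((size p^`()).-1 <= (size p).-1)%N.
Proof. by have := size_poly (size p).-1 (fun i => p`_i.+1 *+ i.+1); rewrite /deriv; lia. Qed.

Lemma size_swap_deriv (R : comNzRingType) (p : {poly {poly R}}) :
  (size (swapXY (swapXY p)^`()) <= size p)%N.
Proof.
apply/leq_sizeP => j pj; apply/polyP=> i.
by rewrite coef_swapXY coef_deriv coefMn coef_swapXY (nth_default 0 pj) !coef0 mul0rn.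
Qed.

Lemma swap3_dw (K : comNzRingType) (F : poly3 K) : swap3 (dw F) = dw (swap3 F).
Proof. by rewrite /swap3 /dw deriv_map. Qed.

Lemma coef_du (K : comNzRingType) (F : poly3 K) i : (du F)`_i = (F`_i)^`().
Proof.
apply/polyP=> j; rewrite /du coef_swapXY !coef_deriv coefMn.
by rewrite coef_swapXY.
Qed.

Lemma inbox_dw (K : fieldType) a b c (F : poly3 K) : inbox a b c F -> inbox a b c (dw F).
Proof.
move=> [Fw Fu Fv]; split.
- exact: leq_trans (pred_size_deriv F) Fw.
- have -> : dw F = swapXY (swapXY (dw F)) by rewrite swapXYK.
  apply: leq_trans Fu; rewrite /degu !sizeYE swapXYK.
  have := size_swap_deriv (swapXY F); rewrite swapXYK -/(dw F) => H.
  by rewrite -!subn1 leq_sub2r.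
- apply: leq_trans Fv; rewrite /degv swap3_dw /degu !sizeYE.
  have := size_swap_deriv (swapXY (swap3 F)); rewrite swapXYK => H.
  by rewrite -!subn1 leq_sub2r.
Qed.

Lemma inbox_du (K : fieldType) a b c (F : poly3 K) : inbox a b c F -> inbox a b c (du F).
Proof.
move=> [Fw Fu Fv]; split.
- by apply: leq_trans Fw; rewrite /degw -!subn1 leq_sub2r //; exact: size_swap_deriv.
- apply: leq_trans Fu; rewrite /degu !sizeYE /du swapXYK; exact: pred_size_deriv.
- apply: leq_trans Fv; rewrite /degv /degu -!subn1; apply: leq_sub2r.
  apply/bigmax_leqP => i _; rewrite coef_map coef_du /=.
  apply: leq_trans (_ : (size (swapXY F`_i) <= _)%N).
    have := size_swap_deriv (swapXY F`_i); rewrite swapXYK; exact.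
  have -> : swapXY F`_i = (swap3 F)`_i by rewrite coef_map.
  exact: max_size_coefXY.
Qed.

Lemma inbox_flecnode (K : fieldType) (F : poly3 K) :
  inbox (3 * degw F) (3 * degu F) (3 * degv F) (flecnode F).
Proof.
have F1 : inbox (degw F) (degu F) (degv F) F by [].
have Fu := inbox_du F1; have Fw := inbox_dw F1.
have H (a b c : poly3 K) : inbox (degw F) (degu F) (degv F) a ->
    inbox (degw F) (degu F) (degv F) b -> inbox (degw F) (degu F) (degv F) c ->
    inbox (3 * degw F) (3 * degu F) (3 * degv F) (a * b * c).
  move=> Ha Hb Hc; have := inboxM (inboxM Ha Hb) Hc.
  by rewrite !mulSn !mul0n !addn0 !addnA.
rewrite /flecnode !expr2; apply: inboxD; first apply: inboxD.
- by apply: H => //; apply: inbox_du.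
- apply: inboxN; apply: H => //; apply: inboxD; [exact: inbox_du|exact: inbox_dw].
- by apply: H => //; apply: inbox_dw.
Qed.

Lemma prime_elt_swap3 (K : fieldType) (F : poly3 K) : prime_elt F -> prime_elt (swap3 F).
Proof.
pose e : {rmorphism poly3 K -> poly3 K} := @swap3 K.
have eK : involutive e by exact: (@swap3K K).
rewrite -[swap3 F]/(e F) => -[F0 Fu pF]; split.
- by apply: contra_neq F0 => E; rewrite -(eK F) E rmorph0.
- by apply: contra Fu => /(rmorph_unit e); rewrite eK.
move=> a b [m E]; have /pF : rdivides F (e a * e b).
  by exists (e m); rewrite -rmorphM E rmorphM eK.
by case=> -[c cE]; [left|right]; exists (e c); rewrite -rmorphM -cE eK.
Qed.

Lemma size_swap3 (K : fieldType) (F : poly3 K) : size (swap3 F) = size F.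
Proof. by rewrite size_map_inj_poly ?raddf0 //; exact: inv_inj (@swapXYK _). Qed.

Lemma size_poly_leq2 (R : nzRingType) (p : {poly R}) : (size p <= 2)%N ->
  p = (p`_1)%:P * 'X + (p`_0)%:P.
Proof.
move=> sp; apply/polyP => -[|[|i]]; rewrite coefD coefMX !coefC ?add0r ?addr0 //=.
by rewrite nth_default //; apply: leq_trans sp _.
Qed.

(** The triple box accommodates the flecnode polynomial, cubic in derivatives of F, and a fortiori
    F_w. The eliminant then has degree at most 2 * 3 * [degw F] * [degu F]. *)
Lemma card_le_flecnode (K : fieldType) (I : finType) (x s t : I -> K) (P : {set I})
    (F G : poly3 K) :
  injective x -> prime_elt F -> (1 < size F)%N -> ~ rdivides F G ->
  inbox (3 * degw F) (3 * degu F) (3 * degv F) G ->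
  {in P, forall i, on_line (x i) (s i) (t i) F = 0} ->
  {in P, forall i, on_line (x i) (s i) (t i) G = 0} ->
  (#|P| <= 6 * deg3 F ^ 2)%N.
Proof.
move=> xi pF sF nFG [Gw Gu _] HF HG.
apply: leq_trans (card_common_lines (x := x) (s := s) (t := t) xi pF sF nFG _) _.
  by move=> i iP; split; [exact: HF|exact: HG].
move: Gw Gu; rewrite /deg3; move: (degw G) (degu G) (degw F) (degu F) (degv F) => a b c d e.
by nia.
Qed.

(** The shapes in both directions leave c w + p(v) u + q(v) = 0 with c constant and p, q of degree
    at most 1. Setting u = x makes slope and intercept affine functions of x. *)
Lemma bilinear_lines (K : fieldType) (F : poly3 K) :
  size F = 2%N -> (forall i, (size (F`_i)%R <= 2)%N) -> (size (F`_1)%R <= 1)%N ->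
  (forall i, (size ((swap3 F)`_i)%R <= 2)%N) -> (size ((swap3 F)`_1)%R <= 1)%N ->
  exists a g b d : K, forall x s t : K, on_line x s t F = 0 ->
    s = a * x + g /\ t = b * x + d.
Proof.
move=> sF s2 s11 s2' s11'.
have F1E := size1_polyC s11; have F0E := size_poly_leq2 (s2 0%N).
have szv i j : (size (F`_i`_j)%R <= 2)%N.
  apply: leq_trans (max_size_coefXY _ _) _; rewrite sizeYE.
  have -> : swapXY F`_i = (swap3 F)`_i by rewrite coef_map.
  exact: s2'.
have szv1 : (size (F`_1`_0)%R <= 1)%N.
  apply: leq_trans (max_size_coefXY _ _) _; rewrite sizeYE.
  by have -> : swapXY F`_1 = (swap3 F)`_1 by rewrite coef_map.
pose c : K := F`_1`_0`_0.
have F1c : F`_1 = c%:P%:P by rewrite F1E (size1_polyC szv1).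
have c0 : c != 0.
  have : lead_coef F != 0 by rewrite lead_coef_eq0 -size_poly_gt0 sF.
  by rewrite lead_coefE sF F1c !polyC_eq0.
pose p := F`_0`_1; pose q := F`_0`_0.
exists (- (p`_1 / c)), (- (q`_1 / c)), (- (p`_0 / c)), (- (q`_0 / c)) => x s t E.
have {}E : c%:P * (s%:P * 'X + t%:P) + (p * x%:P + q) = 0.
  rewrite -E; have FE : F = (F`_1)%:P * 'X + (F`_0)%:P by apply: size_poly_leq2; rewrite sF.
  pose e : {rmorphism poly3 K -> {poly K}} := on_line x s t.
  rewrite [in RHS]FE -[RHS]/(e _) rmorphD rmorphM.
  have -> : e 'X = s%:P * 'X + t%:P by rewrite /e /= /on_line ev3E.
  have -> : e (F`_1)%:P = c%:P by rewrite /e /= on_line_polyC F1c hornerC.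
  have -> : e (F`_0)%:P = p * x%:P + q.
    by rewrite /e /= on_line_polyC F0E hornerD hornerM hornerX !hornerC.
  by [].
have E0 := congr1 (fun r : {poly K} => r`_0) E.
have E1 := congr1 (fun r : {poly K} => r`_1) E.
move: E0 E1; rewrite /= !(coefD, coefCM, coefMC, coefMX, coefC, coefX, coef0) /= ?mulr0 ?mulr1.
rewrite ?addr0 ?add0r => E0 E1; split; apply: (mulfI c0); rewrite mulrDr.
  have -> : c * s = - (p`_1 * x + q`_1) by apply/eqP; rewrite -addr_eq0 E1.
  by field.
have -> : c * t = - (p`_0 * x + q`_0) by apply/eqP; rewrite -addr_eq0 E0.
by field.
Qed.

(* Many lines of each family force the surface to be ruled in both directions, hence to be
   bilinear. *)
Lemma prime_surface (K : fieldType) (I J : finType) (x s t : I -> K) (y s' t' : J -> K)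
    (F : poly3 K) (P : {set I}) (Q : {set J}) (kappa : nat) :
  injective x -> injective y -> prime_elt F ->
  (forall i, (0 < i <= deg3 F)%N -> (i%:R : K) != 0) ->
  {in P, forall i, on_line (x i) (s i) (t i) F = 0} ->
  {in Q, forall j, on_line (y j) (s' j) (t' j) (swap3 F) = 0} ->
  (forall a g b d : K,
     (#|[set i | ((s i == a * x i + g) && (t i == b * x i + d))%R]| <= kappa)%N) ->
  [\/ #|P| <= 6 * deg3 F ^ 2, #|Q| <= 6 * deg3 F ^ 2 | #|P| <= kappa]%N.
Proof.
move=> xi yi pF char HP HQ Hk; have [F0 _ _] := pF.
have [sF|sF] := leqP (size F) 1.
  constructor 1; apply: leq_trans (card_lines_size1 (x := x) xi F0 sF HP) _.
  by rewrite /deg3; nia.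
have pF' := prime_elt_swap3 pF.
have sF' : (1 < size (swap3 F))%N by rewrite size_swap3.
(* Blue lines lie in slices v = const, so they are also on the flecnode surface; if F does not
   divide the flecnode polynomial there are few of them. The swapped polynomial plays the same part
   for the red lines. *)
have [Fl|nFl] := EM (rdivides F (flecnode F)); last first.
  constructor 2; rewrite -deg3_swap.
  apply: (card_le_flecnode (x := y) (s := s') (t := t') (G := swap3 (flecnode F)) yi pF' sF' _ _ HQ).
  - move=> [m E]; apply: nFl; exists (swap3 m).
    have : swap3 (swap3 (flecnode F)) = swap3 (m * swap3 F) by rewrite E.
    pose e : {rmorphism poly3 K -> poly3 K} := @swap3 K.
    by rewrite swap3K -[RHS]/(e _) rmorphM /e /= swap3K.
  - have [H1 H2 H3] := inbox_flecnode F.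
    by split; rewrite ?degw_swap ?degv_swap // degu_swap.
  - by move=> j /HQ; exact: flecnode_on_line.
have [Fl'|nFl'] := EM (rdivides (swap3 F) (flecnode (swap3 F))); last first.
  constructor 1.
  apply: (card_le_flecnode (x := x) (s := s) (t := t) (G := swap3 (flecnode (swap3 F))) xi pF sF _ _ HP).
  - move=> [m E]; apply: nFl'; exists (swap3 m).
    have : swap3 (swap3 (flecnode (swap3 F))) = swap3 (m * F) by rewrite E.
    pose e : {rmorphism poly3 K -> poly3 K} := @swap3 K.
    by rewrite swap3K -[RHS]/(e _) rmorphM /e /=.
  - have [H1 H2 H3] := inbox_flecnode (swap3 F).
    move: H1 H2 H3; rewrite degw_swap degv_swap degu_swap => H1 H2 H3.
    by split; rewrite ?degw_swap ?degv_swap // degu_swap.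
  - by move=> i /HP; rewrite -{1}(swap3K F); exact: flecnode_on_line.
have F1 : inbox (degw F) (degu F) (degv F) F by [].
have dF : ~ rdivides F (dw F).
  apply: ndivides_dw => //; apply: char; rewrite /deg3 -addnA leq_addr andbT.
  by rewrite /degw; case: (size F) sF => [|[|]].
have dbox : inbox (3 * degw F) (3 * degu F) (3 * degv F) (dw F).
  by have [H1 H2 H3] := inbox_dw F1; split; [move: H1|move: H2|move: H3]; lia.
(* [ruled_shape] needs one line of each family on which F_w is not identically zero; a family
   without such a line lies on F = F_w = 0 and is small. *)
have [redF|/existsNP [i /not_implyP [iP iF]]] :=
    EM (forall i, i \in P -> on_line (x i) (s i) (t i) (dw F) = 0).
  by constructor 1; apply: (card_le_flecnode (x := x) xi pF sF dF dbox HP redF).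
have [blueF|/existsNP [j /not_implyP [jQ jF]]] :=
    EM (forall j, j \in Q -> on_line (y j) (s' j) (t' j) (swap3 (dw F)) = 0).
  constructor 2; rewrite -deg3_swap.
  apply: (card_le_flecnode (x := y) (G := swap3 (dw F)) yi pF' sF' _ _ HQ blueF).
  - move=> [m E]; apply: dF; exists (swap3 m).
    have : swap3 (swap3 (dw F)) = swap3 (m * swap3 F) by rewrite E.
    pose e : {rmorphism poly3 K -> poly3 K} := @swap3 K.
    by rewrite swap3K -[RHS]/(e _) rmorphM /e /= swap3K.
  - have [H1 H2 H3] := dbox.
    by split; rewrite ?degw_swap ?degv_swap // degu_swap.
constructor 3.
have /eqP iF' := iF; have /eqP jF' := jF.
have [R1 R2 R3] := ruled_shape pF sF Fl char (HP i iP) iF'.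
have char' k : (0 < k <= deg3 (swap3 F))%N -> (k%:R : K) != 0 by rewrite deg3_swap; exact: char.
have [_ B2 B3] := ruled_shape pF' sF' Fl' char' (HQ j jQ) ltac:(by rewrite -swap3_dw).
have [a [g [b [d ab]]]] := bilinear_lines R1 R2 R3 B2 B3.
apply: leq_trans (Hk a g b d); apply: subset_leq_card; apply/subsetP => k kP.
by have [sE tE] := ab _ _ _ (HP k kP); rewrite inE {1}sE {1}tE !eqxx.
Qed.

(** * Meeting points with a surface and surfaces through given lines *)

Lemma on_line_meet (K : fieldType) (x s t y s' t' : K) (F : poly3 K) :
  s' * x + t' = s * y + t ->
  (on_line x s t F).[y] = (on_line y s' t' (swap3 F)).[x].
Proof.
move=> E; pose e1 : {rmorphism poly3 K -> K} := horner_eval y \o on_line x s t.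
pose e2 : {rmorphism poly3 K -> K} := horner_eval x \o (on_line y s' t' \o @swap3 K).
rewrite -[LHS]/(e1 F) -[RHS]/(e2 F).
apply: poly3_ext => [c|||]; rewrite /e1 /e2 /= /horner_eval swap3E /on_line !ev3E ?hornerC ?hornerX //.
by rewrite !(hornerD, hornerM, hornerC, hornerX) E.
Qed.

Lemma size_on_line (K : fieldType) (x s t : K) (F : poly3 K) :
  ((size (on_line x s t F)).-1 <= deg3 F)%N.
Proof.
have sl : ((size (s%:P * 'X + t%:P)%R).-1 <= 1)%N.
  by rewrite -subn1 leq_subLR size_MXaddC; case: ifP => // _; rewrite ltnS size_polyC_leq1.
have := @size_ev3 K K (@polyC K) x%:P 'X (s%:P * 'X + t%:P) F (fun c => size_polyC_leq1 c).
rewrite size_polyX size_polyC -/(on_line x s t F).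
have -> : (nat_of_bool (x != 0)).-1 = 0%N by case: (x != 0).
move=> H; apply: leq_trans H _; rewrite muln0 addn0 muln1 /deg3.
move: sl; move: (degw F) (degu F) (degv F) => a b c; move: (size _).-1 => d; nia.
Qed.

Lemma sum_nat_of_bool (I : finType) (P : {set I}) (b : I -> bool) :
  (\sum_(i in P) b i = #|[set i in P | b i]|)%N.
Proof.
rewrite -sum1dep_card big_mkcondr /=.
by apply: eq_bigr => i _; case: (b i).
Qed.

(** A blue line off the surface meets it in at most [deg3 F] points, and distinct red lines of the
    surface meet the blue line at distinct abscissae. *)
Lemma card_meet_surface (K : fieldType) (I : finType) (x s t : I -> K) (y s' t' : K)
    (F : poly3 K) (P : {set I}) :
  injective x -> on_line y s' t' (swap3 F) != 0 ->
  {in P, forall i, on_line (x i) (s i) (t i) F = 0} ->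
  (\sum_(i in P) (s' * x i + t' == s i * y + t i)%R <= deg3 F)%N.
Proof.
move=> xi q0 HP; rewrite sum_nat_of_bool -deg3_swap.
apply: leq_trans (size_on_line y s' t' (swap3 F)).
set q := on_line _ _ _ _ in q0 *; set A := [set i in P | _].
have := max_poly_roots (rs := [seq x i | i <- enum A]) q0.
rewrite size_map -cardE map_inj_uniq ?enum_uniq //.
have -> : all (root q) [seq x i | i <- enum A].
  apply/allP => z /mapP[i iA ->]; move: iA; rewrite mem_enum inE => /andP[iP /eqP E].
  by apply/rootP; rewrite /q -(on_line_meet _ E) HP // horner0.
by move=> /(_ isT isT); move: (size q) => n; case: n.
Qed.

Lemma homogeneous_solution (K : fieldType) (I J : finType) (a : I -> J -> K) :
  (#|J| < #|I|)%N ->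
  exists c : I -> K, (exists i, c i != 0) /\ forall j, \sum_i c i * a i j = 0.
Proof.
move=> JI; pose A := \matrix_(i < #|I|, j < #|J|) a (enum_val i) (enum_val j).
have : kermx A != 0.
  rewrite kermx_eq0 /row_free; apply/negP => /eqP E.
  by have := rank_leq_col A; rewrite E leqNgt JI.
case/matrix0Pn => i [k Hk].
exists (fun l => kermx A i (enum_rank l)); split; first by exists (enum_val k); rewrite enum_valK.
move=> j; have /matrixP/(_ i (enum_rank j)) := mulmx_ker A.
rewrite !mxE => E; rewrite -[RHS]E (reindex (@enum_val I xpredT)) /=; last first.
  by exists enum_rank => l _; rewrite (enum_valK, enum_rankK).
by apply: eq_bigr => l _; rewrite !mxE enum_valK !enum_rankK.
Qed.

Lemma inbox_mono (K : fieldType) a b c a' b' c' (F : poly3 K) :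
  inbox a b c F -> (a <= a')%N -> (b <= b')%N -> (c <= c')%N -> inbox a' b' c' F.
Proof. by move=> [H1 H2 H3] Ha Hb Hc; split; [move: Ha|move: Hb|move: Hc]; apply: leq_trans. Qed.

Lemma degu_polyC (K : fieldType) (r : {poly {poly K}}) : degu (r%:P) = (size r).-1.
Proof.
rewrite /degu sizeYE swapXY_polyC size_map_inj_poly //.
by move=> p q /polyC_inj.
Qed.

Lemma inbox_polyC (K : fieldType) (c : K) : inbox 0 0 0 (c%:P%:P%:P : poly3 K).
Proof.
split; rewrite ?/degv ?swap3E ?degu_polyC.
- by rewrite /degw size_polyC; case: (_ != 0).
- by rewrite size_polyC; case: (_ != 0).
- by rewrite size_polyC; case: (_ != 0).
Qed.

Lemma inbox_wvar (K : fieldType) : inbox 1 0 0 ('X : poly3 K).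
Proof.
have H : degu ('X : poly3 K) = 0%N by rewrite /degu sizeYE swapXY_X size_polyC polyX_eq0.
by split; rewrite ?/degv ?swap3E ?H // /degw size_polyX.
Qed.

Lemma inbox_uvar (K : fieldType) : inbox 0 1 0 ('X%:P : poly3 K).
Proof.
split; rewrite ?/degv ?swap3E ?degu_polyC.
- by rewrite /degw size_polyC; case: (_ != 0).
- by rewrite size_polyX.
- by rewrite size_polyC; case: (_ != 0).
Qed.

Lemma inbox_vvar (K : fieldType) : inbox 0 0 1 ('X%:P%:P : poly3 K).
Proof.
split; rewrite ?/degv ?swap3E ?degu_polyC.
- by rewrite /degw size_polyC; case: (_ != 0).
- by rewrite size_polyC; case: (_ != 0).
- by rewrite size_polyX.
Qed.

Lemma inboxX (K : fieldType) a b c n (F : poly3 K) :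
  inbox a b c F -> inbox (n * a) (n * b) (n * c) (F ^+ n).
Proof.
move=> HF; elim: n => [|n IH]; last by rewrite exprS !mulSn; apply: inboxM.
by rewrite !mul0n expr0; have := inbox_polyC (1 : K); rewrite !polyC1.
Qed.

(** There are m^3 monomials with all exponents below m, and each line imposes 2 m - 1 conditions,
    the coefficients of a restriction of degree at most 2 (m - 1); |S| (2 m - 1) < m^3. *)
Lemma surface_through_lines (K : fieldType) (I : finType) (x s t : I -> K) (S : {set I})
    (m : nat) :
  (0 < m)%N -> (2 * #|S| <= m ^ 2)%N ->
  exists F : poly3 K, [/\ F != 0, (deg3 F <= 3 * m.-1)%N &
    {in S, forall i, on_line (x i) (s i) (t i) F = 0}].
Proof.
move=> m0 Sm; pose T := ('I_m * 'I_m * 'I_m)%type.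
pose mon (i : T) : poly3 K := 'X%:P%:P ^+ i.1.1 * 'X%:P ^+ i.1.2 * 'X ^+ i.2.
pose J := ({i : I | i \in S} * 'I_(m.-1 + m.-1).+1)%type.
have [|c [[i0 ci0] Hc]] := @homogeneous_solution K T J
   (fun i j => (on_line (x (val j.1)) (s (val j.1)) (t (val j.1)) (mon i))`_(j.2)).
  rewrite !card_prod !card_ord card_sig.
  have -> : #|[pred i | i \in S]| = #|S| by apply: eq_card.
  by move: (#|S|) Sm => k; case: (m) m0 => // n _; rewrite !expnS expn0; nia.
pose F : poly3 K := \sum_i poly3C (c i) * mon i.
have box : inbox m.-1 m.-1 m.-1 F.
  rewrite /F; elim/big_ind: _ => [||i _].
  - by have := inbox_polyC (0 : K); rewrite !polyC0 => H; apply: inbox_mono H _ _ _.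
  - by move=> ? ?; apply: inboxD.
  - have pm (k : 'I_m) : (k <= m.-1)%N by rewrite -ltnS prednK.
    apply: (inbox_mono (inboxM (inbox_polyC (c i)) (inboxM (inboxM (inboxX i.1.1 (inbox_vvar K))
      (inboxX i.1.2 (inbox_uvar K))) (inboxX i.2 (inbox_wvar K)))));
    by rewrite !(muln0, muln1, addn0, add0n) pm.
have FE : F`_(i0.2)`_(i0.1.2)`_(i0.1.1) = c i0.
  have monE (i : T) : poly3C (c i) * mon i = (((c i)%:P * 'X^(i.1.1))%:P * 'X^(i.1.2))%:P * 'X^(i.2).
    by rewrite /mon /poly3C !(polyCM, rmorphXn) /= !mulrA.
  rewrite /F (eq_bigr _ (fun i _ => monE i)) !coef_sum (bigD1 i0) //= big1 => [|i ii0].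
    by do 3!rewrite coefCM coefXn eqxx mulr1; rewrite addr0.
  rewrite coefCM coefXn.
  case: (eqVneq (i0.2 : nat) i.2) => [e2|_]; last by rewrite mulr0 !coef0.
  rewrite mulr1 coefCM coefXn.
  case: (eqVneq (i0.1.2 : nat) i.1.2) => [e1|_]; last by rewrite mulr0 !coef0.
  rewrite mulr1 coefCM coefXn.
  case: (eqVneq (i0.1.1 : nat) i.1.1) => [e0|_]; last by rewrite mulr0.
  by case/negP: ii0; apply/eqP; case: (i) (i0) e0 e1 e2 => [[? ?] ?] [[? ?] ?] /= *;
     congr (_, _, _); apply: val_inj.
exists F; split.
- by apply: contraNneq ci0 => F0; rewrite -FE F0 !coef0.
- by case: box; rewrite /deg3; lia.
move=> i iS; apply/polyP=> k; rewrite coef0.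
pose e : {rmorphism poly3 K -> {poly K}} := on_line (x i) (s i) (t i).
have [kb|kb] := ltnP k (m.-1 + m.-1).+1; last first.
  apply: nth_default; rewrite -/(e F).
  have sl : ((size ((s i)%:P * 'X + (t i)%:P)%R).-1 <= 1)%N.
    by rewrite -subn1 leq_subLR size_MXaddC; case: ifP => // _; rewrite ltnS size_polyC_leq1.
  have := @size_ev3 K K (@polyC K) (x i)%:P 'X ((s i)%:P * 'X + (t i)%:P) F (fun c => size_polyC_leq1 c).
  rewrite size_polyX size_polyC -/(on_line (x i) (s i) (t i) F) -/(e F).
  have -> : (nat_of_bool (x i != 0)).-1 = 0%N by case: (x i != 0).
  rewrite muln0 addn0 muln1; case: box => b1 b2 b3.
  move: sl b1 b2 b3 kb; move: (degw F) (degu F) (degv F) (size (e F)) => a b d z.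
  move: (size _).-1 => q; nia.
rewrite -/(e F) /F rmorph_sum coef_sum -[RHS](Hc (exist _ i iS, Ordinal kb)).
apply: eq_bigr => l _; rewrite rmorphM /=.
have -> : e (poly3C (c l)) = (c l)%:P by rewrite /e /= /on_line ev3E.
by rewrite coefCM.
Qed.

(** * Sampling *)

Lemma exists_le_average (R : realFieldType) (M : nat) (A : 'I_M -> R) :
  (0 < M)%N -> exists c, M%:R * A c <= \sum_k A k.
Proof.
move=> M0; apply: contrapT => /forallNP H; set T := \sum_k A k in H *.
have : \sum_(c < M) T < \sum_(c < M) M%:R * A c.
  case: M A M0 @T H => // M A _ T H; rewrite !big_ord_recl /=.
  apply: ltr_leD; first by rewrite ltNge; apply/negP/H.
  by apply: ler_sum => i _; rewrite leNgt; apply/negP => /ltW /H.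
by rewrite sumr_const card_ord -mulr_sumr -[T *+ M]mulr_natl ltxx.
Qed.

(** A derandomised random colouring: the right-hand side bounds the expectation of the left for
    uniform colours. The elements are coloured one at a time, each with a colour whose weighted
    correlation with the elements already coloured is at most average. *)
Lemma balanced_coloring (R : realFieldType) (I J : finType) (e : I -> J -> bool)
    (w : J -> R) (M : nat) (l : seq I) :
  (0 < M)%N -> (forall j, 0 <= w j) -> uniq l ->
  exists f : I -> 'I_M,
    \sum_j w j * \sum_c (\sum_(i <- l | f i == c) (e i j)%:R) ^+ 2 <=
    \sum_j w j * (\sum_(i <- l) (e i j)%:R + (\sum_(i <- l) (e i j)%:R) ^+ 2 / M%:R).
Proof.
move=> M0 w0; have MR : (0 : R) < M%:R by rewrite ltr0n.
elim: l => [|i0 l IH] /=.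
  exists (fun=> Ordinal M0); apply: ler_sum => j _; rewrite !big_nil expr2 !mul0r addr0.
  by rewrite big1 // => c _; rewrite big_nil expr2 mul0r.
move=> /andP[i0l /IH [f Hf]].
pose D c j : R := \sum_(i <- l | f i == c) (e i j)%:R.
pose d j : R := \sum_(i <- l) (e i j)%:R.
have sD j : \sum_c D c j = d j.
  rewrite /D /d (exchange_big_dep predT) //=; apply: eq_bigr => i _.
  by rewrite (big_pred1 (f i)) // => c; rewrite eq_sym.
pose A c := \sum_j w j * ((e i0 j)%:R * D c j).
have sA : \sum_c A c = \sum_j w j * ((e i0 j)%:R * d j).
  rewrite /A exchange_big /=; apply: eq_bigr => j _.
  by rewrite -sD !mulr_sumr.
have [c0] := exists_le_average A M0; rewrite sA => Hc0.
exists (fun i => if i == i0 then c0 else f i).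
have D'E c j : \sum_(i <- i0 :: l | (if i == i0 then c0 else f i) == c) ((e i j)%:R : R)
     = (c0 == c)%:R * (e i0 j)%:R + D c j.
  rewrite big_cons eqxx.
  have -> : \sum_(i <- l | (if i == i0 then c0 else f i) == c) ((e i j)%:R : R) = D c j.
    rewrite /D big_seq_cond [in RHS]big_seq_cond; apply: eq_bigl => i.
    by case: (eqVneq i i0) => // ->; rewrite (negPf i0l).
  by case: eqP => _; rewrite ?mul1r ?mul0r ?add0r.
have S2 j : \sum_c (\sum_(i <- i0 :: l | (if i == i0 then c0 else f i) == c) ((e i j)%:R : R)) ^+ 2
    = \sum_c D c j ^+ 2 + 2 * ((e i0 j)%:R * D c0 j) + (e i0 j)%:R.
  rewrite (bigD1 c0) //= [in RHS](bigD1 c0) //= D'E eqxx mul1r.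
  rewrite (eq_bigr (fun c => D c j ^+ 2)) => [|c cc0]; last first.
    by rewrite D'E eq_sym (negPf cc0) mul0r add0r.
  move: (\sum_(_ < _ | _) _) (D c0 j) => X Y; case: (e i0 j) => /=; rewrite ?mulr0n ?mulr1n; ring.
rewrite (eq_bigr (fun j => w j * \sum_c D c j ^+ 2 + 2 * (w j * ((e i0 j)%:R * D c0 j)) + w j * (e i0 j)%:R));
  last by move=> j _; rewrite S2; ring.
rewrite [X in _ <= X](eq_bigr (fun j => w j * (d j + d j ^+ 2 / M%:R) +
   2 / M%:R * (w j * ((e i0 j)%:R * d j)) + w j * ((e i0 j)%:R + (e i0 j)%:R ^+ 2 / M%:R))); last first.
  by move=> j _; rewrite big_cons -/(d j); field; rewrite gt_eqF.
rewrite !big_split /= -!mulr_sumr; apply: lerD; first apply: lerD => //.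
  rewrite -/(A c0) -mulrA ler_pM2l // mulrC ler_pdivlMr //.
  by rewrite mulrC.
apply: ler_sum => j _; apply: ler_wpM2l => //.
by rewrite lerDl divr_ge0 ?exprn_ge0 // ltW.
Qed.

(** The sample is a colour class, expected to catch 1/M of the degree of each j. The j caught at
    less than half that rate have small total degree, by a second moment bound. *)
Lemma sampling (I J : finType) (e : I -> J -> bool) (P : {set I}) (Q : {set J}) (M : nat) :
  (0 < M)%N ->
  exists S : {set I}, [/\ S \subset P, (M * #|S| <= 2 * #|P|)%N &
    (\sum_(j in Q | 2 * M * (\sum_(i in S) e i j) <= \sum_(i in P) e i j)
        (\sum_(i in P) e i j) <= 8 * M * #|Q|)%N].
Proof.
move=> M0; have MR : (0 : rat) < M%:R by rewrite ltr0n.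
have [->|P0] := eqVneq P set0.
  exists set0; split; rewrite ?sub0set ?cards0 ?muln0 //.
  by rewrite big1 // => j _; rewrite big_set0.
have [->|Q0] := eqVneq Q set0.
  exists set0; split; rewrite ?sub0set ?cards0 ?muln0 //.
  by rewrite big1 // => j; rewrite inE.
pose deg (S : {set I}) j : rat := \sum_(i in S) (e i j)%:R.
have degE S j : deg S j = (\sum_(i in S) e i j)%:R by rewrite natr_sum.
have deg0 S j : 0 <= deg S j by rewrite degE ler0n.
(* This normalisation makes each j contribute at most 1 to the total weighted variance; a j of
   degree 0 gets weight 0, since division by 0 yields 0. *)
pose w j : rat := (j \in Q)%:R / deg P j.
have w0 j : 0 <= w j by rewrite divr_ge0 ?ler0n.
have [f Hf] := balanced_coloring e M0 w0 (enum_uniq P).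
pose S c := [set i in P | f i == c].
have dS c j : \sum_(i <- enum P | f i == c) ((e i j)%:R : rat) = deg (S c) j.
  by rewrite big_enum_cond /deg; apply: eq_bigl => i; rewrite inE.
have dP j : \sum_(i <- enum P) ((e i j)%:R : rat) = deg P j by rewrite big_enum.
pose W c := \sum_j w j * (deg (S c) j - deg P j / M%:R) ^+ 2.
have sdS j : \sum_c deg (S c) j = deg P j.
  rewrite -dP (eq_bigr _ (fun c _ => esym (dS c j))) (exchange_big_dep predT) //=.
  by apply: eq_bigr => i _; rewrite (big_pred1 (f i)) // => c; rewrite eq_sym.
have sW : \sum_c W c <= #|Q|%:R.
  rewrite /W exchange_big /=.
  have -> : \sum_j \sum_c w j * (deg (S c) j - deg P j / M%:R) ^+ 2 =
     \sum_j w j * (\sum_c deg (S c) j ^+ 2) - \sum_j w j * (deg P j ^+ 2 / M%:R).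
    rewrite -sumrB; apply: eq_bigr => j _; rewrite -mulr_sumr -mulrBr; congr (_ * _).
    rewrite (eq_bigr (fun c => deg (S c) j ^+ 2 - 2 * (deg P j / M%:R) * deg (S c) j
        + (deg P j / M%:R) ^+ 2)); last by move=> c _; ring.
    rewrite big_split sumrB /= -mulr_sumr sdS sumr_const card_ord -mulr_natl.
    by field; rewrite gt_eqF.
  rewrite lerBlDr.
  have -> : \sum_j w j * (\sum_c deg (S c) j ^+ 2) =
     \sum_j w j * \sum_c (\sum_(i <- enum P | f i == c) (e i j)%:R) ^+ 2.
    by apply: eq_bigr => j _; congr (_ * _); apply: eq_bigr => c _; rewrite dS.
  apply: le_trans Hf _; under eq_bigr do rewrite dP mulrDr.
  rewrite big_split /= lerD2r /w -sum1_card natr_sum [in X in _ <= X]big_mkcond.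
  apply: ler_sum => j _; case: (j \in Q); last by rewrite !mul0r.
  by have [->|d0] := eqVneq (deg P j) 0; rewrite ?mulr0 // mul1r mulVf.
have sS : \sum_c (#|S c|%:R : rat) = #|P|%:R.
  rewrite -natr_sum; congr (_%:R); rewrite -sum1_card (partition_big f predT) //=.
  by apply: eq_bigr => c _; rewrite -sum1_card; apply: eq_bigl => i; rewrite inE.
(* One colour must have both small size and small variance, so the two quantities are averaged
   together, each scaled to total at most |P| |Q|. *)
have [c] := exists_le_average (fun c => #|S c|%:R * #|Q|%:R + W c * #|P|%:R) M0.
rewrite big_split /= -!mulr_suml sS => Hc.
have P1 : (0 : rat) < #|P|%:R by rewrite ltr0n card_gt0.
have Q1 : (0 : rat) < #|Q|%:R by rewrite ltr0n card_gt0.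
have W0 : 0 <= W c by apply: sumr_ge0 => j _; rewrite mulr_ge0 // sqr_ge0.
have Hc2 : M%:R * (#|S c|%:R * #|Q|%:R + W c * #|P|%:R) <= 2 * (#|P|%:R * #|Q|%:R).
  apply: le_trans Hc _; have := ler_wpM2r (ltW P1) sW; lra.
have H1 : M%:R * #|S c|%:R <= 2 * (#|P|%:R : rat).
  rewrite -(ler_pM2r Q1) -!mulrA; apply: le_trans Hc2; rewrite ler_pM2l // lerDl.
  by rewrite mulr_ge0 // ltW.
have H2 : M%:R * W c <= 2 * #|Q|%:R.
  rewrite -(ler_pM2r P1) -!mulrA [X in 2 * X]mulrC; apply: le_trans Hc2.
  by rewrite ler_pM2l // lerDr mulr_ge0.
exists (S c); split.
- by apply/subsetP => i; rewrite inE => /andP[].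
- by rewrite -(ler_nat rat) !natrM.
rewrite -(ler_nat rat) natr_sum !natrM.
have -> : 8 * M%:R * #|Q|%:R = 4 * M%:R * (2 * #|Q|%:R) :> rat by ring.
apply: le_trans (_ : 4 * M%:R * (M%:R * W c) <= _); last first.
  by rewrite ler_pM2l //; lra.
rewrite /W !mulr_sumr big_mkcond /=; apply: ler_sum => j _.
have Wj0 : 0 <= 4 * M%:R * (M%:R * (w j * (deg (S c) j - deg P j / M%:R) ^+ 2)).
  have H := mulr_ge0 (w0 j) (sqr_ge0 (deg (S c) j - deg P j / M%:R)).
  by apply: mulr_ge0; [lra|apply: mulr_ge0; lra].
case: ifP => [/andP[jQ]|_] //.
rewrite -(ler_nat rat) !natrM -!degE => Hj.
have [d0|d0] := eqVneq (deg P j) 0.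
  by move: Wj0; rewrite d0.
have dpos : 0 < deg P j by rewrite lt_def d0 deg0.
(* For a badly sampled j the deviation is at least half of its mean deg/M, so its weighted square is
   at least deg/(4 M^2). *)
rewrite /w jQ mul1r.
have -> : 4 * M%:R * (M%:R * ((deg P j)^-1 * (deg (S c) j - deg P j / M%:R) ^+ 2)) =
  (2 * M%:R * deg (S c) j - 2 * deg P j) ^+ 2 / deg P j.
  by field; rewrite d0 gt_eqF.
rewrite ler_pdivlMr //; move: Hj dpos; move: (2 * M%:R * deg (S c) j) (deg P j) => a b.
by nra.
Qed.

(** * Incidences between two families of lines *)

(* Red lines [u = x, w = s v + t] and blue lines [v = y, w = s' u + t']. *)
Record line_config (K : fieldType) (I J : finType) := LineConfig {
  rx : I -> K; rs : I -> K; rt : I -> K;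
  by_ : J -> K; bs : J -> K; bt : J -> K;
  rx_inj : injective rx; by_inj : injective by_ }.

Definition swap_config (K : fieldType) (I J : finType) (C : line_config K I J) :
  line_config K J I := LineConfig (bs C) (bt C) (rs C) (rt C) (@by_inj _ _ _ C) (@rx_inj _ _ _ C).

Definition meet (K : fieldType) (I J : finType) (C : line_config K I J) i j :=
  bs C j * rx C i + bt C j == rs C i * by_ C j + rt C i.

Definition incidences (K : fieldType) (I J : finType) (C : line_config K I J)
  (P : {set I}) (Q : {set J}) : nat := (\sum_(i in P) \sum_(j in Q) meet C i j)%N.

Definition red_on (K : fieldType) (I J : finType) (C : line_config K I J) (F : poly3 K) i :=
  on_line (rx C i) (rs C i) (rt C i) F == 0.

(** The red lines counted are those contained in the bilinear surface w = (a u + g) v + b u + d. *)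
Definition bilinear_bound (K : fieldType) (I J : finType) (C : line_config K I J) kappa :=
  forall a g b d : K,
  (#|[set i | ((rs C i == a * rx C i + g) && (rt C i == b * rx C i + d))%R]| <= kappa)%N.

Lemma incidences_swap (K : fieldType) (I J : finType) (C : line_config K I J) P Q :
  incidences (swap_config C) Q P = incidences C P Q.
Proof.
rewrite /incidences exchange_big /=; apply: eq_bigr => i _; apply: eq_bigr => j _.
by rewrite /meet /= eq_sym.
Qed.

Lemma incidencesUl (K : fieldType) (I J : finType) (C : line_config K I J) (f : pred I) P Q :
  incidences C P Q =
  (incidences C [set i in P | f i] Q + incidences C [set i in P | ~~ f i] Q)%N.
Proof.
rewrite /incidences (bigID f) /=; congr (_ + _)%N; apply: eq_bigl => i; rewrite inE //.
Qed.

Lemma incidencesUr (K : fieldType) (I J : finType) (C : line_config K I J) (f : pred J) P Q :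
  incidences C P Q =
  (incidences C P [set j in Q | f j] + incidences C P [set j in Q | ~~ f j])%N.
Proof. by rewrite -!(incidences_swap C) (incidencesUl _ f). Qed.

Lemma incidences_leM (K : fieldType) (I J : finType) (C : line_config K I J) P Q :
  (incidences C P Q <= #|P| * #|Q|)%N.
Proof.
rewrite /incidences -sum_nat_const; apply: leq_sum => i _.
by rewrite -sum1_card; apply: leq_sum => j _; case: meet.
Qed.

Lemma incidences_off_surface (K : fieldType) (I J : finType) (C : line_config K I J)
    (F : poly3 K) (P : {set I}) (Q : {set J}) :
  {in P, forall i, red_on C F i} -> {in Q, forall j, ~~ red_on (swap_config C) (swap3 F) j} ->
  (incidences C P Q <= deg3 F * #|Q|)%N.
Proof.
move=> HP HQ; rewrite /incidences exchange_big /= mulnC -sum_nat_const.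
apply: leq_sum => j jQ; apply: card_meet_surface (@rx_inj _ _ _ C) (HQ j jQ) _.
by move=> i /HP /eqP.
Qed.

Lemma incidences_off_surface' (K : fieldType) (I J : finType) (C : line_config K I J)
    (F : poly3 K) (P : {set I}) (Q : {set J}) :
  {in P, forall i, ~~ red_on C F i} -> {in Q, forall j, red_on (swap_config C) (swap3 F) j} ->
  (incidences C P Q <= deg3 F * #|P|)%N.
Proof.
move=> HP HQ; rewrite -incidences_swap -deg3_swap.
apply: incidences_off_surface => [//|i /HP]; rewrite swap3K.
by case: C {HP HQ}.
Qed.

Lemma red_onM (K : fieldType) (I J : finType) (C : line_config K I J) (F G : poly3 K) i :
  red_on C (F * G) i = red_on C F i || red_on C G i.
Proof.
pose e : {rmorphism poly3 K -> {poly K}} := on_line (rx C i) (rs C i) (rt C i).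
by rewrite /red_on -![on_line _ _ _ _]/(e _) rmorphM mulf_eq0.
Qed.

Lemma swap3M (K : comNzRingType) (F G : poly3 K) : swap3 (F * G) = swap3 F * swap3 G.
Proof.
pose e : {rmorphism poly3 K -> poly3 K} := @swap3 K.
by rewrite -![swap3 _]/(e _) rmorphM.
Qed.

Lemma red_on_unit (K : fieldType) (I J : finType) (C : line_config K I J) (F : poly3 K) i :
  F \is a GRing.unit -> red_on C F i = false.
Proof.
pose e : {rmorphism poly3 K -> {poly K}} := on_line (rx C i) (rs C i) (rt C i).
move=> Fu; have eu := rmorph_unit e Fu.
by apply/negP => /eqP E; move: eu; rewrite -[e F]/(on_line _ _ _ F) E unitr0.
Qed.

(** The prime factors are peeled off one at a time. Lines both on p fall under the hypothesis, pairs
    with exactly one line on p cost [deg3 p] per line, and lines both off p remain for the other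
    factors. The costs add up to the degree of the product. *)
Lemma incidences_on_surface (K : fieldType) (I J : finType) (C : line_config K I J) (B : nat)
    (c : poly3 K) (l : seq (poly3 K)) (P : {set I}) (Q : {set J}) :
  c \is a GRing.unit -> (forall p, p \in l -> p != 0) ->
  (forall p (P' : {set I}) (Q' : {set J}), p \in l ->
     {in P', forall i, red_on C p i} -> {in Q', forall j, red_on (swap_config C) (swap3 p) j} ->
     (incidences C P' Q' <= B * (#|P'| + #|Q'|))%N) ->
  {in P, forall i, red_on C (c * \prod_(p <- l) p) i} ->
  {in Q, forall j, red_on (swap_config C) (swap3 (c * \prod_(p <- l) p)) j} ->
  (incidences C P Q <= (deg3 (c * \prod_(p <- l) p)%R + B) * (#|P| + #|Q|))%N.
Proof.
move=> cu; elim: l P Q => [|p l IH] P Q l0 HB.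
  rewrite big_nil mulr1 => HP _; have -> : P = set0.
    by apply/setP => i; rewrite inE; apply/negP => /HP; rewrite red_on_unit.
  by rewrite /incidences big_set0.
have p0 : p != 0 by apply: l0; rewrite mem_head.
have l0' q : q \in l -> q != 0 by move=> ql; apply: l0; rewrite inE ql orbT.
set F := c * \prod_(q <- l) q in IH *.
have F0 : F != 0.
  rewrite mulf_neq0 //; first by apply: contraTneq cu => ->; rewrite unitr0.
  by rewrite prodf_seq_neq0; apply/allP => q /l0' ->.
have -> : c * \prod_(q <- p :: l) q = p * F by rewrite big_cons mulrCA.
rewrite deg3M // => HP HQ.
pose f i := red_on C p i; pose g j := red_on (swap_config C) (swap3 p) j.
rewrite (incidencesUl _ f) [X in (X + _ <= _)%N](incidencesUr _ g).
rewrite [X in (_ + X <= _)%N](incidencesUr _ g).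
set P1 := [set i in P | f i]; set P2 := [set i in P | ~~ f i].
set Q1 := [set j in Q | g j]; set Q2 := [set j in Q | ~~ g j].
have cP : (#|P1| + #|P2| = #|P|)%N by rewrite -(cardsID [set i | f i] P); congr (_ + _)%N;
  apply: eq_card => i; rewrite !inE // andbC.
have cQ : (#|Q1| + #|Q2| = #|Q|)%N by rewrite -(cardsID [set j | g j] Q); congr (_ + _)%N;
  apply: eq_card => i; rewrite !inE // andbC.
have H11 : (incidences C P1 Q1 <= B * (#|P1| + #|Q1|))%N.
  by apply: (HB p); rewrite ?mem_head // => i; rewrite inE => /andP[].
have H12 : (incidences C P1 Q2 <= deg3 p * #|Q2|)%N.
  by apply: incidences_off_surface => i; rewrite inE => /andP[].
have H21 : (incidences C P2 Q1 <= deg3 p * #|P2|)%N.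
  by apply: incidences_off_surface' => i; rewrite inE => /andP[].
have H22 : (incidences C P2 Q2 <= (deg3 F + B) * (#|P2| + #|Q2|))%N.
  apply: IH => //.
  - by move=> q P' Q' ql; apply: HB; rewrite inE ql orbT.
  - by move=> i; rewrite inE => /andP[/HP]; rewrite red_onM /f => /orP[->|].
  - by move=> j; rewrite inE => /andP[/HQ]; rewrite swap3M red_onM /g => /orP[->|].
move: H11 H12 H21 H22 cP cQ; move: (deg3 p) (deg3 F) => d e.
by move: (incidences _ _ _) (incidences _ _ _) (incidences _ _ _) (incidences _ _ _) => a1 a2 a3 a4; nia.
Qed.

(** A sample of at most j^2/(2 r^2) red lines lies on a surface of degree at most 3 k, with k = j/r
    rounded down. A well sampled blue line off the surface meets at most 3 k sample lines, hence at
    most 6 M k lines of P; the others are charged to [sampling]. On a prime factor, one family has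
    at most 6 (3 k)^2 <= (8 k)^2 lines, or the red lines are at most kappa. The condition r > 2
    keeps 3 k within the range j allowed by the characteristic. *)
Lemma incidence_step (K : fieldType) (I J : finType) (C : line_config K I J)
    (kappa j B r M : nat) (P : {set I}) (Q : {set J}) :
  (2 < r)%N -> M = (4 * r ^ 2)%N -> (forall i, (0 < i <= j)%N -> (i%:R : K) != 0) -> (#|P| <= j ^ 2)%N ->
  bilinear_bound C kappa -> (kappa <= B)%N ->
  (forall (P' : {set I}) (Q' : {set J}), (minn #|P'| #|Q'| <= (8 * (j %/ r)) ^ 2)%N ->
     (incidences C P' Q' <= B * (#|P'| + #|Q'|))%N) ->
  (incidences C P Q <= (B + (6 * M + 6) * (j %/ r) + 8 * M) * (#|P| + #|Q|))%N.
Proof.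
move=> r2 ME char Pj Hk kB HB.
have M0 : (0 < M)%N by rewrite ME; nia.
have [S [SP sS bad]] := @sampling I J (meet C) P Q M M0.
pose k := (j %/ r)%N; have [kj jk] : (r * k <= j)%N /\ (j < r * k.+1)%N.
  by rewrite /k mulnC leq_trunc_div mulnC ltn_ceil //; apply: leq_trans r2.
have [|F [F0 dF FS]] := @surface_through_lines K I (rx C) (rs C) (rt C) S k.+1 isT.
  have r2' : (0 < r ^ 2)%N by rewrite expn_gt0 (ltn_trans _ r2).
  rewrite -(leq_pmul2l r2') -(leq_pmul2l (isT : 0 < 2)%N) -expnMn.
  have -> : (2 * (r ^ 2 * (2 * #|S|)) = M * #|S|)%N by rewrite ME; ring.
  apply: leq_trans sS _; rewrite leq_mul2l /=; apply: leq_trans Pj _.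
  by rewrite leq_exp2r // ltnW.
rewrite /= in dF.
have uK : factorial_ring (poly3 K).
  by do 3!apply: factorial_poly; exact: factorial_field.
have [c [l [cu pl FE]]] := uK F F0.
pose f i := red_on C F i; pose g j := red_on (swap_config C) (swap3 F) j.
rewrite (incidencesUr _ g) [X in (X + _ <= _)%N](incidencesUl _ f).
set P1 := [set i in P | f i]; set P2 := [set i in P | ~~ f i].
set Q1 := [set j in Q | g j]; set Q2 := [set j in Q | ~~ g j].
have P1P : (#|P1| <= #|P|)%N by apply: subset_leq_card; apply/subsetP => i; rewrite inE => /andP[].
have P2P : (#|P2| <= #|P|)%N by apply: subset_leq_card; apply/subsetP => i; rewrite inE => /andP[].
have Q1Q : (#|Q1| <= #|Q|)%N by apply: subset_leq_card; apply/subsetP => i; rewrite inE => /andP[].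
have Q2Q : (#|Q2| <= #|Q|)%N by apply: subset_leq_card; apply/subsetP => i; rewrite inE => /andP[].
have H21 : (incidences C P2 Q1 <= deg3 F * #|P2|)%N.
  by apply: incidences_off_surface' => i; rewrite inE => /andP[].
have H11 : (incidences C P1 Q1 <= (deg3 F + B) * (#|P1| + #|Q1|))%N.
  have HP1 : {in P1, forall i, red_on C F i} by move=> i; rewrite inE => /andP[].
  have HQ1 : {in Q1, forall j, red_on (swap_config C) (swap3 F) j}.
    by move=> i; rewrite inE => /andP[].
  have surf := @incidences_on_surface K I J C B c l P1 Q1; rewrite -FE in surf.
  apply: surf => // [p /pl[]//|p P' Q' pin HP' HQ'].
  have dp : (deg3 p <= 3 * k)%N.
    have FE' : F = p * (c * \prod_(q <- rem p l) q) by rewrite FE (big_rem p) //= mulrCA.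
    move: F0 dF; rewrite FE' mulf_eq0 negb_or => /andP[p0 q0].
    by rewrite deg3M //; apply: leq_trans; rewrite leq_addr.
  have charp i : (0 < i <= deg3 p)%N -> (i%:R : K) != 0.
    move=> /andP[i0 ip]; apply: char; rewrite i0 /=; apply: leq_trans ip _.
    by apply: leq_trans dp _; apply: leq_trans kj; rewrite leq_mul2r r2 orbT.
  case: (prime_surface (P := P') (Q := Q') (x := rx C) (s := rs C) (t := rt C)
    (y := by_ C) (s' := bs C) (t' := bt C) (@rx_inj _ _ _ C) (@by_inj _ _ _ C)
    (pl p pin) charp _ _ Hk) => [i /HP'/eqP//|i /HQ'/eqP//|H|H|H].
  - by apply: HB; rewrite geq_min -/k; apply/orP; left; nia.
  - by apply: HB; rewrite geq_min -/k; apply/orP; right; nia.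
  - by apply: leq_trans (incidences_leM _ _ _) _; nia.
have H2 : (incidences C P Q2 <= (2 * M * (3 * k) + 8 * M) * #|Q|)%N.
  rewrite /incidences exchange_big /= mulnDl.
  rewrite (bigID (fun j => 2 * M * (\sum_(i in S) meet C i j) <= \sum_(i in P) meet C i j)%N) /=.
  rewrite addnC; apply: leq_add; last first.
    apply: leq_trans bad; rewrite !big_mkcondr /=.
    rewrite [leqLHS]big_mkcond [leqRHS]big_mkcond /=; apply: leq_sum => b _.
    by rewrite inE; case: (b \in Q) => //; case: (g b).
  apply: leq_trans (_ : (#|Q2| * (2 * M * (3 * k)) <= _)%N); last by rewrite [leqRHS]mulnC leq_mul2r Q2Q orbT.
  rewrite -sum_nat_const big_mkcondr; apply: leq_sum => b bQ.
  case: ifP => //; rewrite -ltnNge => /ltnW /leq_trans; apply.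
  rewrite leq_mul2l; apply/orP; right.
  apply: leq_trans dF; apply: card_meet_surface (@rx_inj _ _ _ C) _ FS.
  by move: bQ; rewrite inE => /andP[].
rewrite -/k; move: H11 H21 H2 dF P1P P2P Q1Q Q2Q; move: (deg3 F) => d.
move: (incidences _ _ _) (incidences _ _ _) (incidences _ _ _) => a1 a2 a3.
move: (#|P1|) (#|P2|) (#|Q1|) (#|Q2|) (#|P|) (#|Q|) => p1 p2 q1 q2 p q H11 H21 H2 dF p1p p2p q1q q2q.
have h1 : ((d + B) * (p1 + q1) <= (3 * k + B) * (p + q))%N by apply: leq_mul; lia.
have h2 : (d * p2 <= 3 * k * p)%N by apply: leq_mul.
have {H11 h1} H1 := leq_trans H11 h1; have {H21 h2} H3 := leq_trans H21 h2.
clear - H1 H2 H3; nia.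
Qed.


(** Induction on j: what remains on the surface is the same problem at 8 (j / 16) <= j/2, so the
    losses form a geometric series. The term kappa does not accumulate, since each step only
    compares it with the current bound. *)
Theorem incidence_bound : exists c : nat,
  forall (K : fieldType) (I J : finType) (C : line_config K I J)
    (kappa j : nat) (P : {set I}) (Q : {set J}),
  (forall i, (0 < i <= j)%N -> (i%:R : K) != 0) ->
  bilinear_bound C kappa -> bilinear_bound (swap_config C) kappa ->
  (minn #|P| #|Q| <= j ^ 2)%N ->
  (incidences C P Q <= (c * j + kappa) * (#|P| + #|Q|))%N.
Proof.
have [M ME] : exists M, M = (4 * 16 ^ 2)%N by exists (4 * 16 ^ 2)%N.
have M0 : (0 < M)%N by rewrite ME.
exists (20 * M)%N => K I J C kappa j P Q + Hk Hk'.
elim/ltn_ind: j P Q => j IH P Q char.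
have [->|j0] := posnP j.
  rewrite leqn0 => /eqP E; apply: leq_trans (incidences_leM _ _ _) _.
  by move: E; move: (#|P|) (#|Q|) => a b; nia.
have kj : (16 * (j %/ 16) <= j)%N by rewrite mulnC leq_trunc_div.
pose B := (20 * M * (8 * (j %/ 16)) + kappa)%N.
have HB (P' : {set I}) (Q' : {set J}) : (minn #|P'| #|Q'| <= (8 * (j %/ 16)) ^ 2)%N ->
     (incidences C P' Q' <= B * (#|P'| + #|Q'|))%N.
  by apply: IH => [|i /andP[i0 ij]]; [lia|apply: char; rewrite i0; lia].
have arith n m : (n <= (B + (6 * M + 6) * (j %/ 16) + 8 * M) * m)%N ->
    (n <= (20 * M * j + kappa) * m)%N.
  move/leq_trans; apply; rewrite leq_mul2r; apply/orP; right; rewrite /B.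
  by move: kj; move: (j %/ 16)%N => k; clear - M0 j0; nia.
have kB : (kappa <= B)%N by rewrite leq_addl.
rewrite geq_min => /orP[Pj|Qj]; apply: arith.
  exact: (@incidence_step _ _ _ C kappa j B 16 M P Q isT ME char Pj Hk kB HB).
rewrite -incidences_swap [(#|P| + _)%N]addnC; apply: (@incidence_step _ _ _ (swap_config C) kappa j B 16 M Q P isT ME char Qj Hk' kB).
by move=> P' Q'; rewrite incidences_swap minnC [(#|P'| + _)%N]addnC; exact: HB.
Qed.

Lemma meet_field (K : fieldType) (X x s t x' s' t' : K) :
  1 + X * s' != 0 -> 1 + X ^+ 4 * s != 0 ->
  s / (1 + X ^+ 4 * s) * ((x + X ^+ 2 * s' + X ^+ 4 * t') / (1 + X * s')) + t / (1 + X ^+ 4 * s)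
  - (s' / (1 + X * s') * ((x' + X * t + X ^+ 2 * s) / (1 + X ^+ 4 * s)) + t' / (1 + X * s'))
  = (s * x + t - (s' * x' + t')) / ((1 + X * s') * (1 + X ^+ 4 * s)).
Proof. by move=> q0 r0; field; rewrite q0 r0. Qed.

(** * Rich lines of a grid *)

Section Embedding.

Variable F : finFieldType.
Local Notation K := {fraction {poly F}}.

Definition fconst (c : F) : K := tofrac c%:P.
Definition fX : K := tofrac 'X.

Lemma fconst_is_zmod_morphism : zmod_morphism fconst.
Proof. by move=> a b; rewrite /fconst polyCB rmorphB. Qed.
Lemma fconst_is_monoid_morphism : monoid_morphism fconst.
Proof. by split=> [|a b]; rewrite /fconst ?polyC1 ?rmorph1 // polyCM rmorphM. Qed.
HB.instance Definition _ := GRing.isZmodMorphism.Build F K fconst fconst_is_zmod_morphism.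
HB.instance Definition _ := GRing.isMonoidMorphism.Build F K fconst fconst_is_monoid_morphism.

Lemma fconst_inj : injective fconst.
Proof. exact: fmorph_inj. Qed.

(** Elements of K polynomial in [fX], given by coefficient lists, so that an identity in K can be
    read off coefficient by coefficient. *)
Definition fpoly (l : seq F) : K := tofrac (Poly l).

Lemma fpoly_nil : fpoly [::] = 0.
Proof. by rewrite /fpoly /= rmorph0. Qed.

Lemma fpoly_cons c l : fpoly (c :: l) = fpoly l * fX + fconst c.
Proof. by rewrite /fpoly /= cons_poly_def rmorphD rmorphM. Qed.

Lemma fpoly_inj l l' : fpoly l = fpoly l' -> forall i, l`_i = l'`_i.
Proof.
move=> E i; have /eqP := E; rewrite tofrac_eq => /eqP E'.
by rewrite -(coef_Poly l) E' coef_Poly.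
Qed.

(* A generic choice of coordinates: scaling by the denominators keeps the incidence relation
   [s x + t = s' x' + t'] (see [meet_field]), and makes the first coordinates of the lines
   pairwise distinct although the [x] and the slopes repeat. *)
Definition red_den (q : F * (F * F)) : K := 1 + fX * fconst q.2.1.
Definition red_x (q : F * (F * F)) : K :=
  (fconst q.1 + fX ^+ 2 * fconst q.2.1 + fX ^+ 4 * fconst q.2.2) / red_den q.
Definition blue_den (q : F * (F * F)) : K := 1 + fX ^+ 4 * fconst q.2.1.
Definition blue_y (q : F * (F * F)) : K :=
  (fconst q.1 + fX * fconst q.2.2 + fX ^+ 2 * fconst q.2.1) / blue_den q.

Lemma red_den_neq0 q : red_den q != 0.
Proof.
apply/eqP => E; have : fpoly [:: 1; q.2.1] = fpoly [::].
  by rewrite !fpoly_cons fpoly_nil -[RHS]E /red_den rmorph1; ring.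
by move=> /fpoly_inj /(_ 0%N) /= /eqP; rewrite oner_eq0.
Qed.

Lemma blue_den_neq0 q : blue_den q != 0.
Proof.
apply/eqP => E; have : fpoly [:: 1; 0; 0; 0; q.2.1] = fpoly [::].
  by rewrite !fpoly_cons fpoly_nil -[RHS]E /blue_den rmorph1 rmorph0; ring.
by move=> /fpoly_inj /(_ 0%N) /= /eqP; rewrite oner_eq0.
Qed.

Lemma red_x_inj : injective red_x.
Proof.
move=> [x [s t]] [x' [s' t']] /eqP; rewrite /red_x eqr_div ?red_den_neq0 // /red_den /= => /eqP E.
(* After cross-multiplication the products occupy the odd orders only; orders 0, 2 and 4 give back
   x, s and t. This is the reason for the exponents 2 and 4 in [red_x]. *)
have : fpoly [:: x; x * s'; s; s * s'; t; t * s'] = fpoly [:: x'; x' * s; s'; s' * s; t'; t' * s].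
  rewrite !fpoly_cons fpoly_nil !rmorphM /=.
  by transitivity ((fconst x + fX ^+ 2 * fconst s + fX ^+ 4 * fconst t) * (1 + fX * fconst s'));
    [ring|rewrite E; ring].
by move=> H; move: (fpoly_inj H 0%N) (fpoly_inj H 2) (fpoly_inj H 4) => /= -> -> ->.
Qed.

Lemma blue_y_inj : injective blue_y.
Proof.
move=> [x [s t]] [x' [s' t']] /eqP; rewrite /blue_y eqr_div ?blue_den_neq0 // /blue_den /= => /eqP E.
have : fpoly [:: x; t; s; 0; x * s'; t * s'; s * s'] =
       fpoly [:: x'; t'; s'; 0; x' * s; t' * s; s' * s].
  rewrite !fpoly_cons fpoly_nil !rmorphM rmorph0 /=.
  by transitivity ((fconst x + fX * fconst t + fX ^+ 2 * fconst s) * (1 + fX ^+ 4 * fconst s'));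
    [ring|rewrite E; ring].
by move=> H; move: (fpoly_inj H 0%N) (fpoly_inj H 1) (fpoly_inj H 2) => /= -> -> ->.
Qed.

Definition grid_config (P : {set F * (F * F)}) : line_config K {q | q \in P} {q | q \in P} :=
  LineConfig (fun q => fconst (val q).2.1 / red_den (val q))
    (fun q => fconst (val q).2.2 / red_den (val q))
    (fun q => fconst (val q).2.1 / blue_den (val q))
    (fun q => fconst (val q).2.2 / blue_den (val q))
    (inj_comp red_x_inj val_inj) (inj_comp blue_y_inj val_inj).

Lemma meet_grid (P : {set F * (F * F)}) (q r : {q | q \in P}) :
  meet (grid_config P) q r =
  ((val r).2.1 * (val q).1 + (val r).2.2 == (val q).2.1 * (val r).1 + (val q).2.2).
Proof.
rewrite /meet /=; move: (val q) (val r) => {q} q {r} r.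
rewrite -(inj_eq fconst_inj) !rmorphD !rmorphM /= /red_x /blue_y.
have q0 := red_den_neq0 q; have r0 := blue_den_neq0 r.
rewrite -subr_eq0 -[RHS]subr_eq0 [X in X == 0](meet_field _ _ _ _ q0 r0).
by rewrite mulf_eq0 invr_eq0 mulf_eq0 (negPf q0) (negPf r0) !orbF.
Qed.

End Embedding.

(* [(l, m)] are homogeneous coordinates of points of a line, normalised off a point of it. *)
Lemma pencil_minor (K : fieldType) (a0 b0 l1 m1 l2 m2 l3 m3 p q p' q' : K) :
  l1 * a0 + m1 * b0 = 1 -> l2 * a0 + m2 * b0 = 1 -> l3 * a0 + m3 * b0 = 1 ->
  ((m2 * p + l2 * q) - (m1 * p + l1 * q)) * ((m3 * p' + l3 * q') - (m1 * p' + l1 * q')) =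
  ((m3 * p + l3 * q) - (m1 * p + l1 * q)) * ((m2 * p' + l2 * q') - (m1 * p' + l1 * q')).
Proof.
move=> E1 E2 E3; pose W := (l2 - l1) * (m3 - m1) - (l3 - l1) * (m2 - m1).
have diff l m : l * a0 + m * b0 = 1 -> (l - l1) * a0 = - ((m - m1) * b0).
  move=> E; apply/eqP; rewrite -addr_eq0; apply/eqP.
  have -> : (l - l1) * a0 + (m - m1) * b0 = (l * a0 + m * b0) - (l1 * a0 + m1 * b0) by ring.
  by rewrite E E1 subrr.
have D2 := diff _ _ E2; have D3 := diff _ _ E3.
have Wa : W * a0 = 0.
  have -> : W * a0 = (l2 - l1) * a0 * (m3 - m1) - (l3 - l1) * a0 * (m2 - m1) by rewrite /W; ring.
  by rewrite D2 D3; ring.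
have Wb : W * b0 = 0.
  have -> : W * b0 = (l2 - l1) * ((m3 - m1) * b0) - (l3 - l1) * ((m2 - m1) * b0) by rewrite /W; ring.
  have -> : (m3 - m1) * b0 = - ((l3 - l1) * a0) by rewrite D3 opprK.
  have -> : (m2 - m1) * b0 = - ((l2 - l1) * a0) by rewrite D2 opprK.
  by ring.
have W0 : W = 0 by rewrite -[W]mulr1 -E1 mulrDr mulrCA Wa mulrCA Wb !mulr0 addr0.
apply/eqP; rewrite -subr_eq0; apply/eqP.
transitivity ((q * p' - p * q') * W); last by rewrite W0 mulr0.
by rewrite /W; ring.
Qed.

(** Collinearity of three points (x, s, t) of affine space: the 2 by 2 minors of two difference
    vectors vanish. Coincident points are allowed. *)
Definition collinear3 (F : fieldType) (q1 q2 q3 : F * (F * F)) : Prop :=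
  [/\ (q2.1 - q1.1) * (q3.2.1 - q1.2.1) = (q3.1 - q1.1) * (q2.2.1 - q1.2.1),
      (q2.1 - q1.1) * (q3.2.2 - q1.2.2) = (q3.1 - q1.1) * (q2.2.2 - q1.2.2) &
      (q2.2.1 - q1.2.1) * (q3.2.2 - q1.2.2) = (q3.2.1 - q1.2.1) * (q2.2.2 - q1.2.2)].

Lemma collinear3_fconst (F : finFieldType) (q1 q2 q3 : F * (F * F))
   (a0 b0 x x' s s' t t' : {fraction {poly F}}) (l m : F * (F * F) -> {fraction {poly F}}) :
  (forall q, q \in [:: q1; q2; q3] ->
     [/\ l q * a0 + m q * b0 = 1, fconst q.1 = m q * x + l q * x',
         fconst q.2.1 = m q * s + l q * s' & fconst q.2.2 = m q * t + l q * t']) ->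
  collinear3 q1 q2 q3.
Proof.
move=> H; have [|E1 x1 s1 t1] := H q1; first by rewrite inE eqxx.
have [|E2 x2 s2 t2] := H q2; first by rewrite !inE eqxx orbT.
have [|E3 x3 s3 t3] := H q3; first by rewrite !inE eqxx !orbT.
split; apply: (@fconst_inj F); rewrite !rmorphM !rmorphB /=;
  rewrite ?x1 ?x2 ?x3 ?s1 ?s2 ?s3 ?t1 ?t2 ?t3; exact: pencil_minor E1 E2 E3.
Qed.

Lemma div_linear (K : fieldType) (s n e a g : K) :
  e != 0 -> s / e = a * (n / e) + g -> s = n * a + e * g.
Proof.
move=> e0 E; have -> : s = s / e * e by rewrite divfK.
by rewrite E; field.
Qed.

(** On a bilinear surface s and t are linear in the numerator n and the denominator e of the
    abscissa. The definitions of e and n then show that (e, n) runs over an affine line and that x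
    is linear in (e, n) too. *)
Lemma red_pencil (K : fieldType) (X x s t a g b d : K) :
  let e := 1 + X * s in let n := x + X ^+ 2 * s + X ^+ 4 * t in
  s = n * a + e * g -> t = n * b + e * d ->
  e * (1 - X * g) + n * (- (X * a)) = 1 /\
  x = n * (1 - X ^+ 2 * a - X ^+ 4 * b) + e * (- (X ^+ 2 * g) - X ^+ 4 * d).
Proof.
move=> e n sE tE; split.
  have -> : e * (1 - X * g) + n * (- (X * a)) = e - X * (n * a + e * g) by ring.
  by rewrite -sE /e; ring.
have -> : n * (1 - X ^+ 2 * a - X ^+ 4 * b) + e * (- (X ^+ 2 * g) - X ^+ 4 * d) =
   n - X ^+ 2 * (n * a + e * g) - X ^+ 4 * (n * b + e * d) by ring.
by rewrite -sE -tE /n; ring.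
Qed.

Lemma blue_pencil (K : fieldType) (X x s t a g b d : K) :
  let e := 1 + X ^+ 4 * s in let n := x + X * t + X ^+ 2 * s in
  s = n * a + e * g -> t = n * b + e * d ->
  e * (1 - X ^+ 4 * g) + n * (- (X ^+ 4 * a)) = 1 /\
  x = n * (1 - X * b - X ^+ 2 * a) + e * (- (X * d) - X ^+ 2 * g).
Proof.
move=> e n sE tE; split.
  have -> : e * (1 - X ^+ 4 * g) + n * (- (X ^+ 4 * a)) = e - X ^+ 4 * (n * a + e * g) by ring.
  by rewrite -sE /e; ring.
have -> : n * (1 - X * b - X ^+ 2 * a) + e * (- (X * d) - X ^+ 2 * g) =
   n - X * (n * b + e * d) - X ^+ 2 * (n * a + e * g) by ring.
by rewrite -sE -tE /n; ring.
Qed.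

(** By the pencil identities, the triples (x, s, t) whose lines lie on a common bilinear surface are
    collinear over K, hence over F since their coordinates are constants. *)
Lemma grid_bilinear_bound (F : finFieldType) (P : {set F * (F * F)}) (kappa : nat) :
  (forall T : {set F * (F * F)}, T \subset P ->
     (forall q1 q2 q3, q1 \in T -> q2 \in T -> q3 \in T -> collinear3 q1 q2 q3) ->
     (#|T| <= kappa)%N) ->
  bilinear_bound (grid_config P) kappa /\ bilinear_bound (swap_config (grid_config P)) kappa.
Proof.
move=> HT; have three (T : {set F * (F * F)}) (R : F * (F * F) -> Prop) q1 q2 q3 :
    (forall q, q \in T -> R q) -> q1 \in T -> q2 \in T -> q3 \in T ->
    forall q, q \in [:: q1; q2; q3] -> R q.
  by move=> TR T1 T2 T3 q; rewrite !inE => /or3P[] /eqP ->; apply: TR.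
split=> a g b d; rewrite -(card_imset _ val_inj); apply: HT;
  try by apply/subsetP => q /imsetP[r _ ->]; exact: valP.
- move=> q1 q2 q3 T1 T2 T3.
  apply: (@collinear3_fconst F q1 q2 q3 (1 - fX F * g) (- (fX F * a))
    (1 - fX F ^+ 2 * a - fX F ^+ 4 * b) (- (fX F ^+ 2 * g) - fX F ^+ 4 * d) a g b d
    (fun q => red_den q) (fun q => fconst q.1 + fX F ^+ 2 * fconst q.2.1 + fX F ^+ 4 * fconst q.2.2)).
  apply: three T1 T2 T3 => q /imsetP[r]; rewrite inE /= => /andP[/eqP sE /eqP tE] ->.
  have {}sE := div_linear (red_den_neq0 _) sE; have {}tE := div_linear (red_den_neq0 _) tE.
  by have [H1 H2] := red_pencil sE tE.
- move=> q1 q2 q3 T1 T2 T3.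
  apply: (@collinear3_fconst F q1 q2 q3 (1 - fX F ^+ 4 * g) (- (fX F ^+ 4 * a))
    (1 - fX F * b - fX F ^+ 2 * a) (- (fX F * d) - fX F ^+ 2 * g) a g b d
    (fun q => blue_den q) (fun q => fconst q.1 + fX F * fconst q.2.2 + fX F ^+ 2 * fconst q.2.1)).
  apply: three T1 T2 T3 => q /imsetP[r]; rewrite inE /= => /andP[/eqP sE /eqP tE] ->.
  have {}sE := div_linear (blue_den_neq0 _) sE; have {}tE := div_linear (blue_den_neq0 _) tE.
  by have [H1 H2] := blue_pencil sE tE.
Qed.

(** * Counting rich lines *)

Lemma sum_sqr_leq (I : finType) (P : {set I}) (f : I -> nat) :
  ((\sum_(i in P) f i) ^ 2 <= #|P| * \sum_(i in P) f i ^ 2)%N.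
Proof.
have -> : (#|P| * \sum_(i in P) f i ^ 2 = \sum_(i in P) \sum_(j in P) f j ^ 2)%N.
  by rewrite sum_nat_const.
rewrite -(leq_pmul2l (isT : 0 < 2)%N) [X in (_ <= X)%N]mul2n -addnn {2}exchange_big /=.
rewrite -big_split /= -mulnn big_distrlr /= big_distrr /=; apply: leq_sum => i _.
rewrite -big_split /= big_distrr /=; apply: leq_sum => j _.
by have [+ _] := nat_Cauchy (f i) (f j); rewrite addnC.
Qed.

Definition line_value (F : fieldType) (l : F * F) (x : F) : F := l.1 * x + l.2.

Definition richness (F : finFieldType) (A B : {set F}) (l : F * F) : nat :=
  #|[set x in A | line_value l x \in B]|.

(** Away from the abscissa a0 every grid point lies on at most one line of L, and discarding a0
    costs at most one point per line: (k - 1) |L| <= |A| |B|, with k <= 2 (k - 1). *)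
Lemma card_lines_pencil (F : finFieldType) (A B : {set F}) (L : {set F * F}) (k : nat) (a0 : F) :
  (1 < k)%N -> {in L, forall l, (k <= richness A B l)%N} ->
  {in L &, forall l l' x, x != a0 -> line_value l x = line_value l' x -> l = l'} ->
  (k * #|L| <= 2 * (#|A| * #|B|))%N.
Proof.
move=> k1 Lk La.
pose W := [set q : (F * F) * F | [&& q.1 \in L, q.2 \in A & line_value q.1 q.2 \in B]].
have cW : (k * #|L| <= #|W|)%N.
  have -> : #|W| = (\sum_(l in L) richness A B l)%N.
    rewrite -[#|W|]sum1_card.
    rewrite (partition_big (fun q : (F * F) * F => q.1) (fun l => l \in L)) /=; last first.
      by move=> q; rewrite !inE => /and3P[].
    apply: eq_bigr => l lL; rewrite sum1_card /richness.
    rewrite -(card_imset _ (_ : injective (fun x : F => (l, x)))); last by move=> x y [].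
    apply: eq_card => -[l' x]; rewrite [LHS]unfold_in /=.
    apply/andP/imsetP => [[]|[y]]; rewrite !inE /=.
      by move=> /and3P[_ xA xB] /eqP El; rewrite El in xB *; exists x => //; rewrite inE xA.
    by move=> /andP[yA yB] [-> ->]; rewrite lL yA yB.
  by rewrite mulnC -sum_nat_const; apply: leq_sum => l /Lk.
have W0 : (#|[set q in W | q.2 == a0]| <= #|L|)%N.
  have <- : #|[set (l, a0) | l in L]| = #|L| by apply: card_imset => l l' [].
  apply: subset_leq_card; apply/subsetP => -[l x]; rewrite !inE /= => /andP[/and3P[lL _ _] /eqP ->].
  exact: imset_f.
have W1 : (#|[set q in W | q.2 != a0]| <= #|A| * #|B|)%N.
  rewrite -cardsX.
  rewrite -(card_in_imset (f := fun q : (F * F) * F => (q.2, line_value q.1 q.2))).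
    apply: subset_leq_card; apply/subsetP => z /imsetP[[l x] qW ->]; move: qW.
    by rewrite !inE /= => /andP[/and3P[_ xA xB] _]; rewrite xA xB.
  move=> [l x] [l' x'] /=; rewrite !inE /= => /andP[/and3P[lL _ _] x0] /andP[/and3P[lL' _ _] _].
  by move=> [<- E]; rewrite (La _ _ lL lL' _ x0 E).
have cWE : #|W| = (#|[set q in W | q.2 == a0]| + #|[set q in W | q.2 != a0]|)%N.
  rewrite -(cardsID [set q | q.2 == a0] W); congr (_ + _)%N; apply: eq_card => q.
    by rewrite !inE.
  by rewrite !inE andbC.
move: cW W0 W1; rewrite cWE; move: (#|[set q in W | q.2 == a0]|) (#|[set q in W | q.2 != a0]|) => u v.
by move: (#|L|) (#|A| * #|B|)%N => a b; nia.
Qed.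

(** On a line of the space of (x, s, t), either x determines the point, giving at most |A| points,
    or x is constant and the k-rich lines (s, t) are concurrent or parallel. *)
Lemma card_collinear (F : finFieldType) (A B : {set F}) (Q : {set F * F}) (k : nat)
    (T : {set F * (F * F)}) :
  (1 < k)%N -> {in Q, forall l, (k <= richness A B l)%N} -> T \subset setX A Q ->
  (forall q1 q2 q3, q1 \in T -> q2 \in T -> q3 \in T -> collinear3 q1 q2 q3) ->
  (#|T| <= #|A| + (2 * (#|A| * #|B|)) %/ k)%N.
Proof.
move=> k1 Qk /subsetP TAQ Tcol.
have [->|/set0Pn [q1 T1]] := eqVneq T set0; first by rewrite cards0.
have [[q2 [T2 /eqP x12]]|xall] := EM (exists q2, q2 \in T /\ q2.1 <> q1.1).
  apply: leq_trans (leq_addr _ _).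
  rewrite -(card_in_imset (f := fun q : F * (F * F) => q.1)).
    by apply: subset_leq_card; apply/subsetP => z /imsetP[q /TAQ + ->]; rewrite inE => /andP[].
  move=> q3 q4 T3 T4 E; have x0 : q2.1 - q1.1 != 0 by rewrite subr_eq0.
  have [s3 t3 _] := Tcol _ _ _ T1 T2 T3; have [s4 t4 _] := Tcol _ _ _ T1 T2 T4.
  rewrite E in s3 t3.
  have /(mulfI x0) /addIr es := etrans s3 (esym s4).
  have /(mulfI x0) /addIr et := etrans t3 (esym t4).
  by case: q3 q4 E es et {T3 T4 s3 s4 t3 t4} => [? [? ?]] [? [? ?]] /= -> -> ->.
have {}xall q : q \in T -> q.1 = q1.1.
  by move=> qT; apply: contrapT => H; apply: xall; exists q.
pose L := [set q.2 | q in T].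
have cL : #|L| = #|T|.
  apply: card_in_imset => -[x l] [x' l'] /xall /= -> /xall /= ->.
  by move=> ->.
have LQ : {in L, forall l, (k <= richness A B l)%N}.
  by move=> z /imsetP[q /TAQ + ->]; rewrite inE => /andP[_ /Qk].
apply: leq_trans (leq_addl _ _); rewrite leq_divRL ?(ltn_trans _ k1) // mulnC -cL.
have [[q2 [T2 /eqP s12]]|sall] := EM (exists q2, q2 \in T /\ q2.2.1 <> q1.2.1).
  have s0 : q2.2.1 - q1.2.1 != 0 by rewrite subr_eq0.
  pose c := (q2.2.2 - q1.2.2) / (q2.2.1 - q1.2.1).
  have Lc l : l \in L -> l.2 - q1.2.2 = c * (l.1 - q1.2.1).
    move=> /imsetP[q qT ->]; have [_ _ E] := Tcol _ _ _ T1 T2 qT.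
    by apply: (mulfI s0); rewrite E /c; field.
  (* Intercepts affine in the slope with factor c: the lines all meet above - c. *)
  apply: (card_lines_pencil (a0 := - c) k1 LQ) => l l' lL lL' x xc E.
  have l2 : l.2 = q1.2.2 + c * (l.1 - q1.2.1) by rewrite -Lc // addrC subrK.
  have l2' : l'.2 = q1.2.2 + c * (l'.1 - q1.2.1) by rewrite -Lc // addrC subrK.
  have E1 : (l.1 - l'.1) * (x + c) = 0.
    have -> : (l.1 - l'.1) * (x + c) = line_value l x - line_value l' x.
      by rewrite /line_value l2 l2'; ring.
    by rewrite E subrr.
  have e1 : l.1 = l'.1.
    apply/eqP; move/eqP: E1; rewrite mulf_eq0 subr_eq0 => /orP[//|].
    by rewrite addr_eq0 (negPf xc).
  by case: l l' e1 l2 l2' {lL lL' E E1} => [? ?] [? ?] /= -> -> ->.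
have Ls l : l \in L -> l.1 = q1.2.1.
  move=> /imsetP[q qT ->]; apply: contrapT => H; apply: sall; by exists q.
(* Parallel lines never meet, and any a0 would serve. *)
apply: (card_lines_pencil (a0 := 0) k1 LQ) => l l' /Ls + /Ls + x _.
by case: l l' => [? ?] [? ?] /= -> ->; rewrite /line_value /= => /addrI ->.
Qed.

Lemma fraction_natr_neq0 (F : finFieldType) (i : nat) :
  (i%:R : F) != 0 -> (i%:R : {fraction {poly F}}) != 0.
Proof.
move=> i0; have -> : (i%:R : {fraction {poly F}}) = fconst (i%:R : F) by rewrite rmorph_nat.
by rewrite -(rmorph0 (@fconst F)) (inj_eq (@fconst_inj F)).
Qed.

(** Let V(y) count the pairs (x, l) in A and Q with value y. Its second moment is the number of
    incidences of the family indexed by A x Q with itself, while its sum over B is at least k |Q|;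
    Cauchy-Schwarz over B compares them. *)
Lemma rich_lines_energy : exists c : nat,
  forall (F : finFieldType) (A B : {set F}) (Q : {set F * F}) (k j : nat),
  (1 < k)%N -> {in Q, forall l, (k <= richness A B l)%N} ->
  (forall i, (0 < i <= j)%N -> (i%:R : F) != 0) -> (#|A| * #|Q| <= j ^ 2)%N ->
  ((k * #|Q|) ^ 2 <=
   #|B| * ((c * j + (#|A| + (2 * (#|A| * #|B|)) %/ k)) * (2 * (#|A| * #|Q|))))%N.
Proof.
have [c Hc] := incidence_bound; exists c => F A B Q k j k1 Qk char AQ.
pose P := setX A Q.
have [b1 b2] := @grid_bilinear_bound F P _ (fun T TP => @card_collinear F A B Q k T k1 Qk TP).
have cP : #|[set: {q | q \in P}]| = (#|A| * #|Q|)%N.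
  by rewrite cardsT card_sig -cardsX; apply: eq_card.
have := Hc _ _ _ (grid_config P) _ j setT setT (fun i Hi => fraction_natr_neq0 (char i Hi)) b1 b2.
rewrite cP minnn => /(_ AQ); rewrite addnn -mul2n.
pose V (y : F) := (\sum_(x in A) \sum_(l in Q) (line_value l x == y))%N.
have -> : incidences (grid_config P) setT setT = (\sum_y V y ^ 2)%N.
  rewrite /incidences.
  transitivity (\sum_(q in P) \sum_(r in P) (line_value r.2 q.1 == line_value q.2 r.1))%N.
    rewrite [in RHS]big_sub /=; apply: eq_big => [q|q _]; first by rewrite inE.
    rewrite [in RHS]big_sub /=; apply: eq_big => [r|r _]; first by rewrite inE.
    by rewrite meet_grid.
  transitivity (\sum_(x in A) \sum_(l in Q) \sum_(x' in A) \sum_(l' in Q)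
      (line_value l x == line_value l' x'))%N.
    rewrite (eq_bigl (fun q => (q.1 \in A) && (q.2 \in Q))); last by move=> q; rewrite inE.
    rewrite -(pair_big (mem A) (mem Q) (fun x l' => \sum_(r in P) (line_value r.2 x == line_value l' r.1)))%N /=.
    apply: eq_bigr => x _; rewrite exchange_big.
    rewrite (eq_bigl (fun q => (q.1 \in A) && (q.2 \in Q))); last by move=> q; rewrite inE.
    rewrite -(pair_big (mem A) (mem Q) (fun x' l => \sum_(l' in Q) (line_value l x == line_value l' x')))%N /=.
    by rewrite exchange_big.
  rewrite /V; under [RHS]eq_bigr => y _ do rewrite -mulnn big_distrl /=.
  rewrite [RHS]exchange_big /=; apply: eq_bigr => x _.
  under [RHS]eq_bigr => y _ do rewrite big_distrl /=.
  rewrite [RHS]exchange_big /=; apply: eq_bigr => l _.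
  rewrite [RHS](bigD1 (line_value l x)) //= eqxx mul1n [X in (_ + X)%N]big1 ?addn0; last first.
    by move=> y /negPf; rewrite eq_sym => ->; rewrite mul0n.
  by apply: eq_bigr => x' _; apply: eq_bigr => l' _; rewrite eq_sym.
move=> E; apply: leq_trans (_ : (#|B| * \sum_(y in B) V y ^ 2 <= _)%N); last first.
  rewrite leq_mul2l; apply/orP; right; apply: leq_trans E.
  by rewrite [leqRHS](bigID (mem B)) /= leq_addr.
apply: leq_trans (sum_sqr_leq B V); rewrite leq_exp2r //.
have -> : (\sum_(y in B) V y = \sum_(l in Q) richness A B l)%N.
  rewrite /V exchange_big /= [RHS](eq_bigr (fun l => \sum_(x in A) (line_value l x \in B))%N).
    rewrite [RHS]exchange_big /=; apply: eq_bigr => x _; rewrite exchange_big /=; apply: eq_bigr => l _.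
    have [lB|lB] := boolP (line_value l x \in B).
      rewrite (bigD1 (line_value l x)) //= eqxx big1 // => y /andP[_ /negPf].
      by rewrite eq_sym => ->.
    by rewrite big1 // => y yB; case: eqP => // E'; rewrite E' yB in lB.
  by move=> l _; rewrite sum_nat_of_bool.
by rewrite mulnC -sum_nat_const; apply: leq_sum => l /Qk.
Qed.

Lemma subset_of_card (T : finType) (Q : {set T}) n : (n <= #|Q|)%N ->
  exists2 Q' : {set T}, Q' \subset Q & #|Q'| = n.
Proof.
move=> nQ; exists [set x in take n (enum Q)].
  by apply/subsetP => x; rewrite inE => /mem_take; rewrite mem_enum.
rewrite cardsE; move/card_uniqP: (take_uniq n (enum_uniq Q)) => ->.
by rewrite size_takel // -cardE.
Qed.

Lemma sqrt_bracket n : (0 < n)%N -> exists j, (n <= j ^ 2 /\ j ^ 2 <= 4 * n)%N.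
Proof.
move=> n0; have ex : exists j, (n <= j ^ 2)%N by exists n; nia.
case: (ex_minnP ex) => j nj jmin; exists j; split=> //.
case: j nj jmin => [|j] nj jmin; first by nia.
have : ~~ (n <= j ^ 2)%N by apply/negP => /jmin; rewrite ltnn.
by rewrite -ltnNge; nia.
Qed.

(** Solves for q the inequality of [rich_lines_energy], where h stands for 2 a b / k. If c j k
    dominates 3 a b, the square of k^2 q <= 4 a b c j is combined with j^2 <= 4 a q; otherwise k^3 q
    <= 12 (a b)^2 is combined with k <= a. *)
Lemma rich_arithmetic (c a b q k j h : nat) :
  (j ^ 2 <= 4 * (a * q))%N -> (1 < k)%N -> (k <= a)%N -> (a <= b)%N -> (0 < q)%N ->
  (h * k <= 2 * (a * b))%N ->
  ((k * q) ^ 2 <= b * ((c * j + (a + h)) * (2 * (a * q))))%N ->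
  (k ^ 4 * q <= (64 * c ^ 2 + 12) * (a ^ 3 * b ^ 2))%N.
Proof.
move=> jq k1 ka ab q0 hk E.
have k0 : (0 < k)%N by apply: ltn_trans k1.
have E1 : (k ^ 2 * q <= 2 * (a * b) * (c * j + (a + h)))%N.
  rewrite -(leq_pmul2r q0); move: E; congr (_ <= _)%N; ring.
have E2 : (k ^ 3 * q <= 2 * (a * b) * (c * j * k + 3 * (a * b)))%N.
  apply: (@leq_trans (2 * (a * b) * (c * j + (a + h)) * k)).
    by move: E1; rewrite -(leq_pmul2r k0); congr (_ <= _)%N; ring.
  rewrite -mulnA leq_mul2l; apply/orP; right; rewrite !mulnDl leq_add2l.
  have : (a * k <= a * b)%N by rewrite leq_mul2l (leq_trans ka ab) orbT.
  by move: hk; lia.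
rewrite mulnDl; have [large|small] := leqP (3 * (a * b)) (c * j * k).
  apply: leq_trans (leq_addr _ _).
  have E3 : (k ^ 2 * q <= 4 * (a * b) * (c * j))%N.
    rewrite -(leq_pmul2r k0); apply: leq_trans (_ : (k ^ 3 * q <= _)%N).
      by rewrite (_ : k ^ 2 * q * k = k ^ 3 * q)%N //; ring.
    apply: leq_trans E2 _; apply: (@leq_trans (2 * (a * b) * (2 * (c * j * k)))).
      by rewrite leq_mul2l; apply/orP; right; rewrite mul2n -addnn leq_add2l.
    by apply: eq_leq; ring.
  rewrite -(leq_pmul2r q0).
  have -> : (k ^ 4 * q * q = (k ^ 2 * q) ^ 2)%N by ring.
  apply: leq_trans (_ : ((4 * (a * b) * (c * j)) ^ 2 <= _)%N); first by rewrite leq_exp2r.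
  have -> : ((4 * (a * b) * (c * j)) ^ 2 = 16 * (a * b) ^ 2 * c ^ 2 * j ^ 2)%N by ring.
  have -> : (64 * c ^ 2 * (a ^ 3 * b ^ 2) * q = 16 * (a * b) ^ 2 * c ^ 2 * (4 * (a * q)))%N by ring.
  by rewrite leq_mul2l jq orbT.
apply: leq_trans (leq_addl _ _).
have E3 : (k ^ 3 * q <= 12 * (a * b) ^ 2)%N.
  apply: leq_trans E2 _; apply: (@leq_trans (2 * (a * b) * (2 * (3 * (a * b))))).
    by rewrite leq_mul2l; apply/orP; right; rewrite mul2n -addnn leq_add2r ltnW.
  by apply: eq_leq; ring.
have -> : (k ^ 4 * q = k * (k ^ 3 * q))%N by ring.
have -> : (12 * (a ^ 3 * b ^ 2) = a * (12 * (a * b) ^ 2))%N by ring.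
exact: leq_mul.
Qed.

Lemma rich_lines_small : exists c : nat,
  forall (F : finFieldType) (p : nat) (A B : {set F}) (Q : {set F * F}) (k : nat),
  (forall i, (0 < i < p)%N -> (i%:R : F) != 0) ->
  (1 < k <= #|A|)%N -> (#|A| <= #|B|)%N -> {in Q, forall l, (k <= richness A B l)%N} ->
  (4 * (#|A| * #|Q|) < p ^ 2)%N ->
  (k ^ 4 * #|Q| <= c * (#|A| ^ 3 * #|B| ^ 2))%N.
Proof.
have [c Hc] := rich_lines_energy; exists (64 * c ^ 2 + 12)%N.
move=> F p A B Q k char /andP[k1 kA] AB Qk AQp.
have [->|Q0] := posnP #|Q|; first by rewrite muln0.
have A0 : (0 < #|A|)%N by lia.
have n0 : (0 < #|A| * #|Q|)%N by rewrite muln_gt0 A0.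
have [j [nj jn]] := sqrt_bracket n0.
have jp : (j < p)%N by rewrite -(ltn_exp2r _ _ (isT : 0 < 2)%N); exact: leq_ltn_trans jn AQp.
have char' i : (0 < i <= j)%N -> (i%:R : F) != 0.
  by move=> /andP[i0 ij]; apply: char; rewrite i0 (leq_ltn_trans ij).
exact: rich_arithmetic jn k1 kA AB Q0 (leq_trunc_div _ _) (Hc F A B Q k j k1 Qk char' nj).
Qed.

(** If the bound failed, keep one line more than [rich_lines_small] permits. The small case is then
    contradictory, so p^2 <= 4 |A| q, which together with the size of q contradicts the threshold on
    k. *)
Lemma rich_lines : exists c : nat, (0 < c)%N /\
  forall (F : finFieldType) (p : nat) (A B : {set F}) (Q : {set F * F}) (k : nat),
  (forall i, (0 < i < p)%N -> (i%:R : F) != 0) ->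
  (1 < k)%N -> (#|A| <= #|B|)%N -> {in Q, forall l, (k <= richness A B l)%N} ->
  (c * (#|A| ^ 4 * #|B| ^ 2) < p ^ 2 * k ^ 4)%N ->
  (k ^ 4 * #|Q| <= c * (#|A| ^ 3 * #|B| ^ 2))%N.
Proof.
have [c Hc] := rich_lines_small; exists (4 * c.+1)%N; split=> //.
move=> F p A B Q k char k1 AB Qk kp; have [->|Q0] := posnP #|Q|; first by rewrite muln0.
have kA : (k <= #|A|)%N.
  have [l lQ] : exists l, l \in Q by apply/set0Pn; rewrite -card_gt0.
  by apply: leq_trans (Qk l lQ) _; apply: subset_leq_card; apply/subsetP => x; rewrite inE => /andP[].
apply: leq_trans (_ : (c * (#|A| ^ 3 * #|B| ^ 2) <= _)%N); last by rewrite leq_mul2r; apply/orP; right; lia.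
have k0 : (0 < k ^ 4)%N by rewrite expn_gt0 (ltn_trans _ k1).
rewrite leqNgt; apply/negP => big.
pose q := ((c * (#|A| ^ 3 * #|B| ^ 2)) %/ k ^ 4)%N.+1.
have qQ : (q <= #|Q|)%N by rewrite /q ltn_divLR // [(#|Q| * _)%N]mulnC.
have [Q' Q'Q cQ'] := subset_of_card qQ.
have Q'k : {in Q', forall l, (k <= richness A B l)%N} by move=> l /(subsetP Q'Q) /Qk.
have k1A : (1 < k <= #|A|)%N by rewrite k1.
have [small|large] := ltnP (4 * (#|A| * #|Q'|)) (p ^ 2).
  have := Hc F p A B Q' k char k1A AB Q'k small; rewrite cQ' leqNgt /q => /negP; apply.
  by rewrite [(k ^ 4 * _)%N]mulnC ltn_ceil.
have qk : (k ^ 4 * q <= (c + 1) * (#|A| ^ 3 * #|B| ^ 2))%N.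
  rewrite /q mulnS addnC mulnDl mul1n; apply: leq_add.
    by rewrite [(k ^ 4 * _)%N]mulnC leq_trunc_div.
  apply: (@leq_trans (#|A| ^ 4)); first by rewrite leq_exp2r.
  by rewrite expnSr leq_mul2l; apply/orP; right; move: kA AB k1; rewrite -mulnn; nia.
move: kp; apply/negP; rewrite -leqNgt; apply: leq_trans (_ : (4 * (#|A| * q) * k ^ 4 <= _)%N).
  by rewrite leq_mul2r -cQ' large orbT.
have -> : (4 * (#|A| * q) * k ^ 4 = 4 * #|A| * (k ^ 4 * q))%N by ring.
have -> : (4 * c.+1 * (#|A| ^ 4 * #|B| ^ 2) = 4 * #|A| * ((c + 1) * (#|A| ^ 3 * #|B| ^ 2)))%N by ring.
by rewrite leq_mul2l qk orbT.
Qed.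

Lemma richnessE (F : finFieldType) (A B : {set F}) (l : F * F) :
  richness A B l = (\sum_(x in A) (line_value l x \in B))%N.
Proof. by rewrite sum_nat_of_bool. Qed.

Lemma richness_leq (F : finFieldType) (A B : {set F}) (l : F * F) :
  (richness A B l <= #|A|)%N.
Proof. by apply: subset_leq_card; apply/subsetP => x; rewrite inE => /andP[]. Qed.

Lemma sum_richness (F : finFieldType) (A B : {set F}) (s : F) :
  (\sum_t richness A B (s, t) = #|A| * #|B|)%N.
Proof.
under eq_bigr do rewrite richnessE; rewrite exchange_big /= -sum_nat_const.
apply: eq_bigr => x _; rewrite -sum1_card [RHS]big_mkcond /=.
rewrite (reindex_inj (h := fun t => t - s * x)); last by move=> u v /addIr.
apply: eq_bigr => t _; rewrite /line_value /= addrC subrK.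
by case: (t \in B).
Qed.

(** Counts lines with prescribed abscissae x and x' and values in B: a line is determined by its
    slope and one value when x = x', and by two values otherwise. *)
Lemma sum_richness_sqr (F : finFieldType) (A B : {set F}) :
  (\sum_s \sum_t richness A B (s, t) ^ 2 <= (#|A| * #|B|) ^ 2 + #|F| * (#|A| * #|B|))%N.
Proof.
pose N x x' := #|[set l : F * F | (line_value l x \in B) && (line_value l x' \in B)]|.
have -> : (\sum_s \sum_t richness A B (s, t) ^ 2 = \sum_(x in A) \sum_(x' in A) N x x')%N.
  rewrite pair_big /=; under eq_bigr => l _ do rewrite richnessE -surjective_pairing -mulnn big_distrlr /=.
  rewrite exchange_big /=; apply: eq_bigr => x _; rewrite exchange_big /=; apply: eq_bigr => x' _.
  rewrite /N -sum1_card [RHS]big_mkcond /=; apply: eq_bigr => l _; rewrite inE.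
  by case: (_ \in B); case: (_ \in B).
have N1 x : (N x x <= #|F| * #|B|)%N.
  rewrite /N -cardsT -cardsX -[X in (X <= _)%N](card_in_imset (f := fun l : F * F => (l.1, line_value l x))).
    apply: subset_leq_card; apply/subsetP => z /imsetP[l + ->].
    by rewrite !inE => /andP[].
  by move=> [s t] [s' t'] _ _ []; rewrite /line_value /= => <- /addrI ->.
have N2 x x' : x != x' -> (N x x' <= #|B| * #|B|)%N.
  move=> xx; rewrite /N -cardsX -[X in (X <= _)%N](card_in_imset (f := fun l : F * F => (line_value l x, line_value l x'))).
    apply: subset_leq_card; apply/subsetP => z /imsetP[l + ->].
    by rewrite !inE.
  move=> [s t] [s' t'] _ _ []; rewrite /line_value /= => E1 E2.
  have E3 : (s - s') * (x - x') = 0.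
    have -> : (s - s') * (x - x') = (s * x + t) - (s * x' + t) - (s' * x + t') + (s' * x' + t') by ring.
    by rewrite E1 E2; ring.
  have ss : s = s'.
    by apply/eqP; move/eqP: E3; rewrite mulf_eq0 !subr_eq0 (negPf xx) orbF.
  by move: E1; rewrite ss => /addrI ->.
apply: (@leq_trans (\sum_(x in A) (#|F| * #|B| + #|A| * (#|B| * #|B|)))).
  apply: leq_sum => x xA; rewrite (bigD1 x) //=; apply: leq_add => //.
  apply: leq_trans (_ : (\sum_(i in A | i != x) #|B| * #|B| <= _)%N).
    by apply: leq_sum => i /andP[_ ix]; apply: N2; rewrite eq_sym.
  by rewrite -[X in (_ <= X)%N]sum_nat_const big_mkcondr; apply: leq_sum => i _; case: ifP.
by rewrite sum_nat_const; apply: eq_leq; ring.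
Qed.

(** * Second moments *)

Definition excess (R : realFieldType) (F : finFieldType) (A B : {set F}) (s : F) : R :=
  \sum_t ((richness A B (s, t))%:R - #|A|%:R * #|B|%:R / #|F|%:R) ^+ 2.

Section Excess.

Variables (R : realFieldType) (F : finFieldType) (A B : {set F}).
Local Notation p := (#|F|%:R : R).
Local Notation a := (#|A|%:R : R).
Local Notation b := (#|B|%:R : R).
Local Notation r s t := ((richness A B (s, t))%:R : R).

Lemma cardF_gt0 : 0 < p.
Proof. by rewrite ltr0n; apply/card_gt0P; exists 0. Qed.

Lemma sum_richnessR s : \sum_t r s t = a * b.
Proof. by rewrite -natr_sum sum_richness natrM. Qed.

Lemma excessE s : excess R A B s = \sum_t r s t ^+ 2 - (a * b) ^+ 2 / p.
Proof.
have p0 := cardF_gt0; rewrite /excess.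
set m := a * b / p.
rewrite (eq_bigr (fun t => r s t ^+ 2 - 2 * m * r s t + m ^+ 2)); last by move=> t _; ring.
rewrite big_split sumrB /= -mulr_sumr sum_richnessR sumr_const -[_ *+ _]mulr_natl /m.
by field; rewrite gt_eqF.
Qed.

Lemma excess_ge0 s : 0 <= excess R A B s.
Proof. by apply: sumr_ge0 => t _; exact: sqr_ge0. Qed.

Lemma sum_excess : \sum_s excess R A B s <= p * (a * b).
Proof.
have p0 := cardF_gt0; under eq_bigr do rewrite excessE.
rewrite sumrB sumr_const lerBlDr -[_ / _ *+ _]mulr_natl.
have -> : p * ((a * b) ^+ 2 / p) = (a * b) ^+ 2 by field; rewrite gt_eqF.
have := sum_richness_sqr A B; rewrite -(ler_nat R) natrD natrX !natrM addrC.
congr (_ <= _); rewrite natr_sum; apply: eq_bigr => s _; rewrite natr_sum.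
by apply: eq_bigr => t _; rewrite natrX.
Qed.

End Excess.

Lemma cube_layers (D r : nat) : (D <= r)%N ->
  (r ^ 3 <= D ^ 3 + \sum_(D <= k < r) 3 * k.+1 ^ 2)%N.
Proof.
move=> /subnK <-; move: (r - D)%N => n; elim: n => [|n IH].
  by rewrite add0n big_geq // addn0.
have arith (v d u : nat) : (v ^ 3 <= d + u -> v.+1 ^ 3 <= d + (u + 3 * v.+1 ^ 2))%N by nia.
by rewrite addSn big_nat_recr ?leq_addl //=; exact: arith.
Qed.

Lemma sum_inv_sqr (R : realFieldType) (D n : nat) : (0 < D)%N ->
  \sum_(D <= k < n) (k.+1%:R ^+ 2)^-1 <= (D%:R^-1 : R).
Proof.
move=> D0; have [nD|Dn] := leqP n D; first by rewrite big_geq // invr_ge0 ler0n.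
apply: le_trans (_ : \sum_(D <= k < n) (k%:R^-1 - k.+1%:R^-1) <= _).
  rewrite !big_nat; apply: ler_sum => k /andP[Dk _].
  have k0 : (0 : R) < k%:R by rewrite ltr0n (leq_trans D0).
  rewrite -natr1; set x := k%:R in k0 *; have x1 : 0 < x + 1 by lra.
  have -> : x^-1 - (x + 1)^-1 = (x * (x + 1))^-1 by field; rewrite !gt_eqF.
  rewrite lef_pV2 ?posrE ?mulr_gt0 ?exprn_gt0 // expr2.
  by rewrite ler_pM2r // lerDl.
under eq_bigr do rewrite -opprB; rewrite sumrN telescope_sumr; last exact: ltnW.
by rewrite opprB lerBlDr lerDl invr_ge0 ler0n.
Qed.

(** Summation by layers: the level k carries weight of order k^2 and at most G / k^4 lines, so the
    levels from D on sum to order G / D. *)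
Lemma sum_rich_cubes (R : realFieldType) (F : finFieldType) (A B : {set F}) (G : R) (D : nat) :
  (0 < D)%N ->
  (forall k, (D <= k)%N -> k%:R ^+ 4 * #|[set l | (k <= richness A B l)%N]|%:R <= G) ->
  \sum_(l | (D <= richness A B l)%N) (richness A B l)%:R ^+ 3 <= 4 * G / D%:R.
Proof.
move=> D0 HG; pose n := #|A|; pose q k : R := #|[set l | (k <= richness A B l)%N]|%:R.
have D1 : (0 : R) < D%:R by rewrite ltr0n.
have G0 : 0 <= G by apply: le_trans (HG D (leqnn D)); rewrite mulr_ge0 ?exprn_ge0 ?ler0n.
have qE k : q k = \sum_(l : F * F) (k <= richness A B l)%N%:R.
  by rewrite /q -sum1_card natr_sum big_mkcond; apply: eq_bigr => l _; rewrite inE; case: ifP.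
apply: le_trans (_ : D%:R ^+ 3 * q D + \sum_(D <= k < n) 3 * k.+1%:R ^+ 2 * q k.+1 <= _).
  rewrite qE mulr_sumr.
  under [X in _ <= _ + X]eq_bigr do rewrite qE mulr_sumr.
  rewrite exchange_big -big_split big_mkcond /=; apply: ler_sum => l _.
  case: ifP => Dr; last first.
    by rewrite mulr0 add0r sumr_ge0 // => k _; rewrite !mulr_ge0 ?ler0n ?exprn_ge0 ?ler0n.
  rewrite mulr1; have := cube_layers Dr.
  rewrite -(ler_nat R) natrD !natrX natr_sum => H; apply: le_trans H _; rewrite lerD2l.
  rewrite (big_cat_nat (n := richness A B l) (p := n)) ?richness_leq //=.
  apply: ler_wpDr; first by rewrite sumr_ge0 // => k _; rewrite !mulr_ge0 ?ler0n ?exprn_ge0 ?ler0n.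
  by rewrite !big_nat; apply: ler_sum => k /andP[_ kr]; rewrite kr mulr1 natrM natrX.
have H1 : D%:R ^+ 3 * q D <= G / D%:R.
  by rewrite ler_pdivlMr // mulrAC -exprSr; exact: HG.
have H2 : \sum_(D <= k < n) 3 * k.+1%:R ^+ 2 * q k.+1 <= 3 * G / D%:R.
  apply: le_trans (_ : \sum_(D <= k < n) 3 * G * (k.+1%:R ^+ 2)^-1 <= _).
    rewrite !big_nat; apply: ler_sum => k /andP[Dk _].
    have H := HG k.+1 (leqW Dk); have K0 : (0 : R) < k.+1%:R by rewrite ltr0n.
    rewrite -/(q k.+1) in H; move: (k.+1%:R : R) (q k.+1) K0 H => K Q K0 H.
    have -> : 3 * K ^+ 2 * Q = 3 * (K ^+ 4 * Q) * (K ^+ 2)^-1 by field; rewrite gt_eqF.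
    by rewrite ler_pM2r ?invr_gt0 ?exprn_gt0 // ler_pM2l.
  by rewrite -mulr_sumr -!mulrA ler_pM2l ?ltr0n // ler_wpM2l // sum_inv_sqr.
apply: le_trans (lerD H1 H2) _; lra.
Qed.

(** For each slope, e(s)^2 is either at most a multiple of D e(s), to be summed by the first moment
    of e, or at most a multiple of the sum of cubes over the D-rich lines of slope s. *)
Lemma sum_excess_sqr (R : realFieldType) (F : finFieldType) (A B : {set F}) (G : R) (D : nat) :
  (0 < D)%N ->
  (forall k, (D <= k)%N -> k%:R ^+ 4 * #|[set l | (k <= richness A B l)%N]|%:R <= G) ->
  \sum_s excess R A B s ^+ 2 <=
    2 * (#|A|%:R * #|B|%:R) ^+ 2 * #|F|%:R * D%:R
    + 16 * (#|A|%:R * #|B|%:R) * G / D%:R.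
Proof.
move=> D0 HG; set m : R := #|A|%:R * #|B|%:R.
have m0 : 0 <= m by rewrite mulr_ge0 ?ler0n.
pose r s t : R := (richness A B (s, t))%:R.
have r0 s t : 0 <= r s t by rewrite ler0n.
have pt s : excess R A B s ^+ 2 <=
    2 * m * D%:R * excess R A B s + 4 * m * \sum_(t | (D <= richness A B (s, t))%N) r s t ^+ 3.
  have e0 := excess_ge0 R A B s; set e := excess R A B s in e0 *.
  set f := \sum_t r s t ^+ 2.
  have ef : e <= f by rewrite /e excessE -/m lerBlDr lerDl divr_ge0 ?exprn_ge0 ?ler0n.
  have f0 : 0 <= f by apply: le_trans ef.
  have C0 : 0 <= \sum_(t | (D <= richness A B (s, t))%N) r s t ^+ 3.
    by apply: sumr_ge0 => t _; rewrite exprn_ge0.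
  have D1 : (0 : R) < D%:R by rewrite ltr0n.
  have [fD|Df] := ltP f (2 * m * D%:R).
    have : e * e <= 2 * m * D%:R * e by apply: ler_wpM2r => //; apply: le_trans ef (ltW fD).
    have : 0 <= 4 * m * \sum_(t | (D <= richness A B (s, t))%N) r s t ^+ 3.
      by rewrite mulr_ge0 // mulr_ge0.
    by rewrite expr2; lra.
  have [mz|mpos] : m = 0 \/ 0 < m by case/boolP: (m == 0) => [/eqP|mn]; [left|right; rewrite lt_def mn].
    have fz : f = 0.
      apply/eqP; rewrite psumr_eq0 => [|t _]; last exact: exprn_ge0.
      have := sum_richnessR R A B s; rewrite -/m mz => /eqP; rewrite psumr_eq0 => [H|t _]; last exact: r0.
      by apply/allP => t tt; have /allP/(_ t tt)/= := H; rewrite /r => /eqP ->; rewrite expr0n.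
    have -> : e = 0 by apply/eqP; rewrite eq_le e0 andbT -fz.
    by rewrite mz !(mulr0, mul0r) expr0n addr0.
  (* Since the richnesses sum to m, the lines of richness below f / (2 m) contribute at most half of
     f. The remaining ones have richness at least f / (2 m) >= D, and there f r^2 <= 2 m r^3. *)
  have key : f * f <= f / (2 * m) * (f * m) + 2 * m * \sum_(t | (D <= richness A B (s, t))%N) r s t ^+ 3.
    have -> : f / (2 * m) * (f * m) = \sum_t f ^+ 2 / (2 * m) * r s t.
      by rewrite -mulr_sumr sum_richnessR -/m; field; rewrite gt_eqF.
    rewrite {2}/f !mulr_sumr [X in _ <= _ + X]big_mkcond -big_split /=.
    apply: ler_sum => t _.
    have [big|small] := leP f (2 * m * r s t).
      have -> : (D <= richness A B (s, t))%N.
        rewrite -(ler_nat R) -/(r s t) -(ler_pM2l (_ : 0 < 2 * m)); last by lra.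
        exact: le_trans big.
      apply: ler_wpDl; first by rewrite mulr_ge0 // divr_ge0 ?exprn_ge0 //; lra.
      have -> : 2 * m * r s t ^+ 3 = (2 * m * r s t) * r s t ^+ 2 by ring.
      by apply: ler_wpM2r => //; rewrite exprn_ge0.
    apply: ler_wpDr.
      by case: ifP => // _; rewrite mulr_ge0 ?exprn_ge0 //; lra.
    have -> : f ^+ 2 / (2 * m) * r s t = f * r s t * (f / (2 * m)) by field; rewrite gt_eqF.
    rewrite expr2 mulrA; apply: ler_wpM2l; first by rewrite mulr_ge0.
    by rewrite ler_pdivlMr; [rewrite mulrC ltW|lra].
  have e2 : e ^+ 2 <= f * f by rewrite expr2; apply: ler_pM.
  have fe : f / (2 * m) * (f * m) = f * f / 2 by field; rewrite gt_eqF.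
  have : 0 <= 2 * m * D%:R * e by rewrite !mulr_ge0 // ltW.
  rewrite fe in key; lra.
apply: le_trans (ler_sum _ (fun s _ => pt s)) _.
rewrite big_split /= -!mulr_sumr; apply: lerD.
  have := sum_excess R A B; rewrite -/m => H.
  have -> : 2 * m ^+ 2 * #|F|%:R * D%:R = 2 * m * D%:R * (#|F|%:R * m) by ring.
  by apply: ler_wpM2l => //; rewrite !mulr_ge0 // ler0n.
have -> : 16 * m * G / D%:R = 4 * m * (4 * G / D%:R) by ring.
apply: ler_wpM2l; first by rewrite mulr_ge0.
apply: le_trans (sum_rich_cubes D0 HG); rewrite pair_big_dep /=.
by [].
Qed.

Theorem excess_moment : exists c : nat, (0 < c)%N /\
  forall (R : rcfType) (F : finFieldType) (A B : {set F}),
  (forall i, (0 < i < #|F|)%N -> (i%:R : F) != 0) -> (#|A| <= #|B|)%N ->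
  \sum_s excess R A B s ^+ 2 <=
    c%:R * (#|F|%:R * #|A|%:R ^+ 2 * #|B|%:R ^+ 2
            + #|A|%:R ^+ 3 * #|B|%:R ^+ 2 * Num.sqrt (#|F|%:R * #|B|%:R)).
Proof.
have [c [c0 Hc]] := rich_lines; exists (20 * c)%N; split; first by rewrite muln_gt0.
move=> R F A B char AB.
have p0 := cardF_gt0 R F.
have pN : (0 < #|F|)%N by rewrite -(ltr0n R).
(* The least threshold admissible for [rich_lines], about |A| (|B| / p)^(1/2). Minimality bounds D
   in the first term of [sum_excess_sqr], and admissibility bounds |A| |B| / D in the second. *)
pose ok D := (1 < D)%N && (c * (#|A| ^ 4 * #|B| ^ 2) < #|F| ^ 2 * D ^ 4)%N.
have ex : exists D, ok D.
  exists (c * (#|A| ^ 4 * #|B| ^ 2)).+2; rewrite /ok /=.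
  by move: (c * _)%N (#|F|) pN => x y; rewrite !expnS expn0; nia.
case: (ex_minnP ex) => D /andP[D1 DD] Dmin.
have D0 : (0 < D)%N by apply: ltn_trans D1.
set p : R := #|F|%:R; set a : R := #|A|%:R; set b : R := #|B|%:R; set w := Num.sqrt (p * b).
have a0 : 0 <= a by rewrite ler0n.
have b0 : 0 <= b by rewrite ler0n.
have w0 : 0 <= w by exact: sqrtr_ge0.
have w2 : w ^+ 2 = p * b by rewrite sqr_sqrtr // mulr_ge0 // ltW.
have c1 : (1 : R) <= c%:R by rewrite ler1n.
have d0 : (0 : R) < D%:R by rewrite ltr0n.
pose G : R := c%:R * (a ^+ 3 * b ^+ 2).
have HG k : (D <= k)%N -> k%:R ^+ 4 * #|[set l | (k <= richness A B l)%N]|%:R <= G.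
  move=> Dk; have k1 := leq_trans D1 Dk.
  have kQ : {in [set l | (k <= richness A B l)%N], forall l, (k <= richness A B l)%N}.
    by move=> l; rewrite inE.
  have kp : (c * (#|A| ^ 4 * #|B| ^ 2) < #|F| ^ 2 * k ^ 4)%N.
    by apply: leq_trans DD _; rewrite leq_mul2l leq_exp2r // Dk orbT.
  have := Hc F #|F| A B _ k char k1 AB kQ kp.
  by rewrite -(ler_nat R) !(natrX, natrM).
apply: le_trans (sum_excess_sqr D0 HG) _; rewrite -/p -/a -/b -/w.
have H1 : p * D%:R <= 2 * p + 2 * c%:R * a * w.
  have caw : 0 <= 2 * c%:R * a * w by rewrite !mulr_ge0 // ler0n.
  have [D2|D3] := leqP D 2.
    have -> : D = 2%N by lia.
    by rewrite -[2%:R]/(2 : R); lra.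
  have nok : ~~ ok D.-1 by apply/negP => /Dmin; lia.
  have : (#|F| ^ 2 * D.-1 ^ 4 <= c * (#|A| ^ 4 * #|B| ^ 2))%N.
    by move: nok; rewrite /ok negb_and -!leqNgt => /orP[|//]; lia.
  rewrite -(ler_nat R) !(natrX, natrM) -/p -/a -/b => Hle.
  set e : R := D.-1%:R in Hle; have e0 : 0 <= e by rewrite ler0n.
  have H2 : p * e ^+ 2 <= c%:R * (a ^+ 2 * b).
    rewrite -ler_sqr ?nnegrE ?mulr_ge0 ?exprn_ge0 ?ler0n //.
    have -> : (p * e ^+ 2) ^+ 2 = p ^+ 2 * e ^+ 4 by ring.
    apply: le_trans Hle _.
    have -> : (c%:R * (a ^+ 2 * b)) ^+ 2 = c%:R * (c%:R * (a ^+ 4 * b ^+ 2)) by ring.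
    by rewrite ler_peMl // !mulr_ge0 ?exprn_ge0 ?ler0n.
  have H3 : p * e <= c%:R * a * w.
    rewrite -ler_sqr ?nnegrE ?mulr_ge0 ?ler0n //.
    have -> : (p * e) ^+ 2 = p * (p * e ^+ 2) by ring.
    have -> : (c%:R * a * w) ^+ 2 = c%:R * (p * (c%:R * (a ^+ 2 * b))).
      by rewrite exprMn w2; ring.
    apply: le_trans (_ : p * (c%:R * (a ^+ 2 * b)) <= _); first by rewrite ler_pM2l.
    by rewrite ler_peMl // !mulr_ge0 ?exprn_ge0 ?ler0n // ltW.
  have De : D%:R <= 2 * e.
    have : (D <= D.-1 + D.-1)%N by clear - D3; lia.
    by rewrite -(ler_nat R) natrD -/e; lra.
  have : p * D%:R <= p * (2 * e) by rewrite ler_pM2l.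
  by lra.
have H2 : a * b <= D%:R * w.
  rewrite -ler_sqr ?nnegrE ?mulr_ge0 ?ler0n //.
  have -> : (D%:R * w) ^+ 2 = p * D%:R ^+ 2 * b by rewrite exprMn w2; ring.
  have -> : (a * b) ^+ 2 = a ^+ 2 * b * b by ring.
  apply: ler_wpM2r => //; rewrite -ler_sqr ?nnegrE ?mulr_ge0 ?exprn_ge0 ?ler0n //.
  move: DD; rewrite -(ltr_nat R) !(natrX, natrM) -/p -/a -/b => DD.
  have -> : (p * D%:R ^+ 2) ^+ 2 = p ^+ 2 * D%:R ^+ 4 by ring.
  have -> : (a ^+ 2 * b) ^+ 2 = a ^+ 4 * b ^+ 2 by ring.
  apply: le_trans (ltW DD); rewrite ler_peMl // !mulr_ge0 ?exprn_ge0 //.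
have H3 : 2 * (a * b) ^+ 2 * p * D%:R <= 2 * (a * b) ^+ 2 * (2 * p + 2 * c%:R * a * w).
  by rewrite -mulrA; apply: ler_wpM2l => //; rewrite mulr_ge0 // exprn_ge0 // mulr_ge0.
have H4 : 16 * (a * b) * G / D%:R <= 16 * c%:R * (a ^+ 3 * b ^+ 2 * w).
  rewrite ler_pdivrMr //.
  have -> : 16 * (a * b) * G = 16 * G * (a * b) by ring.
  have -> : 16 * c%:R * (a ^+ 3 * b ^+ 2 * w) * D%:R = 16 * G * (D%:R * w) by rewrite /G; ring.
  by apply: ler_wpM2l => //; rewrite mulr_ge0 // /G !mulr_ge0 ?exprn_ge0 ?ler0n.
apply: le_trans (lerD H3 H4) _; rewrite natrM.
have -> : 2 * (a * b) ^+ 2 * (2 * p + 2 * c%:R * a * w) + 16 * c%:R * (a ^+ 3 * b ^+ 2 * w) =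
  4 * (p * a ^+ 2 * b ^+ 2) + 20 * c%:R * (a ^+ 3 * b ^+ 2 * w) by ring.
have x0 : 0 <= p * a ^+ 2 * b ^+ 2 by rewrite !mulr_ge0 ?exprn_ge0 // ltW.
rewrite mulrDr lerD2r; apply: ler_wpM2r => //; lra.
Qed.

Lemma sum_indicator (I J T : finType) (P : {set I}) (Q : {set J}) (f : I -> T) (g : J -> T) :
  (\sum_y (\sum_(i in P) (f i == y)) * (\sum_(j in Q) (g j == y)) =
   \sum_(i in P) \sum_(j in Q) (f i == g j))%N.
Proof.
under eq_bigr do rewrite big_distrl /=; rewrite exchange_big /=; apply: eq_bigr => i _.
rewrite (bigD1 (f i)) //= eqxx mul1n [X in (_ + X)%N]big1 ?addn0.
  by apply: eq_bigr => j _; rewrite eq_sym.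
by move=> y yf; have -> : (f i == y) = false by rewrite eq_sym (negPf yf).
Qed.

Lemma mem_sum_eq (T : finType) (B : {set T}) z : ((z \in B) = \sum_(b in B) (b == z) :> nat)%N.
Proof.
have [zB|zB] := boolP (z \in B).
  by rewrite (bigD1 z) //= eqxx big1 // => y /andP[_ /negPf ->].
by rewrite big1 // => b bB; case: eqP => // E; rewrite -E bB in zB.
Qed.

Lemma big_setX_nat (I J : finType) (A : {set I}) (B : {set J}) (f : I -> J -> nat) :
  (\sum_(q in setX A B) f q.1 q.2 = \sum_(x in A) \sum_(y in B) f x y)%N.
Proof.
rewrite pair_big /=; apply: eq_bigl => q; by rewrite inE.
Qed.

(** * Ratios of differences *)

Definition diff_count (F : finFieldType) (A B : {set F}) (u : F) : nat :=
  (\sum_(q in setX A B) (q.1 - q.2 == u)%R)%N.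

Lemma sum_diff_count (F : finFieldType) (A B : {set F}) :
  (\sum_u diff_count A B u = #|A| * #|B|)%N.
Proof.
rewrite /diff_count exchange_big /= -cardsX -sum1_card; apply: eq_bigr => q _.
rewrite (bigD1 (q.1 - q.2)) //= eqxx big1 // => u uq.
by have -> : (q.1 - q.2 == u)%R = false by rewrite eq_sym (negPf uq).
Qed.

Lemma diff_count_leq (F : finFieldType) (A B : {set F}) u : (diff_count A B u <= #|A|)%N.
Proof.
rewrite /diff_count (big_setX_nat A B (fun x y => x - y == u)) -sum1_card.
apply: leq_sum => x _.
rewrite (eq_bigr (fun y => (y == x - u) : nat)) => [|y _].
  by rewrite -mem_sum_eq; case: (_ \in _).
by congr nat_of_bool; apply/eqP/eqP => [<-|->]; ring.
Qed.

(** The equation a - b = l (a' - b') is rewritten as a + l b' = b + l a' = y. The solutions (a, b')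
    are points of the grid on the line of slope - 1/l and intercept y/l, and the solutions (a', b)
    are points on the line of slope - l and intercept y. *)
Lemma diff_count_ratio (F : finFieldType) (A B : {set F}) (l : F) : l != 0 ->
  (\sum_u diff_count A B (l * u)%R * diff_count A B u =
   \sum_y richness A B (- l^-1, l^-1 * y)%R * richness A B (- l, y)%R)%N.
Proof.
move=> l0.
have V1 y : richness A B (- l^-1, l^-1 * y) = (\sum_(q in setX A B) (q.1 + l * q.2 == y)%R)%N.
  rewrite richnessE (big_setX_nat A B (fun x z => x + l * z == y)); apply: eq_bigr => x _.
  rewrite mem_sum_eq; apply: eq_bigr => b _; congr nat_of_bool; rewrite /line_value /=.
  apply/eqP/eqP => [->|<-]; by field.
have V2 y : richness A B (- l, y) = (\sum_(q in setX A B) (q.2 + l * q.1 == y)%R)%N.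
  rewrite richnessE (big_setX_nat A B (fun x z => z + l * x == y)); apply: eq_bigr => x _.
  rewrite mem_sum_eq; apply: eq_bigr => b _; congr nat_of_bool; rewrite /line_value /=.
  by apply/eqP/eqP => [->|<-]; ring.
under [RHS]eq_bigr do rewrite V1 V2.
rewrite sum_indicator.
have dl u : diff_count A B (l * u) = (\sum_(q in setX A B) (l^-1 * (q.1 - q.2) == u)%R)%N.
  apply: eq_bigr => q _; congr nat_of_bool.
  by apply/eqP/eqP => [->|<-]; rewrite ?mulKf ?mulVKf.
under eq_bigr do rewrite dl.
rewrite [LHS]sum_indicator.
under eq_bigr => q _ do rewrite (big_setX_nat A B (fun x y => l^-1 * (q.1 - q.2) == x - y)).
rewrite (big_setX_nat A B (fun a b => \sum_(x in A) \sum_(y in B) (l^-1 * (a - b) == x - y)%R))%N.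
under [RHS]eq_bigr => q _ do rewrite (big_setX_nat A B (fun x y => q.1 + l * q.2 == y + l * x)).
rewrite (big_setX_nat A B (fun a b => \sum_(x in A) \sum_(y in B) (a + l * b == y + l * x)%R))%N.
apply: eq_bigr => a _; rewrite exchange_big [RHS]exchange_big /=; apply: eq_bigr => x _.
rewrite exchange_big /=; apply: eq_bigr => y _; apply: eq_bigr => b _; congr nat_of_bool.
apply/eqP/eqP => E.
  have -> : a = b + l * (l^-1 * (a - b)) by field.
  by rewrite E; ring.
have -> : a - b = l * (x - y).
  have -> : a = b + l * x - l * y by rewrite -E; ring.
  by ring.
by rewrite mulKf.
Qed.

Lemma cauchy_schwarz (R : realFieldType) (I : finType) (P : pred I) (f g : I -> R) :
  (\sum_(i | P i) f i * g i) ^+ 2 <= (\sum_(i | P i) f i ^+ 2) * (\sum_(i | P i) g i ^+ 2).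
Proof.
have : 0 <= \sum_(i | P i) \sum_(j | P j) (f i * g j - f j * g i) ^+ 2.
  by apply: sumr_ge0 => i _; apply: sumr_ge0 => j _; exact: sqr_ge0.
have -> : \sum_(i | P i) \sum_(j | P j) (f i * g j - f j * g i) ^+ 2 =
  \sum_(i | P i) \sum_(j | P j) (f i ^+ 2 * g j ^+ 2) +
  \sum_(i | P i) \sum_(j | P j) (g i ^+ 2 * f j ^+ 2) -
  2 * \sum_(i | P i) \sum_(j | P j) (f i * g i) * (f j * g j).
  rewrite mulr_sumr -big_split -sumrB /=; apply: eq_bigr => i _.
  rewrite mulr_sumr -big_split -sumrB /=; apply: eq_bigr => j _; ring.
rewrite -!big_distrlr /=; lra.
Qed.

Lemma sum_neq0_scale (F : finFieldType) (c : F) (h : F -> nat) : c != 0 ->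
  (\sum_(u | u != 0%R) h u = \sum_(u | u != 0%R) h (u * c)%R)%N.
Proof.
move=> c0; rewrite (reindex_inj (h := fun u => u * c)); last by move=> u v /(mulIf c0).
by apply: eq_bigl => u; rewrite mulf_eq0 (negPf c0) orbF.
Qed.

(** * Multiplicative convolution and correlation *)

Definition mult_conv (F : finFieldType) (f g : F -> nat) (x : F) : nat :=
  (\sum_(u | u != 0%R) f u * g (x / u)%R)%N.

Definition mult_corr (F : finFieldType) (f : F -> nat) (l : F) : nat :=
  (\sum_(u | u != 0%R) f (l * u)%R * f u)%N.

Lemma sum_mult_conv (F : finFieldType) (f g : F -> nat) :
  (\sum_(x | x != 0%R) mult_conv f g x =
   (\sum_(u | u != 0%R) f u) * (\sum_(u | u != 0%R) g u))%N.
Proof.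
rewrite /mult_conv exchange_big /= big_distrl /=; apply: eq_bigr => u u0.
by rewrite -big_distrr (sum_neq0_scale _ u0) /=; congr muln; apply: eq_bigr => x _; rewrite mulfK.
Qed.

(** Multiplicative energy: u y = u' y' is sorted by the common ratio l = u / u' = y' / y. *)
Lemma sum_mult_conv_sqr (F : finFieldType) (f g : F -> nat) :
  (\sum_(x | x != 0%R) mult_conv f g x ^ 2 =
   \sum_(l | l != 0%R) mult_corr f l * mult_corr g l)%N.
Proof.
under eq_bigr do rewrite -mulnn /mult_conv big_distrlr /=.
under [RHS]eq_bigr do rewrite /mult_corr big_distrlr /=.
rewrite exchange_big [RHS]exchange_big /=; apply: eq_bigr => u u0.
rewrite exchange_big (sum_neq0_scale _ u0) /=; apply: eq_bigr => l l0.
rewrite (sum_neq0_scale _ (mulf_neq0 l0 u0)); apply: eq_bigr => y y0.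
rewrite mulfK ?mulf_neq0 //.
have -> : y * (l * u) / u = l * y by rewrite mulrA mulfK // mulrC.
by move: (f _) (f _) (g _) (g _) => *; ring.
Qed.

Lemma mult_corr_full (F : finFieldType) (f : F -> nat) (l : F) :
  (\sum_u f (l * u)%R * f u = mult_corr f l + f 0%R ^ 2)%N.
Proof. by rewrite (bigD1 0%R) //= mulr0 mulnn addnC. Qed.

Lemma sum_mult_corr (F : finFieldType) (f : F -> nat) :
  (\sum_(l | l != 0%R) mult_corr f l <= (\sum_u f u) ^ 2)%N.
Proof.
rewrite /mult_corr exchange_big /= -mulnn.
apply: (@leq_trans (\sum_(u | u != 0%R) f u * \sum_l f l)); last first.
  rewrite big_distrl /= [X in (_ <= X)%N](bigD1 0%R) //= leq_addl //.
apply: leq_sum => u u0; rewrite -big_distrl /= mulnC leq_mul2l.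
by rewrite -(sum_neq0_scale _ u0) [X in (_ <= X)%N](bigD1 0%R) //= leq_addl orbT.
Qed.

(** By [diff_count_ratio] the deviation is a covariance of two richness functions with the same
    mean, and 2 |v w| <= v^2 + w^2. *)
Lemma diff_ratio_deviation (R : realFieldType) (F : finFieldType) (A B : {set F}) (l : F) :
  l != 0 ->
  `|(\sum_u diff_count A B (l * u)%R * diff_count A B u)%:R
     - (#|A|%:R * #|B|%:R) ^+ 2 / #|F|%:R| * 2
  <= excess R A B (- l^-1) + excess R A B (- l).
Proof.
move=> l0; have p0 := cardF_gt0 R F.
have inj : injective (fun y => l^-1 * y) by move=> u v /(mulfI (invr_neq0 l0)).
rewrite diff_count_ratio // natr_sum /excess [X in _ <= X + _](reindex_inj inj) /=.
set m : R := #|A|%:R * #|B|%:R / #|F|%:R.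
have E1 : \sum_y (richness A B (- l^-1, l^-1 * y))%:R = #|A|%:R * #|B|%:R :> R.
  rewrite -(sum_richnessR R A B (- l^-1)).
  by rewrite [RHS](reindex_inj inj).
have E2 := sum_richnessR R A B (- l).
have -> : \sum_y (richness A B (- l^-1, l^-1 * y)%R * richness A B (- l, y)%R)%:R -
    (#|A|%:R * #|B|%:R) ^+ 2 / #|F|%:R =
  \sum_y ((richness A B (- l^-1, l^-1 * y))%:R - m) * ((richness A B (- l, y))%:R - m) :> R.
  rewrite [RHS](eq_bigr (fun y => (richness A B (- l^-1, l^-1 * y)%R * richness A B (- l, y)%R)%:R
    - m * (richness A B (- l^-1, l^-1 * y))%:R - m * (richness A B (- l, y))%:R + m ^+ 2)); last first.
    by move=> y _; rewrite natrM; ring.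
  rewrite big_split !sumrB /= -!mulr_sumr E1 E2 sumr_const -[_ *+ _]mulr_natl /m.
  by field; rewrite gt_eqF.
rewrite -big_split /=.
apply: le_trans (ler_wpM2r _ (ler_norm_sum _ _ _)) _ => //.
rewrite mulr_suml; apply: ler_sum => y _.
set v := (_ - m); set w := (_ - m); rewrite normrM.
have := sqr_ge0 (`|v| - `|w|); rewrite -(real_normK (num_real v)) -(real_normK (num_real w)).
by move: (`|v|) (`|w|) => x y'; lra.
Qed.

Lemma diff_ratio_variance : exists c : nat, (0 < c)%N /\
  forall (R : rcfType) (F : finFieldType) (A B : {set F}),
  (forall i, (0 < i < #|F|)%N -> (i%:R : F) != 0) -> (#|A| <= #|B|)%N ->
  \sum_(l | l != 0) ((mult_corr (diff_count A B) l)%:R - (#|A|%:R * #|B|%:R) ^+ 2 / #|F|%:R) ^+ 2 <=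
    c%:R * (#|F|%:R * #|A|%:R ^+ 2 * #|B|%:R ^+ 2
            + #|A|%:R ^+ 3 * #|B|%:R ^+ 2 * Num.sqrt (#|F|%:R * #|B|%:R)) :> R.
Proof.
have [c [c0 Hc]] := excess_moment; exists (2 * c + 2)%N; split; first by lia.
move=> R F A B char AB; have := Hc R F A B char AB.
have p0 := cardF_gt0 R F; set M : R := _ / _.
set a : R := #|A|%:R; set b : R := #|B|%:R; set p : R := #|F|%:R.
have a0 : 0 <= a by rewrite ler0n.
have b0 : 0 <= b by rewrite ler0n.
have ab : a <= b by rewrite ler_nat.
set T2 := a ^+ 3 * _ * _; set T1 := p * _ * _ => Hs.
have T20 : 0 <= T2 by rewrite !mulr_ge0 ?exprn_ge0 ?sqrtr_ge0.
have T10 : 0 <= T1 by rewrite !mulr_ge0 ?exprn_ge0 // ltW.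
(* Here w is the contribution of u = 0, the square of the number of pairs with zero difference. It
   is at most |A|^2, so w^2 is at most |A|^2 |B|^2 and sums over l to at most the first main
   term. *)
have aux (z e e' w v : R) : z ^+ 2 * 4 <= (e + e') ^+ 2 -> w ^+ 2 <= v ->
    (z - w) ^+ 2 <= e ^+ 2 + e' ^+ 2 + 2 * v.
  by have := sqr_ge0 (z + w); have := sqr_ge0 (e - e'); lra.
have step l : l != 0 -> ((mult_corr (diff_count A B) l)%:R - M) ^+ 2 <=
    excess R A B (- l^-1) ^+ 2 + excess R A B (- l) ^+ 2 + 2 * (a ^+ 2 * b ^+ 2).
  move=> l0; have := diff_ratio_deviation R A B l0; rewrite mult_corr_full natrD natrX -/M.
  set x := (mult_corr _ l)%:R; set y := (diff_count _ _ _)%:R.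
  have y0 : 0 <= y :> R by rewrite ler0n.
  have ya : y <= a by rewrite ler_nat diff_count_leq.
  have := excess_ge0 R A B (- l^-1); have := excess_ge0 R A B (- l).
  set e1 := excess _ _ _ _; set e2 := excess _ _ _ _ => e10 e20.
  set z := x + _ - _ => Hz.
  have z2 : z ^+ 2 * 4 <= (e2 + e1) ^+ 2.
    rewrite -(real_normK (num_real z)).
    have -> : `|z| ^+ 2 * 4 = (`|z| * 2) ^+ 2 by ring.
    by rewrite ler_sqr ?nnegrE ?mulr_ge0 ?addr_ge0.
  have y4 : (y ^+ 2) ^+ 2 <= a ^+ 2 * b ^+ 2.
    by rewrite -exprMn ler_sqr ?nnegrE ?mulr_ge0 ?exprn_ge0 // expr2 ler_pM // (le_trans ya ab).
  have -> : x - M = z - y ^+ 2 by rewrite /z; ring.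
  exact: aux z2 y4.
apply: le_trans (ler_sum _ step) _; rewrite !big_split /=.
have ext (f : F -> F) : injective f -> \sum_(l | l != 0) excess R A B (f l) ^+ 2 <= c%:R * (T1 + T2).
  move=> fi; apply: le_trans Hs; rewrite [leRHS](reindex_inj fi) [leRHS](bigD1 0) //= lerDr.
  exact: sqr_ge0.
have e1 := ext (fun l => - l^-1) (inj_comp oppr_inj invr_inj).
have e2 := ext -%R oppr_inj.
have e3 : \sum_(l : F | l != 0) 2 * (a ^+ 2 * b ^+ 2) <= 2 * T1.
  apply: le_trans (_ : \sum_(l : F) 2 * (a ^+ 2 * b ^+ 2) <= _).
    rewrite [leRHS](bigD1 0) //= lerDr !mulr_ge0 ?exprn_ge0 //.
  by rewrite sumr_const -[_ *+ _]mulr_natl -/p /T1 le_eqVlt; apply/orP; left; apply/eqP; ring.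
apply: le_trans (lerD (lerD e1 e2) e3) _; rewrite natrD natrM.
move: (c%:R : R) => k; lra.
Qed.

(** * Size hypotheses and conclusion *)

Ltac pos := rewrite ?nnegrE; repeat first
  [apply: exprn_gt0 | apply: mulr_gt0 | apply: exprn_ge0 | apply: mulr_ge0]; by [|apply: ltW].

(* With [g] the inverse of the density constant and [q] the fifth root of [p]; raising to powers clears the square roots. *)
Lemma size_exponents (R : rcfType) (g q a b c d : R) :
  1 <= g -> 1 <= q -> 1 <= a -> a <= b -> 1 <= c -> c <= d -> b <= d ->
  q ^+ 12 <= g * (a * b * c * d) -> q ^+ 10 * d ^+ 2 <= a * b ^+ 4 * c ->
  (q ^+ 5 * a ^+ 2 * b ^+ 2 + a ^+ 3 * b ^+ 2 * Num.sqrt (q ^+ 5 * b)) *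
  (q ^+ 5 * c ^+ 2 * d ^+ 2 + c ^+ 3 * d ^+ 2 * Num.sqrt (q ^+ 5 * d)) * q ^+ 10
  <= 4 * g ^+ 2 * (a * b * c * d) ^+ 4.
Proof.
move=> g1 q1 a1 ab c1 cd bd HX HD.
have g0 : 0 < g by apply: lt_le_trans g1.
have q0 : 0 < q by apply: lt_le_trans q1.
have a0 : 0 < a by apply: lt_le_trans a1.
have b0 : 0 < b by apply: lt_le_trans ab.
have c0 : 0 < c by apply: lt_le_trans c1.
have d0 : 0 < d by apply: lt_le_trans cd.
set u := Num.sqrt (q ^+ 5 * b); set v := Num.sqrt (q ^+ 5 * d).
have u0 : 0 <= u by exact: sqrtr_ge0.
have v0 : 0 <= v by exact: sqrtr_ge0.
have u2 : u ^+ 2 = q ^+ 5 * b by rewrite sqr_sqrtr // mulr_ge0 ?exprn_ge0 // ltW.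
have v2 : v ^+ 2 = q ^+ 5 * d by rewrite sqr_sqrtr // mulr_ge0 ?exprn_ge0 // ltW.
set X := a * b * c * d in HX *.
have X0 : 0 < X by rewrite /X !mulr_gt0.
have HXn n : q ^+ (12 * n) <= g ^+ n * X ^+ n.
  by rewrite exprM -exprMn lerXn2r //; pos.
have qn m n : (m <= n)%N -> q ^+ m <= q ^+ n by move=> mn; rewrite ler_weXn2l.
have gn m n : (m <= n)%N -> g ^+ m <= g ^+ n by move=> mn; rewrite ler_weXn2l.
have t1 : q ^+ 20 <= g ^+ 2 * X ^+ 2 by apply: le_trans (HXn 2); apply: qn.
(* First term of (A, B) against second term of (C, D). Cubed, the exponent is 105, below 8 * 12 +
   10: eight uses of [HX] and one of [HD]. *)
have t2 : q ^+ 35 <= g ^+ 4 * (a ^+ 4 * b ^+ 4 * c ^+ 2 * d ^+ 3).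
  rewrite -(@ler_pXn2r _ 3); try pos.
  rewrite -(@ler_pM2r _ (d ^+ 2)) ?exprn_gt0 //.
  apply: (@le_trans _ _ (q ^+ 96 * (q ^+ 10 * d ^+ 2))).
    rewrite mulrA -exprD -exprM ler_pM2r ?exprn_gt0 //; exact: qn.
  apply: le_trans (ler_pM _ _ (HXn 8) HD) _; try pos.
  apply: (@le_trans _ _ (g ^+ 12 * (X ^+ 8 * (a * b ^+ 4 * c)))).
    rewrite -[leLHS]mulrA ler_pM2r; [exact: gn | pos].
  have -> : (g ^+ 4 * (a ^+ 4 * b ^+ 4 * c ^+ 2 * d ^+ 3)) ^+ 3 * d ^+ 2 =
    g ^+ 12 * (a ^+ 9 * b ^+ 12 * c ^+ 6 * d ^+ 8 * (a ^+ 3 * d ^+ 3)) by ring.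
  have -> : X ^+ 8 * (a * b ^+ 4 * c) = a ^+ 9 * b ^+ 12 * c ^+ 6 * d ^+ 8 * (c ^+ 3).
    by rewrite /X; ring.
  rewrite !ler_pM2l; try pos.
  apply: le_trans (_ : d ^+ 3 <= _); first by rewrite lerXn2r ?nnegrE ?(ltW c0) ?(ltW d0).
  apply: ler_peMl; [pos | exact: exprn_ege1].
have t3 : q ^+ 35 <= g ^+ 4 * (a ^+ 2 * b ^+ 3 * c ^+ 4 * d ^+ 4).
  apply: le_trans (le_trans (qn 35 (12 * 3)%N isT) (HXn 3)) _.
  apply: (@le_trans _ _ (g ^+ 4 * X ^+ 3)).
    rewrite ler_pM2r ?exprn_gt0 //; exact: gn.
  have -> : X ^+ 3 = a ^+ 2 * b ^+ 3 * c ^+ 3 * d ^+ 3 * a by rewrite /X; ring.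
  have -> : a ^+ 2 * b ^+ 3 * c ^+ 4 * d ^+ 4 = a ^+ 2 * b ^+ 3 * c ^+ 3 * d ^+ 3 * (c * d) by ring.
  rewrite !ler_pM2l; try pos.
  by apply: le_trans (le_trans ab bd) _; rewrite ler_peMl // ltW.
(* Second term against second term. Squared, the exponent is 60 = 5 * 12 with nothing to spare; this
   is the case that fixes the exponent 12/5. *)
have t4 : q ^+ 30 <= g ^+ 4 * (a ^+ 2 * b ^+ 3 * c ^+ 2 * d ^+ 3).
  rewrite -(@ler_pXn2r _ 2); try pos.
  rewrite -exprM; apply: le_trans (HXn 5) _.
  apply: (@le_trans _ _ (g ^+ 8 * X ^+ 5)).
    rewrite ler_pM2r ?exprn_gt0 //; exact: gn.
  have -> : X ^+ 5 = a ^+ 4 * b ^+ 5 * c ^+ 4 * d ^+ 5 * (a * c) by rewrite /X; ring.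
  have -> : (g ^+ 4 * (a ^+ 2 * b ^+ 3 * c ^+ 2 * d ^+ 3)) ^+ 2 =
    g ^+ 8 * (a ^+ 4 * b ^+ 5 * c ^+ 4 * d ^+ 5 * (b * d)) by ring.
  rewrite !ler_pM2l; try pos.
  by apply: ler_pM => //; pos.
have r1 : (q ^+ 5 * a ^+ 2 * b ^+ 2) * (q ^+ 5 * c ^+ 2 * d ^+ 2) * q ^+ 10 <= g ^+ 2 * X ^+ 4.
  have -> : (q ^+ 5 * a ^+ 2 * b ^+ 2) * (q ^+ 5 * c ^+ 2 * d ^+ 2) * q ^+ 10 = q ^+ 20 * X ^+ 2.
    by rewrite /X; ring.
  by rewrite (_ : g ^+ 2 * X ^+ 4 = g ^+ 2 * X ^+ 2 * X ^+ 2); [rewrite ler_pM2r ?exprn_gt0 | ring].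
have r2 : (q ^+ 5 * a ^+ 2 * b ^+ 2) * (c ^+ 3 * d ^+ 2 * v) * q ^+ 10 <= g ^+ 2 * X ^+ 4.
  rewrite -ler_sqr; try pos.
  have -> : (q ^+ 5 * a ^+ 2 * b ^+ 2 * (c ^+ 3 * d ^+ 2 * v) * q ^+ 10) ^+ 2 =
    q ^+ 30 * a ^+ 4 * b ^+ 4 * c ^+ 6 * d ^+ 4 * v ^+ 2 by ring.
  have -> : (g ^+ 2 * X ^+ 4) ^+ 2 =
    g ^+ 4 * (a ^+ 4 * b ^+ 4 * c ^+ 2 * d ^+ 3) * (a ^+ 4 * b ^+ 4 * c ^+ 6 * d ^+ 5).
    by rewrite /X; ring.
  rewrite v2 (_ : _ * (q ^+ 5 * d) = q ^+ 35 * (a ^+ 4 * b ^+ 4 * c ^+ 6 * d ^+ 5)); last by ring.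
  by rewrite ler_pM2r //; pos.
have r3 : (a ^+ 3 * b ^+ 2 * u) * (q ^+ 5 * c ^+ 2 * d ^+ 2) * q ^+ 10 <= g ^+ 2 * X ^+ 4.
  rewrite -ler_sqr; try pos.
  have -> : (a ^+ 3 * b ^+ 2 * u * (q ^+ 5 * c ^+ 2 * d ^+ 2) * q ^+ 10) ^+ 2 =
    q ^+ 30 * a ^+ 6 * b ^+ 4 * c ^+ 4 * d ^+ 4 * u ^+ 2 by ring.
  have -> : (g ^+ 2 * X ^+ 4) ^+ 2 =
    g ^+ 4 * (a ^+ 2 * b ^+ 3 * c ^+ 4 * d ^+ 4) * (a ^+ 6 * b ^+ 5 * c ^+ 4 * d ^+ 4).
    by rewrite /X; ring.
  rewrite u2 (_ : _ * (q ^+ 5 * b) = q ^+ 35 * (a ^+ 6 * b ^+ 5 * c ^+ 4 * d ^+ 4)); last by ring.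
  by rewrite ler_pM2r //; pos.
have r4 : (a ^+ 3 * b ^+ 2 * u) * (c ^+ 3 * d ^+ 2 * v) * q ^+ 10 <= g ^+ 2 * X ^+ 4.
  rewrite -ler_sqr; try pos.
  have -> : (a ^+ 3 * b ^+ 2 * u * (c ^+ 3 * d ^+ 2 * v) * q ^+ 10) ^+ 2 =
    q ^+ 20 * a ^+ 6 * b ^+ 4 * c ^+ 6 * d ^+ 4 * u ^+ 2 * v ^+ 2 by ring.
  have -> : (g ^+ 2 * X ^+ 4) ^+ 2 =
    g ^+ 4 * (a ^+ 2 * b ^+ 3 * c ^+ 2 * d ^+ 3) * (a ^+ 6 * b ^+ 5 * c ^+ 6 * d ^+ 5).
    by rewrite /X; ring.
  rewrite u2 v2 (_ : _ * (q ^+ 5 * d) = q ^+ 30 * (a ^+ 6 * b ^+ 5 * c ^+ 6 * d ^+ 5)); last by ring.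
  by rewrite ler_pM2r //; pos.
move: r1 r2 r3 r4; rewrite -[4 * _ * _]mulrA.
move: (q ^+ 5 * _ * _) (q ^+ 5 * _ * _) (_ * u) (_ * v) (q ^+ 10) (g ^+ 2 * _) => *; lra.
Qed.

Lemma diff_count_neq0 (F : finFieldType) (A B : {set F}) u :
  diff_count A B u != 0%N -> exists a b, [/\ a \in A, b \in B & u = a - b].
Proof.
rewrite /diff_count sum_nat_eq0 negb_forall => /existsP[[a b]]; rewrite negb_imply inE /=.
by case/andP=> /andP[aA bB]; rewrite eqb0 negbK => /eqP <-; exists a, b.
Qed.

Lemma mult_conv_neq0 (F : finFieldType) (A B C D : {set F}) x :
  mult_conv (diff_count A B) (diff_count C D) x != 0%N -> x \in diff_prod A B C D.
Proof.
rewrite /mult_conv sum_nat_eq0 negb_forall => /existsP[u]; rewrite negb_imply => /andP[u0].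
rewrite muln_eq0 negb_or => /andP[/diff_count_neq0[a [b [aA bB ua]]] /diff_count_neq0[c [d [cC dD xu]]]].
rewrite inE; apply/existsP; exists a; rewrite aA; apply/existsP; exists b; rewrite bB.
apply/existsP; exists c; rewrite cC; apply/existsP; exists d; rewrite dD /=.
by rewrite -ua -xu mulrC divfK.
Qed.

(** Cauchy-Schwarz on the support of the representation function, restricted to nonzero x. *)
Lemma card_diff_prod (F : finFieldType) (A B C D : {set F}) :
  ((\sum_(x | x != 0%R) mult_conv (diff_count A B) (diff_count C D) x) ^ 2 <=
   #|diff_prod A B C D| *
     \sum_(l | l != 0%R) mult_corr (diff_count A B) l * mult_corr (diff_count C D) l)%N.
Proof.
rewrite -sum_mult_conv_sqr; set f := mult_conv _ _; set E := diff_prod A B C D.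
have fE x : x \notin E -> f x = 0%N by apply: contraNeq => /mult_conv_neq0.
have EE (h : nat -> nat) : h 0%N = 0%N ->
    (\sum_(x | x != 0%R) h (f x) = \sum_(x in [set x in E | x != 0%R]) h (f x))%N.
  move=> h0; rewrite [RHS](eq_bigl (fun x => (x != 0) && (x \in E))); last first.
    by move=> x; rewrite inE andbC.
  rewrite [RHS]big_mkcondr; apply: eq_bigr => x _; case: ifPn => // /fE ->; exact: h0.
rewrite (EE id) // (EE (fun n => n ^ 2)%N) //; apply: leq_trans (sum_sqr_leq _ _) _.
by rewrite leq_mul2r subset_leq_card ?orbT //; apply/subsetP => x; rewrite inE => /andP[].
Qed.

(** The difference 0 has at most |A| representations, at most half of all pairs once |B| is at least
    2. *)
Lemma sum_diff_count_neq0 (F : finFieldType) (A B : {set F}) : (1 < #|B|)%N ->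
  (#|A| * #|B| <= 2 * \sum_(u | u != 0%R) diff_count A B u)%N.
Proof.
move=> B1; have := sum_diff_count A B; rewrite (bigD1 0%R) //= => E.
have := diff_count_leq A B 0; have : (#|A| * 2 <= #|A| * #|B|)%N by rewrite leq_mul2l B1 orbT.
by move: E; move: (\sum_(_ | _) _)%N (diff_count _ _ _) (_ * #|B|)%N => *; lia.
Qed.

(** M1 and M2 only bound the averages from above, so the cross terms of the expansion are bounded
    rather than cancelled; this costs the factor 2. *)
Lemma sum_mul_deviation (R : realFieldType) (F : finFieldType) (s1 s2 : F -> R) (M1 M2 : R) :
  0 <= M1 -> 0 <= M2 ->
  \sum_(l | l != 0) s1 l <= #|F|%:R * M1 -> \sum_(l | l != 0) s2 l <= #|F|%:R * M2 ->
  \sum_(l | l != 0) s1 l * s2 l <=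
    2 * #|F|%:R * (M1 * M2) + \sum_(l | l != 0) (s1 l - M1) * (s2 l - M2).
Proof.
move=> M10 M20 h1 h2.
have -> : \sum_(l | l != 0) (s1 l - M1) * (s2 l - M2) =
  \sum_(l | l != 0) s1 l * s2 l - M2 * (\sum_(l | l != 0) s1 l) - M1 * (\sum_(l | l != 0) s2 l)
  + (#|F|%:R - 1) * (M1 * M2).
  have -> : (#|F|%:R - 1) * (M1 * M2) = \sum_(l : F | l != 0) M1 * M2.
    have := sumr_const {: F} (M1 * M2); rewrite (bigD1 0) //= -[_ *+ _]mulr_natl => E.
    by rewrite mulrBl mul1r -E addrAC subrr add0r.
  rewrite !mulr_sumr -!sumrB -big_split /=; apply: eq_bigr => l _; ring.
have := ler_wpM2l M20 h1; have := ler_wpM2l M10 h2.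
have : 0 <= (#|F|%:R - 1) * (M1 * M2).
  rewrite !mulr_ge0 // subr_ge0 ler1n; apply/card_gt0P; by exists 0.
lra.
Qed.

Theorem diff_prod_bound : exists K : nat, (0 < K)%N /\
  forall (R : rcfType) (F : finFieldType) (A B C D : {set F}) (g q : R),
  (forall i, (0 < i < #|F|)%N -> (i%:R : F) != 0) ->
  (#|A| <= #|B|)%N -> (#|C| <= #|D|)%N -> (#|B| <= #|D|)%N ->
  1 <= g -> 0 < q -> q ^+ 5 = #|F|%:R ->
  q ^+ 12 <= g * (#|A| * #|B| * #|C| * #|D|)%:R ->
  (#|F| ^ 2 * #|D| ^ 2 <= #|A| * #|B| ^ 4 * #|C|)%N ->
  #|F|%:R <= K%:R * g * #|diff_prod A B C D|%:R.
Proof.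
have [k [k0 Hk]] := diff_ratio_variance; exists (64 * k)%N; split; first by rewrite muln_gt0.
move=> R F A B C D g q char AB CD BD g1 q0 q5 HX HD.
have g0 : 0 < g by apply: lt_le_trans g1.
have F1 : (1 < #|F|)%N by rewrite -cardsT; apply/card_gt1P; exists 0, 1; rewrite !inE eq_sym oner_neq0.
have X0 : (0 < #|A| * #|B| * #|C| * #|D|)%N.
  rewrite lt0n; apply: contraTneq HX => ->; rewrite mulr0 -ltNge exprn_gt0 //.
move: (X0); rewrite !muln_gt0 => /andP[/andP[/andP[A0 B0] C0] D0].
(* If |B| = 1 then |A| = 1, and the second size hypothesis would read p^2 |D|^2 <= |C|, which is
   impossible since |C| <= |D|. *)
have [B1 D1] : (1 < #|B|)%N /\ (1 < #|D|)%N.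
  suff : (1 < #|B|)%N by move=> B1; split=> //; apply: leq_trans BD.
  rewrite ltnNge; apply/negP => B1; have {B1}B1 : #|B| = 1%N by lia.
  move: HD AB; rewrite B1 exp1n muln1 => HD A1; have {A0 A1}A1 : #|A| = 1%N by lia.
  by move: HD; rewrite A1 mul1n; clear - F1 CD D0; nia.
have q1 : 1 <= q.
  rewrite leNgt; apply/negP => q1; have : q ^+ 5 < 1 by rewrite exprn_ilt1 // ltW.
  by rewrite q5 (ltr_nat R _ 1); lia.
have hAB := sum_diff_count_neq0 A B1; have hCD := sum_diff_count_neq0 C D1.
have := card_diff_prod A B C D; rewrite sum_mult_conv.
set S1 := mult_corr _; set S2 := mult_corr _.
have s1 := sum_mult_corr (diff_count A B); have s2 := sum_mult_corr (diff_count C D).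
rewrite -/S1 -/S2 !sum_diff_count in s1 s2.
move: hAB hCD s1 s2.
set u := (\sum_(_ | _) diff_count A B _)%N; set v := (\sum_(_ | _) diff_count C D _)%N.
rewrite -![(_ <= _)%N](ler_nat R) !(natrX, natrM) => hAB hCD s1 s2 hN.
have v1 := Hk R F A B char AB; have v2 := Hk R F C D char CD.
move: HX HD; rewrite -(ler_nat R) !(natrX, natrM) -/S1 -/S2 => HX HD.
have se := size_exponents (R := R) (g := g) (q := q) (a := #|A|%:R) (b := #|B|%:R) (c := #|C|%:R) (d := #|D|%:R).
rewrite !ler1n !ler_nat q5 in se.
have p0 := cardF_gt0 R F.
move: v1 v2 se hN hAB hCD s1 s2 HX HD q5.
rewrite !natr_sum -/S1 -/S2.
set p : R := #|F|%:R; set a : R := #|A|%:R; set b : R := #|B|%:R.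
set c : R := #|C|%:R; set d : R := #|D|%:R; set E : R := #|_|%:R.
set V1 := p * _ ^+ 2 * _ + _ * _; set V2 := p * c ^+ 2 * _ + _ * _.
move=> Hv1 Hv2 se hN hAB hCD s1 s2 HX HD q5.
have {}se : V1 * V2 * p ^+ 2 <= 4 * g ^+ 2 * (a * b * c * d) ^+ 4.
  by rewrite -q5 -exprM; apply: se => //; rewrite (exprM q 5 2) q5.
have pge1 : 1 <= p by rewrite ler1n ltnW.
have pn0 : p != 0 by rewrite gt_eqF.
have EE : a * b = p * (a * b / p) by field.
have cov := sum_mul_deviation (s1 := fun l => (S1 l)%:R) (s2 := fun l => (S2 l)%:R)
  (M1 := (a * b) ^+ 2 / p) (M2 := (c * d) ^+ 2 / p) .
have {}cov : \sum_(l | l != 0) (S1 l * S2 l)%:R <= 2 * p * (((a * b) ^+ 2 / p) * ((c * d) ^+ 2 / p)) + 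
   \sum_(l | l != 0) ((S1 l)%:R - (a * b) ^+ 2 / p) * ((S2 l)%:R - (c * d) ^+ 2 / p).
  under eq_bigr do rewrite natrM.
  by apply: cov; rewrite ?divr_ge0 ?sqr_ge0 ?ler0n //; rewrite mulrCA divff // mulr1.
set N := \sum_(_ | _) (_ * _)%:R in hN cov; set Y := \sum_(_ | _) (_ - _) * _ in cov.
have Y2 : Y ^+ 2 <= (k%:R * V1) * (k%:R * V2).
  apply: le_trans (cauchy_schwarz _ _ _) _; apply: ler_pM => //; apply: sumr_ge0 => l _; exact: sqr_ge0.
set X := a * b * c * d in HX se *.
have Xp : 0 < X by rewrite /X !mulr_gt0 ?ltr0n.
have k1 : 1 <= k%:R :> R by rewrite ler1n.
have kg : 0 < k%:R * g by rewrite mulr_gt0 ?ltr0n.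
have Yp : Y * p <= 2 * (k%:R * g) * X ^+ 2.
  have RHS0 : 0 <= 2 * (k%:R * g) * X ^+ 2 by rewrite mulr_ge0 ?exprn_ge0 ?(ltW Xp) // mulr_ge0 // ltW.
  have [Y0|Y0] := leP (Y * p) 0; first exact: le_trans RHS0.
  rewrite -ler_sqr ?nnegrE ?(ltW Y0) //.
  have -> : (Y * p) ^+ 2 = Y ^+ 2 * p ^+ 2 by ring.
  apply: (@le_trans _ _ (k%:R * V1 * (k%:R * V2) * p ^+ 2)); first by rewrite ler_pM2r // exprn_gt0.
  have -> : k%:R * V1 * (k%:R * V2) * p ^+ 2 = k%:R ^+ 2 * (V1 * V2 * p ^+ 2) by ring.
  have -> : (2 * (k%:R * g) * X ^+ 2) ^+ 2 = k%:R ^+ 2 * (4 * g ^+ 2 * X ^+ 4) by ring.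
  by rewrite ler_pM2l // exprn_gt0 ?ltr0n.
have Np : N * p <= 4 * (k%:R * g) * X ^+ 2.
  have : N * p <= (2 * p * ((a * b) ^+ 2 / p * ((c * d) ^+ 2 / p)) + Y) * p by rewrite ler_pM2r.
  have -> : (2 * p * ((a * b) ^+ 2 / p * ((c * d) ^+ 2 / p)) + Y) * p = 2 * X ^+ 2 + Y * p.
    by rewrite /X; field.
  have : X ^+ 2 <= k%:R * g * X ^+ 2.
    apply: ler_peMl; first by rewrite exprn_ge0 // ltW.
    by rewrite -[leLHS]mulr1 ler_pM.
  lra.
(* The factor 16 is the square of the two factors 2 lost by discarding zero differences; with the 4
   of [Np] it makes up the constant 64. *)
have U : X ^+ 2 <= 16 * (E * N).
  apply: (@le_trans _ _ (16 * (u%:R * v%:R) ^+ 2)); last by rewrite ler_pM2l // natr_sum natr_sum.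
  have -> : 16 * (u%:R * v%:R) ^+ 2 = ((2 * u%:R) * (2 * v%:R)) ^+ 2 :> R by ring.
  rewrite ler_sqr ?nnegrE ?(ltW Xp) ?mulr_ge0 ?ler0n // /X -mulrA.
  by rewrite ler_pM ?mulr_ge0 ?ler0n // /u /v natr_sum.
rewrite -(@ler_pM2r _ (X ^+ 2)) ?exprn_gt0 // mulrC.
apply: (@le_trans _ _ (16 * (E * N) * p)); first by rewrite ler_pM2r.
have -> : 16 * (E * N) * p = 16 * E * (N * p) by ring.
have -> : 64 * k%:R * g * E * X ^+ 2 = 16 * E * (4 * (k%:R * g) * X ^+ 2) by ring.
by apply: ler_wpM2l => //; rewrite mulr_ge0 // ler0n.
Qed.

Theorem theoremF (R : realType) (L : R) (L_gt0 : 0 < L) :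
  exists c : R, 0 < c /\
    forall (p : nat) (p_prime : prime p) (A B C D : {set 'F_p}),
      (#|A| <= #|B|)%N -> (#|C| <= #|D|)%N -> (#|B| <= #|D|)%N ->
      (#|A| * #|B| * #|C| * #|D|)%:R > L * p%:R `^ (12%:R / 5%:R) ->
      (#|A| * #|B| ^ 4 * #|C| >= p ^ 2 * #|D| ^ 2)%N ->
      #|diff_prod A B C D|%:R > c * p%:R.
Proof.
have [K [K0 HK]] := diff_prod_bound.
(* Ensures both g >= 1 and g L >= 1, whatever the size of L. *)
pose g := 1 + L^-1.
have g1 : 1 <= g by rewrite lerDl invr_ge0 ltW.
have gL : 1 <= g * L by rewrite mulrDl mulVf ?gt_eqF // lerDr mul1r ltW.
have Kg : 0 < K%:R * g by rewrite mulr_gt0 ?ltr0n // (lt_le_trans _ g1).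
(* The factor 2 turns the weak inequality of [diff_prod_bound] into a strict one. *)
exists (2 * (K%:R * g))^-1; split; first by rewrite invr_gt0 mulr_gt0.
move=> p p_prime A B C D AB CD BD HX HD.
have p0 : 0 < p%:R :> R by rewrite ltr0n prime_gt0.
(* With the fifth root of p as a variable, all exponents become integers. *)
pose q : R := p%:R `^ 5%:R^-1.
have qn n : q ^+ n = p%:R `^ (n%:R / 5%:R).
  by rewrite -powR_mulrn ?powR_ge0 // -powRrM mulrC.
have char i : (0 < i < #|'F_p|)%N -> (i%:R : 'F_p) != 0.
  rewrite card_Fp // => /andP[i0 ip]; rewrite -(dvdn_pcharf (pchar_Fp p_prime)).
  by apply: contraL ip; rewrite -leqNgt; apply: dvdn_leq.
have q5 : q ^+ 5 = #|'F_p|%:R by rewrite qn card_Fp // divff ?pnatr_eq0 // powRr1 // ltW.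
have q12 : q ^+ 12 <= g * (#|A| * #|B| * #|C| * #|D|)%:R.
  rewrite qn; apply: (@le_trans _ _ (g * (L * p%:R `^ (12%:R / 5%:R)))).
    by rewrite mulrA ler_peMl // powR_ge0.
  by rewrite ler_wpM2l ?(le_trans ler01 g1) // ltW.
have := HK R 'F_p A B C D g q char AB CD BD g1 (powR_gt0 _ p0) q5 q12.
rewrite card_Fp // => /(_ HD); set E := #|_|%:R => HE.
have E0 : 0 < K%:R * g * E := lt_le_trans p0 HE.
rewrite [ltLHS]mulrC ltr_pdivrMr; last by rewrite mulr_gt0.
by apply: le_lt_trans HE _; move: E0; rewrite [E * _]mulrC -mulrA; lra.
Qed.
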